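(* Let $\sigma\ge0$ and $T\in(0,\infty]$, and let $k,\mu>0$, $g\ge 0$, $\rho_\pm\in\mathbb{R}$, $\Delta_\rho:=g(\rho_--\rho_+)$. Let $$f\in C^1((0,T),L_2(\mathbb{R}))\cap C([0,T),L_2(\mathbb{R})),\qquad f(t)\in H^5(\mathbb{R})\ \text{ for all } t\in(0,T).$$ The following are equivalent. (i) There exist, for all $t\in(0,T)$, $v_\pm(t)\in C(\overline{\Omega_\pm(t)})\cap C^1(\Omega_\pm(t))$ (with values in $\mathbb{R}^2$) and $p_\pm(t)\in C^1(\overline{\Omega_\pm(t)})\cap C^2(\Omega_\pm(t))$ such that $(f,v_\pm,p_\pm)$ solves the Muskat problem $$\begin{cases}\operatorname{div}v_\pm(t)=0 & \text{in }\Omega_\pm(t),\\ v_\pm(t)=-\frac{k}{\mu}\big(\nabla p_\pm(t)+(0,\rho_\pm g)\big)&\text{in }\Omega_\pm(t),\\ p_+(t)-p_-(t)=\sigma\kappa(f(t))&\text{on }[y=f(t,x)],\\ \langle v_+(t)|\nu(t)\rangle=\langle v_-(t)|\nu(t)\rangle&\text{on }[y=f(t,x)],\\ f(t,x)\to0&\text{for }|x|\to\infty,\\ v_\pm(t,x,y)\to0&\text{for }|(x,y)|\to\infty,\\ \partial_tf(t)=\langle v_\pm(t)|(-f'(t),1)\rangle&\text{on }[y=f(t,x)]\end{cases}$$ for all $t\in(0,T)$, and $f(0)=f_0$. (ii) $f$ solves the evolution problem $$\begin{aligned}\partial_tf(t,x)=&\ \frac{\sigma k}{2\pi\mu}f'(t,x)\,\mathrm{PV}\!\int_{\mathbb{R}}\frac{f(t,x)-f(t,x-y)}{y^2+(f(t,x)-f(t,x-y))^2}(\kappa(f))'(t,x-y)\,dy\\&+\frac{\sigma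 k}{2\pi\mu}\,\mathrm{PV}\!\int_{\mathbb{R}}\frac{y}{y^2+(f(t,x)-f(t,x-y))^2}(\kappa(f))'(t,x-y)\,dy\\&+\frac{\Delta_\rho k}{2\pi\mu}\,\mathrm{PV}\!\int_{\mathbb{R}}\frac{y(f'(t,x)-f'(t,x-y))}{y^2+(f(t,x)-f(t,x-y))^2}\,dy\end{aligned}$$ for $t\in(0,T)$, $x\in\mathbb{R}$, and $f(0)=f_0$.
   Context: $\Omega_-(t):=\{(x,y)\in\mathbb{R}^2:y<f(t,x)\}$, $\Omega_+(t):=\{(x,y):y>f(t,x)\}$, $[y=f(t,x)]$ is their common boundary (the graph of $f(t)$), $\nu(t)$ is the unit normal at $[y=f(t,x)]$ pointing into $\Omega_+(t)$, $\langle\cdot|\cdot\rangle$ is the Euclidean inner product on $\mathbb{R}^2$, $f'=\partial_xf$, and $\kappa(f)=f''/(1+f'^2)^{3/2}$ is the curvature of the graph. $\mathrm{PV}$ denotes the principal value (at $0$ and/or at infinity, as needed), $\lim_{\delta\to0}\int_{\delta<|y|<1/\delta}$. Here $v_\pm$ are the velocities and $p_\pm$ the pressures of the two fluids, $\rho_\pm$ their densities, $k$ the permeability, $\mu$ the common viscosity, $g$ gravity. Conditions with the subscript $\pm$ are required for both signs. The function $f_0$ is the given initial datum. *)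

(* Defs.v *)
From HB Require Import structures.
From mathcomp Require Import all_boot all_order all_algebra.
From mathcomp Require Import all_classical all_reals all_analysis.

Set Implicit Arguments.
Unset Strict Implicit.
Unset Printing Implicit Defensive.

Import Order.TTheory GRing.Theory Num.Theory.
Import numFieldNormedType.Exports.

Local Open Scope ring_scope.
Local Open Scope classical_set_scope.

Section FunctionSpaces.
Context {R : realType}.

Definition leb := @lebesgue_measure R.

(* Elements of L_2 are represented by square-integrable functions; equality of
   elements of L_2 is equality almost everywhere. *)
Definition L2 (u : R -> R) : Prop := u \in Lfun leb 2%:E.

Definition L2norm (u : R -> R) : \bar R := ('N[leb]_2%:E [EFin \o u])%E.

Definition test_function (phi : R -> R) : Prop :=
  (forall n x, derivable (derive1n n phi) x 1) /\
  (exists M : R, forall x, M < `|x| -> phi x = 0).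

Definition weak_derivative (j : nat) (u w : R -> R) : Prop :=
  forall phi : R -> R, test_function phi ->
    \int[leb]_x (u x * derive1n j phi x) = (-1) ^+ j * \int[leb]_x (w x * phi x).

(* H^m(R) *)
Definition Sobolev (m : nat) (u : R -> R) : Prop :=
  L2 u /\
  forall j : nat, (j <= m)%N -> exists2 w : R -> R, L2 w & weak_derivative j u w.

(* C(D, L_2(R)), D a set of times *)
Definition L2_continuous_on (D : set R) (u : R -> R -> R) : Prop :=
  (forall t, D t -> L2 (u t)) /\
  forall t, D t ->
    L2norm (fun x => u s x - u t x) @[s --> within D (nbhs t)] --> 0%E.

Definition is_L2_derivative (u : R -> R -> R) (t : R) (w : R -> R) : Prop :=
  L2norm (fun x => h^-1 * (u (t + h) x - u t x) - w x) @[h --> 0^'] --> 0%E.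

(* u belongs to C^1(D, L_2(R)), D open, and its derivative is ut; each ut t is
   thus determined up to a null set. *)
Definition L2_C1_on (D : set R) (u ut : R -> R -> R) : Prop :=
  [/\ forall t, D t -> L2 (u t),
      forall t, D t -> is_L2_derivative u t (ut t) &
      L2_continuous_on D ut].

Definition annulus (delta : R) : set R := [set y | delta < `|y| < delta^-1].

Definition PV_exists (F : R -> R) : Prop :=
  (forall delta, 0 < delta -> leb.-integrable (annulus delta) (EFin \o F)) /\
  cvg (\int[leb]_(y in annulus delta) F y @[delta --> 0^'+]).

(* The value is meaningful only under PV_exists F. *)
Definition PV (F : R -> R) : R :=
  lim (\int[leb]_(y in annulus delta) F y @[delta --> 0^'+]).

End FunctionSpaces.

Section Plane.
Context {R : realType}.
Implicit Types (Omega : set (R * R)) (p : R * R -> R) (v : R * R -> R * R).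

Definition dot (a b : R * R) : R := a.1 * b.1 + a.2 * b.2.
Definition enorm (a : R * R) : R := Num.sqrt (dot a a).

Definition dx p (z : R * R) : R := 'D_((1, 0) : R * R) p z.
Definition dy p (z : R * R) : R := 'D_((0, 1) : R * R) p z.
Definition grad p (z : R * R) : R * R := (dx p z, dy p z).
Definition divergence v (z : R * R) : R :=
  dx (fun w => (v w).1) z + dy (fun w => (v w).2) z.

(* C^1(Omega) and C^2(Omega), Omega open *)
Definition C1_in Omega p : Prop :=
  forall z, Omega z ->
    [/\ derivable p z ((1, 0) : R * R), derivable p z ((0, 1) : R * R),
        {for z, continuous (dx p)} & {for z, continuous (dy p)}].

Definition C2_in Omega p : Prop :=
  [/\ C1_in Omega p, C1_in Omega (dx p) & C1_in Omega (dy p)].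

(* C^1 up to the boundary: the function and its first-order derivatives on Omega
   extend continuously to the closure. *)
Definition C1_closure Omega p : Prop :=
  [/\ C1_in Omega p,
      {within closure Omega, continuous p} &
      exists q : R * R -> R * R,
        {within closure Omega, continuous q} /\
        forall z, Omega z -> q z = grad p z].

Definition vanishes_at_infinity Omega v : Prop :=
  forall eps, 0 < eps -> exists M, forall z,
    closure Omega z -> M < enorm z -> enorm (v z) < eps.

End Plane.

Section Muskat.
Context {R : realType}.
Implicit Types (F Ft : R -> R) (k visc sigma g rho : R).

Definition above F : set (R * R) := [set z | F z.1 < z.2].
Definition below F : set (R * R) := [set z | z.2 < F z.1].

Definition curvature F (x : R) : R :=
  derive1n 2 F x / (1 + derive1 F x ^+ 2) `^ (3 / 2).

(* unit normal to the graph of F at (x, F x), pointing into above F *)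
Definition unit_normal F (x : R) : R * R :=
  (Num.sqrt (1 + derive1 F x ^+ 2))^-1 *: ((- derive1 F x, 1) : R * R).

Definition phase_regularity (Omega : set (R * R)) (v : R * R -> R * R)
    (p : R * R -> R) : Prop :=
  [/\ {within closure Omega, continuous v},
      C1_in Omega (fun z => (v z).1) /\ C1_in Omega (fun z => (v z).2),
      C1_closure Omega p &
      C2_in Omega p].

Definition phase_equations (Omega : set (R * R)) k visc g rho
    (v : R * R -> R * R) (p : R * R -> R) : Prop :=
  [/\ forall z, Omega z -> divergence v z = 0,
      forall z, Omega z -> v z = - (k / visc) *: (grad p z + (0, rho * g)) &
      vanishes_at_infinity Omega v].

(* The equation for the time derivative Ft holds in L_2, i.e. a.e. in x. *)
Definition kinematic_condition F Ft (v : R * R -> R * R) : Prop :=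
  {ae leb, forall x, Ft x = dot (v (x, F x)) (- derive1 F x, 1)}.

(* The Muskat problem at a fixed time, F being the profile of the interface at
   that time and Ft its time derivative. *)
Record muskat_problem k visc sigma g rhop rhom F Ft
    (vp vm : R * R -> R * R) (pp pm : R * R -> R) : Prop := MuskatProblem {
  muskat_above : phase_equations (above F) k visc g rhop vp pp;
  muskat_below : phase_equations (below F) k visc g rhom vm pm;
  muskat_pressure_jump :
    forall x, pp (x, F x) - pm (x, F x) = sigma * curvature F x;
  muskat_normal_velocity :
    forall x, dot (vp (x, F x)) (unit_normal F x)
            = dot (vm (x, F x)) (unit_normal F x);
  muskat_flat_at_infinity :
    F x @[x --> +oo] --> (0 : R) /\ F x @[x --> -oo] --> (0 : R);
  muskat_kinematic_above : kinematic_condition F Ft vp;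
  muskat_kinematic_below : kinematic_condition F Ft vm }.

Definition denominator F (x y : R) : R := y ^+ 2 + (F x - F (x - y)) ^+ 2.

Definition capillary_integrand1 F (x y : R) : R :=
  (F x - F (x - y)) / denominator F x y * derive1 (curvature F) (x - y).
Definition capillary_integrand2 F (x y : R) : R :=
  y / denominator F x y * derive1 (curvature F) (x - y).
Definition gravity_integrand F (x y : R) : R :=
  y * (derive1 F x - derive1 F (x - y)) / denominator F x y.

Definition evolution_rhs k visc sigma Delta_rho F (x : R) : R :=
  sigma * k / (2 * pi * visc) * derive1 F x * PV (capillary_integrand1 F x)
  + sigma * k / (2 * pi * visc) * PV (capillary_integrand2 F x)
  + Delta_rho * k / (2 * pi * visc) * PV (gravity_integrand F x).

(* The principal values exist for every x; the equation for the time derivative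
   Ft holds in L_2, i.e. a.e. in x. *)
Definition evolution_problem k visc sigma Delta_rho F Ft : Prop :=
  (forall x, [/\ PV_exists (capillary_integrand1 F x),
                 PV_exists (capillary_integrand2 F x) &
                 PV_exists (gravity_integrand F x)]) /\
  {ae leb, forall x, Ft x = evolution_rhs k visc sigma Delta_rho F x}.

End Muskat.

(* Main.v *)
Require Import Defs.
From HB Require Import structures.
From mathcomp Require Import all_boot all_order all_algebra.
From mathcomp Require Import all_classical all_reals all_analysis.
From mathcomp Require Import measurable_realfun lebesgue_integral_under.
From mathcomp Require Import ring lra.
Set Implicit Arguments.
Unset Strict Implicit.
Unset Printing Implicit Defensive.
Import Order.TTheory GRing.Theory Num.Theory.
Import numFieldNormedType.Exports.
Local Open Scope ring_scope.
Local Open Scope classical_set_scope.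

(** Fix a time t.  Incompressibility and Darcy's law make the velocity v = (v1, v2)
    divergence and curl free in each phase, that is, v1 - i v2 is holomorphic there.
    On the graph let T = v1 + f' v2 and N = v2 - f' v1 be the tangential and normal
    components, up to the length element.  Differentiating the pressure jump
    p+ - p- = sigma kappa(f) along the graph and inserting Darcy's law
    ([darcy_trace]), one sees that the Muskat problem asks for a field that is
    holomorphic in both phases and vanishes at infinity, with N continuous across the
    graph, with the jump of T equal to
    omega = (k / mu) (Delta_rho f' - sigma kappa(f)'), and with f_t = N.

    Such a field is determined by omega.  In one phase, the Cauchy integral theorem
    on the region between a small box around a boundary point and a large one gives
    Plemelj's formula ([plemelj_phase]): the principal value of the Cauchy kernel
    against the boundary values is half a residue, pi times the value at the point up
    to a factor of modulus 1.  In the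
    difference of the formulas for the two phases N cancels and omega remains
    ([two_phase_PV]), so that N is the sum of singular integrals with density omega.
    Up to a kernel that is the derivative of a logarithm and has principal value 0
    ([log_kernel_PV]), this sum is the right-hand side of the evolution equation
    ([evolution_value]).  This gives the passage from (i) to (ii).

    Conversely, the Cauchy integral with density omega is such a field
    ([cauchy_two_phase]).  Integrating by parts along the graph, where the derivative
    of the density is square integrable, its gradient is found to blow up at most
    like the inverse square root of the distance to the graph ([M_bound]), so it
    extends continuously to the graph; rescaling the kernels at a boundary point
    gives the jumps ([jump], [kap_tangential], [kap_normal]); and it vanishes at
    infinity because omega is square integrable ([far_field]).  Its potentials,
    corrected by gravity and a constant, are the pressures ([evolution_muskat]).  The
    same construction with density f' or kappa(f)' provides the existence of the
    single principal values.

    Both phases are mapped to the upper half-plane by (x, eta) -> (x, f x + e eta)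
    with e = 1 or e = -1.  The smoothness that is needed, namely that f is four times
    continuously differentiable with bounded and square integrable derivatives, is
    extracted from f in H^5 by testing with smooth cut-offs and passing to Lebesgue
    points ([sobolev5_profile]). *)

Notation itg D g :=
  ((@lebesgue_measure _).-integrable D%classic (EFin \o g)) (only parsing).
Notation integ D g := (\int[@lebesgue_measure _]_(x in D%classic) g x) (only parsing).
Notation cont_on a b g :=
  (forall x, a <= x <= b -> {for x, continuous g}) (only parsing).

(** * Integration on the line *)
Section Integrals.
Context {R : realType}.
Local Notation mu := (@lebesgue_measure R).
Implicit Types (D : set R) (g h G : R -> R) (a b c : R).

Lemma itg_le D g h : measurable D -> measurable_fun D g ->
  (forall x, D x -> `|g x| <= h x) -> itg D h -> itg D g.
Proof.
move=> mD mg gh ih; apply: le_integrable ih => //; first exact/measurable_EFinP.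
by move=> x Dx /=; rewrite lee_fin (le_trans (gh _ Dx)) ?ler_norm.
Qed.

Lemma itgD D g h : measurable D -> itg D g -> itg D h ->
  itg D (fun x => g x + h x).
Proof. by move=> mD ig ih; exact: (@integrableD _ _ R mu D mD _ _ ig ih). Qed.

Lemma itgB D g h : measurable D -> itg D g -> itg D h ->
  itg D (fun x => g x - h x).
Proof. by move=> mD ig ih; exact: (@integrableB _ _ R mu D mD _ _ ig ih). Qed.

Lemma itgZ D c g : measurable D -> itg D g -> itg D (fun x => c * g x).
Proof. by move=> mD ig; exact: (@integrableZl _ _ R mu D mD c _ ig). Qed.

Lemma itg_norm D g : measurable D -> itg D g -> itg D (fun x => `|g x|).
Proof. by move=> mD ig; exact: (@integrable_norm _ _ R mu D _ ig). Qed.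

Lemma itg_meas D g : itg D g -> measurable_fun D g.
Proof. by case/integrableP => /measurable_EFinP. Qed.

Lemma itg_sub D E g : measurable D -> measurable E -> D `<=` E ->
  itg E g -> itg D g.
Proof. by move=> mD mE DE; apply: integrableS. Qed.

Lemma continuous_itg a b g : cont_on a b g -> itg `[a, b] g.
Proof.
move=> cg; apply: continuous_compact_integrable; first exact: segment_compact.
by apply: continuous_in_subspaceT => x; rewrite inE /= in_itv => /cg.
Qed.

Lemma cont_meas g : continuous g -> measurable_fun setT g.
Proof. by move=> cg; exact: continuous_measurable_fun. Qed.

Lemma integ_itv_same a g : integ `[a, a] g = 0.
Proof. by rewrite set_itv1 Rintegral_set1. Qed.

Lemma FTC2 a b g G : a <= b -> cont_on a b g -> cont_on a b G ->
  (forall x, a < x < b -> is_derive x 1 G (g x)) ->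
  integ `[a, b] g = G b - G a.
Proof.
rewrite le_eqVlt => /predU1P[<- _ _ _|ab cg cG dG].
  by rewrite integ_itv_same subrr.
rewrite /Rintegral (@continuous_FTC2 _ _ G)//.
- by apply: continuous_in_subspaceT => x; rewrite inE /= in_itv => /cg.
- split.
  + by move=> x; rewrite in_itv /= => /dG [].
  + by apply: cvg_at_right_filter; apply: cG; rewrite lexx ltW.
  + by apply: cvg_at_left_filter; apply: cG; rewrite lexx ltW.
- by move=> x; rewrite in_itv /= => /dG; rewrite derive1E => -[_ ->].
Qed.

Lemma integ_bound a b g (M : R) : a <= b -> cont_on a b g ->
  (forall x, a <= x <= b -> `|g x| <= M) ->
  `|integ `[a, b] g| <= M * (b - a).
Proof.
move=> ab cg gM; apply: (le_trans (le_normr_Rintegral _ _)) => //.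
  exact: continuous_itg.
have -> : M * (b - a) = \int[mu]_(x in `[a, b]) M.
  rewrite Rintegral_cst//. 
  transitivity (M * fine (b - a)%:E) => //; congr (M * fine _).
  apply/esym/(etrans (lebesgue_measure_itv `[a, b]%R)); rewrite /= lte_fin.
  by case: ltgtP ab => //= -> _; rewrite subrr.
apply: le_Rintegral => //.
- exact/itg_norm/continuous_itg.
- by apply: continuous_itg => x _; exact: (@cst_continuous R R M x).
Qed.

Lemma integ_chasles a b c g : a <= b <= c -> cont_on a c g ->
  integ `[a, c] g = integ `[a, b] g + integ `[b, c] g.
Proof.
move=> /andP[ab bc] cg; apply/eqP; rewrite addrC -subr_eq; apply/eqP.
rewrite Rintegral_itvB ?bnd_simp//; last exact: continuous_itg.
apply: Rintegral_itv_obnd_cbnd.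
apply: (@itg_sub _ `[a, c]) => //; last exact: continuous_itg.
by apply: subset_itv; rewrite bnd_simp.
Qed.

Definition prim g x :=
  if 0 <= x then integ `[0, x] g else - integ `[x, 0] g.

Lemma prim_shift g a x : continuous g -> a <= 0 -> a <= x ->
  prim g x = integ `[a, x] g - integ `[a, 0] g.
Proof.
move=> cg a0 ax; rewrite /prim; case: ifPn => [x0|]; last rewrite -ltNge => x0.
  have -> : integ `[a, x] g = integ `[a, 0] g + integ `[0, x] g; last by ring.
  by apply: integ_chasles => [|*]; [exact/andP|exact: cg].
have -> : integ `[a, 0] g = integ `[a, x] g + integ `[x, 0] g; last by ring.
by apply: integ_chasles => [|*]; [rewrite ax ltW|exact: cg].
Qed.

Lemma is_derive_prim g (x : R) : continuous g -> is_derive x 1 (prim g) (g x).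
Proof.
move=> cg; pose a := Num.min 0 x - 1.
have a0 : a <= 0 by rewrite /a lerBlDr; case: (leP 0 x); lra.
have ax : a < x by rewrite /a ltrBlDr; case: (leP 0 x); lra.
have ix : itg `[a, x + 1] g by apply: continuous_itg => *; exact: cg.
have [dF F'] := @continuous_FTC1_closed R g a x (x + 1) ltac:(lra) ix ax (cg x).
rewrite derive1E in F'.
have E : \near x, prim g x = (integ `[a, x] g) - (integ `[a, 0] g).
  by near=> y; apply: prim_shift => //; near: y; apply: (cvgr_ge x) => //; exact: cvg_id.
have D1 : is_derive x 1 (fun x => integ `[a, x] g - integ `[a, 0] g) (g x).
  have H : is_derive x 1 (fun x => integ `[a, x] g) (g x) by apply: DeriveDef.
  have := is_deriveB H (is_derive_cst (integ `[a, 0] g) x 1).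
  by rewrite subr0.
by apply: near_eq_is_derive D1; near do apply/esym.
Unshelve. all: by end_near. Qed.

End Integrals.
Section Dominated.
Context {R : realType}.
Local Notation mu := (@lebesgue_measure R).
Implicit Types (D : set R) (g h G : R -> R) (a b c : R).

Lemma dct D (h_ : nat -> R -> R) h G : measurable D ->
  (forall n, measurable_fun D (h_ n)) ->
  (forall x, D x -> h_ n x @[n --> \oo] --> h x) ->
  itg D G -> (forall n x, D x -> `|h_ n x| <= G x) ->
  itg D h /\ (integ D (h_ n) @[n --> \oo] --> integ D h).
Proof.
move=> mD mh hh iG hG.
have hh' x : D x -> (EFin \o h_ n) x @[n --> \oo] --> (EFin \o h) x.
  by move=> Dx; apply: cvg_EFin; [exact: nearW|exact: hh].
have mh' n : measurable_fun D (EFin \o h_ n) by exact/measurable_EFinP.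
have mhl : measurable_fun D (EFin \o h).
  by apply: emeasurable_fun_cvg hh' => n; exact: mh'.
have [||ih _ C] := @dominated_convergence _ _ R mu D mD (fun n => EFin \o h_ n)
  (EFin \o h) (EFin \o G) mh' mhl _ iG _.
- by apply: aeW => x; exact: hh'.
- by apply: aeW => x n Dx; rewrite lee_fin hG.
split=> //; apply: fine_cvg; rewrite fineK//.
by apply: integrable_fin_num.
Qed.

(** By contradiction, with points chosen at distance less than 1 / (n + 1). *)
Lemma cvg_seqP (T : pseudoMetricType R) (p : T) (H : T -> R) (l : R) :
  (forall u : nat -> T, u n @[n --> \oo] --> p -> H (u n) @[n --> \oo] --> l) ->
  H x @[x --> p] --> l.
Proof.
move=> Hu; apply/cvgrPdist_lt => eps eps0; apply: contrapT => nH.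
have key n : exists x, ball p n.+1%:R^-1 x /\ ~~ (`|l - H x| < eps).
  apply: contrapT => nex; apply: nH.
  apply/nbhs_ballP; exists n.+1%:R^-1 => //= x px.
  by apply: contrapT => /negP nlt; apply: nex; exists x.
have [u up] := choice key.
have : u n @[n --> \oo] --> p.
  apply/cvg_ballP => e e0; near=> n.
  apply: (le_ball _ (up n).1); rewrite ltW//.
  by near: n; exact: near_infty_natSinv_lt (PosNum e0).
move=> /Hu /cvgrPdist_lt /(_ _ eps0) [N _ /(_ N (leqnn _))] /=.
by apply/negP; exact: (up N).2.
Unshelve. all: by end_near. Qed.


Lemma cvg_param (T : pseudoMetricType R) (k : T -> R -> R) (p : T) D G :
  measurable D -> itg D G ->
  (\forall z \near p, measurable_fun D (k z)) ->
  (\forall z \near p, forall s, D s -> `|k z s| <= G s) ->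
  (forall s, D s -> k z s @[z --> p] --> k p s) ->
  integ D (k z) @[z --> p] --> integ D (k p).
Proof.
move=> mD iG mk kG kp; apply: cvg_seqP => u up.
have [N _ HN] : \forall n \near \oo, measurable_fun D (k (u n)) /\
    forall s, D s -> `|k (u n) s| <= G s.
  by near=> n; split; near: n; [exact: up mk|exact: up kG].
rewrite -(cvg_shiftn N).
have H n := HN (n + N)%N (leq_addl _ _).
have [] // := @dct D (fun n => k (u (n + N)%N)) (k p) G mD (fun n => (H n).1) _ iG
  (fun n => (H n).2).
move=> s Ds; have := cvg_comp _ _ up (kp s Ds).
by rewrite -(cvg_shiftn N).
Unshelve. all: by end_near. Qed.

Lemma is_derive_param (k dk : R -> R -> R) D G (t0 rho : R) :
  measurable D -> 0 < rho -> itg D G ->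
  (forall t, `|t - t0| < rho -> itg D (k t)) ->
  (forall t s, `|t - t0| < rho -> D s -> is_derive t 1 (k ^~ s) (dk t s)) ->
  (forall t s, `|t - t0| < rho -> D s -> `|dk t s| <= G s) ->
  is_derive t0 1 (fun t => integ D (k t)) (integ D (dk t0)).
Proof.
move=> mD rho0 iG ik dkE dkG.
have I t : t \in `]t0 - rho, t0 + rho[%R -> `|t - t0| < rho.
  by rewrite in_itv /= ltr_distlC => /andP[? ?]; apply/andP; split; lra.
have tI : t0 \in `]t0 - rho, t0 + rho[%R by rewrite in_itv/=; apply/andP; split; lra.
have dE t s : t \in `]t0 - rho, t0 + rho[%R -> D s -> partial1of2 k t s = dk t s.
  by move=> /I tt Ds; rewrite partial1of2E; have [_ ->] := dkE _ _ tt Ds.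
have GE (s : R) : D s -> `|G s| = G s.
  move=> Ds; rewrite ger0_norm//; apply: le_trans (dkG t0 s _ Ds) => //.
  by rewrite subrr normr0.
have A1 : forall x, `]t0 - rho, t0 + rho[%classic x -> itg D (k x).
  by move=> t /I; exact: ik.
have A2 : forall x y, `]t0 - rho, t0 + rho[%classic x -> D y ->
    derivable (k ^~ y) x 1.
  by move=> t s /I tt Ds; have [] := dkE t s tt Ds.
have A3 : forall x y, `]t0 - rho, t0 + rho[%classic x -> D y ->
    `|partial1of2 k x y| <= `|G y|.
  by move=> t s tt Ds; rewrite dE// GE// dkG//; exact: I.
have A4 := itg_norm mD iG.
split.
  exact: (@derivable_under_integral _ _ _ mu k D mD t0 _ _ tI A1 A2 (fun s => `|G s|)
    (fun=> normr_ge0 _) A4 A3).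
rewrite -derive1E (@differentiation_under_integral _ _ _ mu k D mD t0 _ _ tI A1 A2
  (fun s => `|G s|) (fun=> normr_ge0 _) A4 A3).
by apply: eq_Rintegral => s /[!inE] Ds; exact: dE.
Qed.

Lemma cvg_patch_itv g (x : R) :
  (g \_ `[- n%:R, n%:R]) x @[n --> \oo] --> g x.
Proof.
apply: (cvg_near_cst).
near=> n; rewrite patchE mem_set//= in_itv /= -ler_norml.
by near: n; exact: nbhs_infty_ger.
Unshelve. all: by end_near. Qed.

Lemma line_FTC g G (lm lp : R) : continuous g ->
  (forall x : R, is_derive x 1 G (g x)) -> itg setT g ->
  G x @[x --> -oo] --> lm -> G x @[x --> +oo] --> lp ->
  integ setT g = lp - lm.
Proof.
move=> cg dG ig Gm Gp.
have [] := @dct setT (fun n => g \_ `[- n%:R, n%:R]) g (fun x => `|g x|) measurableT.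
- move=> n; apply/(measurable_restrict _ _ _) => //.
  by rewrite setTI; apply: measurable_funTS; exact: cont_meas.
- by move=> x _; exact: cvg_patch_itv.
- exact: itg_norm.
- by move=> n x _; rewrite patchE; case: ifP => //; rewrite normr0.
move=> _ /(cvg_unique (@Rhausdorff R)); apply.
have E n : integ setT (g \_ `[- n%:R, n%:R]) = G n%:R - G (- n%:R).
  rewrite -Rintegral_mkcond; apply: FTC2 => //.
  - by rewrite -subr_ge0 opprK -natrD.
  - by move=> *; exact: cg.
  - by move=> x _; apply: differentiable_continuous; exact/derivable1_diffP.
rewrite (_ : (fun n => _) = (fun n => G n%:R - G (- n%:R))); last first.
  by apply/funext => n; exact: E.
have cn : (n%:R : R) @[n --> \oo] --> +oo by exact: cvgr_idn.
apply: cvgB; first exact: (cvg_comp _ _ cn Gp).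
have cm : (- n%:R : R) @[n --> \oo] --> -oo.
  by apply/cvgNry; apply: cvg_trans cn; rewrite (_ : - _ = (fun n => n%:R))//;
     apply/funext => n; exact: opprK.
exact: (cvg_comp _ _ cm Gm).
Qed.

(** Monotone convergence turns a bounded primitive into integrability. *)
Lemma line_itg g G (M : R) : continuous g -> (forall x, 0 <= g x) ->
  (forall x : R, is_derive x 1 G (g x)) -> (forall x, `|G x| <= M) ->
  itg setT g /\ integ setT g <= 2 * M.
Proof.
move=> cg g0 dG GM.
have mg : measurable_fun setT (EFin \o g)
  by apply/measurable_EFinP; exact: cont_meas.
have mn n : measurable_fun setT (g \_ `[- n%:R, n%:R]).
  apply/(measurable_restrict _ _ _) => //.
  by rewrite setTI; apply: measurable_funTS; exact: cont_meas.
pose gn n := EFin \o (g \_ `[- n%:R, n%:R]).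
have bd : (\int[mu]_x (g x)%:E <= (2 * M)%:E)%E.
  have -> : (\int[mu]_x (g x)%:E = \int[mu]_x limn (fun n => gn n x))%E.
    apply: eq_integral => x _; apply/esym/cvg_lim => //.
    by apply: cvg_EFin; [exact: nearW|exact: cvg_patch_itv].
  have gn0 n x : (0 <= gn n x)%E.
    by rewrite /gn /= lee_fin patchE; case: ifP => _ //; exact: g0.
  have gnS : forall x, setT x -> {homo gn^~ x : n m / (n <= m)%N >-> (n <= m)%E}.
    move=> x _ n m nm; rewrite /gn /= lee_fin !patchE; case: ifPn => [|_].
      rewrite inE /= in_itv /= => /andP[nx xn]; rewrite mem_set//= in_itv /=.
      have nm' : n%:R <= m%:R :> R by rewrite ler_nat.
      by apply/andP; split; lra.
    by case: ifP => _ //; exact: g0.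
  have mgn n : measurable_fun setT (gn n) by exact/measurable_EFinP.
  rewrite monotone_convergence//=; apply: lime_le.
    apply: ereal_nondecreasing_is_cvgn => m n mn'.
    by apply: ge0_le_integral => //; [exact: mgn|exact: mgn|move=> x Dx; exact: gnS].
  apply: nearW => n.
  have dn : - n%:R <= n%:R :> R by rewrite -subr_ge0 opprK -natrD.
  have E : integ `[- n%:R, n%:R] g = G n%:R - G (- n%:R).
    apply: FTC2 => //.
    - by move=> *; exact: cg.
    - by move=> x _; apply: differentiable_continuous; exact/derivable1_diffP.
  have itn : itg setT (g \_ `[- n%:R, n%:R]).
    rewrite -restrict_EFin.
    have [//|H _] := @integrable_mkcond _ _ R mu `[- n%:R, n%:R] (EFin \o g).
    by apply: H; apply: continuous_itg => *; exact: cg.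
  have -> : (\int[mu]_x gn n x = (G n%:R - G (- n%:R))%:E)%E.
    rewrite -E Rintegral_mkcond /Rintegral fineK//.
    exact: integrable_fin_num itn.
  rewrite lee_fin (le_trans (ler_norm _))// (le_trans (ler_normB _ _))//.
  by rewrite mulr_natl mulr2n lerD.
have ig : itg setT g.
  apply/integrableP; split => //.
  under eq_integral do rewrite gee0_abs ?lee_fin//.
  by apply: le_lt_trans bd _; rewrite ltry.
split=> //; rewrite -lee_fin /Rintegral fineK//.
exact: integrable_fin_num.
Qed.

End Dominated.

(** * Calculus in one and two variables *)
Section Calculus.
Context {R : realType}.
Implicit Types (g h G : R -> R) (a b c : R).

Lemma scaleRE (x y : R) : x *: y = x * y.
Proof. by []. Qed.

Lemma is_derive_cont g x l : is_derive x (1 : R) g l -> {for x, continuous g}.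
Proof. by move=> [dg _]; apply: differentiable_continuous; exact/derivable1_diffP. Qed.

Lemma is_derive_eps g (x l : R) :
  (forall eps, 0 < eps -> \forall y \near x,
     `|g y - g x - l * (y - x)| <= eps * `|y - x|) ->
  is_derive x 1 g l.
Proof.
move=> H.
have C : h^-1 *: (g (h + x) - g x) @[h --> 0^'] --> l.
  apply/cvgrPdist_le => eps eps0.
  have /nbhs_ballP[d /= d0 Hd] := H _ eps0.
  near=> h.
  have h0 : h != 0 by near: h; exact: nbhs_dnbhs_neq.
  have hx : ball x d (h + x).
    rewrite /ball /= opprD addrC subrK normrN.
    near: h; apply: dnbhs0_lt; exact: d0.
  have := Hd _ hx; rewrite addrK => K.
  have -> : l - h^-1 *: (g (h + x) - g x) = - (h^-1 * (g (h + x) - g x - l * h)).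
    rewrite scaleRE; field.
    exact: h0.
  rewrite normrN normrM normfV mulrC ler_pdivrMr ?normr_gt0//.
split; first by apply/cvg_ex; exists l; under eq_fun do rewrite scaler1.
by apply/cvg_lim => //; under eq_fun do rewrite scaler1.
Unshelve. all: by end_near. Qed.

Lemma is_derive_epsP g (x l : R) : is_derive x 1 g l ->
  forall eps, 0 < eps -> \forall y \near x,
     `|g y - g x - l * (y - x)| <= eps * `|y - x|.
Proof.
move=> [dg gl] eps eps0.
have C : h^-1 *: (g (h + x) - g x) @[h --> 0^'] --> l.
  by rewrite -gl; under eq_fun do rewrite -[X in g (X + _)]scaler1; exact: dg.
move/cvgrPdist_le : C => /(_ _ eps0) /nbhs_ballP[d /= d0 Hd].
apply/nbhs_ballP; exists d => //= y xy.
have [->|yx] := eqVneq y x; first by rewrite !subrr mulr0 subr0 normr0 mulr0.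
have h0 : y - x != 0 by rewrite subr_eq0.
have K0 : ball (0 : R) d (y - x) by rewrite /ball /= sub0r normrN distrC.
have := Hd _ K0 h0; rewrite subrK scaleRE => K.
have -> : g y - g x - l * (y - x) =
    - ((l - (y - x)^-1 * (g y - g x)) * (y - x)) by field.
by rewrite normrN normrM ler_wpM2r.
Qed.

Lemma mvt g dg a b :
  (forall x, `|x - a| <= `|b - a| -> is_derive x 1 g (dg x)) ->
  exists2 c, `|c - a| <= `|b - a| & g b - g a = dg c * (b - a).
Proof.
move=> dgE; have [ab|ba|->] := ltgtP a b; last 2 first.
- have D x : x \in `[b, a]%R -> is_derive x 1 g (dg x).
    rewrite in_itv /= => /andP[? ?]; apply: dgE.
    by rewrite ler0_norm ?ler0_norm; lra.
  have cg : {within `[b, a], continuous g}.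
    by apply: derivable_within_continuous => x /D [].
  have [c] := @MVT R g dg b a ba (fun x xI => D x (subset_itv_oo_cc xI)) cg.
  rewrite in_itv /= => /andP[? ?] E; exists c.
    by rewrite ler0_norm ?ler0_norm; lra.
  by rewrite -[LHS]opprB E; ring.
- exists b => //; by rewrite !subrr mulr0.
have D x : x \in `[a, b]%R -> is_derive x 1 g (dg x).
  rewrite in_itv /= => /andP[? ?]; apply: dgE.
  by rewrite ger0_norm ?ger0_norm; lra.
have cg : {within `[a, b], continuous g}.
  by apply: derivable_within_continuous => x /D [].
have [c] := @MVT R g dg a b ab (fun x xI => D x (subset_itv_oo_cc xI)) cg.
rewrite in_itv /= => /andP[? ?] E; exists c => //.
by rewrite ger0_norm ?ger0_norm; lra.
Qed.

Implicit Types p : R * R -> R.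

Lemma is_derive_dxP p (x y l : R) :
  is_derive x 1 (fun t => p (t, y)) l <->
  derivable p (x, y) ((1, 0) : R * R) /\ dx p (x, y) = l.
Proof.
have E : (fun h : R => h^-1 *: ((fun t => p (t, y)) (h *: 1 + x) - p (x, y))) =
    (fun h : R => h^-1 *: (p (h *: ((1, 0) : R * R) + (x, y)) - p (x, y))).
  apply/funext => h; congr (_ *: (p _ - _)).
  by rewrite -[RHS]/(h * 1 + x, h * 0 + y) mulr0 add0r.
split=> [[d dl]|[d dl]].
  by split; [rewrite /derivable -E|rewrite /dx /derive -E].
by split; [rewrite /derivable E|rewrite /derive E].
Qed.

Lemma is_derive_dyP p (x y l : R) :
  is_derive y 1 (fun t => p (x, t)) l <->
  derivable p (x, y) ((0, 1) : R * R) /\ dy p (x, y) = l.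
Proof.
have E : (fun h : R => h^-1 *: ((fun t => p (x, t)) (h *: 1 + y) - p (x, y))) =
    (fun h : R => h^-1 *: (p (h *: ((0, 1) : R * R) + (x, y)) - p (x, y))).
  apply/funext => h; congr (_ *: (p _ - _)).
  by rewrite -[RHS]/(h * 0 + x, h * 1 + y) mulr0 add0r.
split=> [[d dl]|[d dl]].
  by split; [rewrite /derivable -E|rewrite /dy /derive -E].
by split; [rewrite /derivable E|rewrite /derive E].
Qed.

Lemma near_pairP (P : R * R -> Prop) (x y : R) :
  (\forall z \near (x, y), P z) ->
  exists2 d, 0 < d & forall x' y', `|x' - x| <= d -> `|y' - y| <= d -> P (x', y').
Proof.
move=> /nbhs_ballP[d /= d0 Hd]; exists (d / 2); first by rewrite divr_gt0.
move=> x' y' xx yy; apply: Hd; have d2 : d / 2 < d by lra.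
by split; rewrite /ball /= distrC; [exact: le_lt_trans xx d2|exact: le_lt_trans yy d2].
Qed.

Lemma pair_nearP (P : R * R -> Prop) (x y d : R) : 0 < d ->
  (forall x' y', `|x' - x| < d -> `|y' - y| < d -> P (x', y')) ->
  \forall z \near (x, y), P z.
Proof.
move=> d0 H; apply/nbhs_ballP; exists d => //= -[x' y'] [] /=.
by rewrite /ball /= distrC => xx; rewrite distrC; exact: H.
Qed.

Definition C1_at p (z : R * R) :=
  [/\ derivable p z ((1, 0) : R * R), derivable p z ((0, 1) : R * R),
      {for z, continuous (dx p)} & {for z, continuous (dy p)}].

Lemma C1_dx p (x y : R) : C1_at p (x, y) ->
  is_derive x 1 (fun t => p (t, y)) (dx p (x, y)).
Proof. by move=> [dxp _ _ _]; apply: (is_derive_dxP _ _ _ _).2 (conj dxp erefl). Qed.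

Lemma C1_dy p (x y : R) : C1_at p (x, y) ->
  is_derive y 1 (fun t => p (x, t)) (dy p (x, y)).
Proof. by move=> [_ dyp _ _]; apply: (is_derive_dyP _ _ _ _).2 (conj dyp erefl). Qed.

(** The vertical part of the increment is a one-variable composition; the
    horizontal part is handled by the mean value theorem and the continuity of
    [dx p]. *)
Lemma chain2 p g (x m : R) :
  (\forall z \near (x, g x), C1_at p z) -> is_derive x 1 g m ->
  is_derive x 1 (fun t => p (t, g t)) (dx p (x, g x) + m * dy p (x, g x)).
Proof.
move=> pC1 dg; have cg := is_derive_cont dg.
have p1 : is_derive x 1 (fun t => p (x, g t)) (m * dy p (x, g x)).
  have H := C1_dy (nbhs_singleton pC1).
  by have := is_derive1_comp H dg; rewrite mulrC.
have p2 : is_derive x 1 (fun t => p (t, g t) - p (x, g t)) (dx p (x, g x)).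
  apply: is_derive_eps => eps eps0.
  have [_ _ cdx _] := nbhs_singleton pC1.
  have /near_pairP[d d0 Hd] : \forall z \near (x, g x),
      C1_at p z /\ `|dx p (x, g x) - dx p z| <= eps.
    near=> z; split; near: z; first exact: pC1.
    by move/cvgrPdist_le : cdx; apply.
  near=> y.
  have gy : `|g y - g x| <= d.
    rewrite distrC; near: y; by move/cvgrPdist_le : cg; apply.
  have xy : `|y - x| <= d.
    rewrite distrC; near: y; apply/nbhs_ballP; exists d => //= t; exact: ltW.
  have [t|c cxy ->] := @mvt (fun t => p (t, g y)) (fun t => dx p (t, g y)) x y.
    by move=> tx; apply: C1_dx; exact: (Hd t (g y) (le_trans tx xy) gy).1.
  rewrite subrr subr0 -mulrBl normrM ler_wpM2r// distrC.
  by have [_] := Hd c (g y) (le_trans cxy xy) gy.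
have -> : (fun t => p (t, g t)) =
    (fun t => p (x, g t)) + (fun t => p (t, g t) - p (x, g t)).
  by apply/funext => t; rewrite !fctE; ring.
by rewrite [dx _ _ + _]addrC; exact: is_deriveD.
Unshelve. all: by end_near. Qed.

Lemma two_close (u v a b e : R) : `|u - a| <= e / 2 -> `|v - b| <= e / 2 ->
  a = b -> `|u - v| <= e.
Proof. by rewrite !ler_norml => /andP[? ?] /andP[? ?] ?; apply/andP; split; lra. Qed.

(** The mixed second difference of p over a square of side d is d^2 times either
    mixed derivative at some point of the square. *)
Lemma cross_difference (P1 P2 P3 P4 D1 D2 u v x y d : R) : 0 < d ->
  (P1 - P2) - (P3 - P4) = D1 * (x + d - x) -> D1 = v * (y + d - y) ->
  (P1 - P3) - (P2 - P4) = D2 * (y + d - y) -> D2 = u * (x + d - x) -> u = v.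
Proof.
move=> d0 E1 E2 F1 F2; have dn : d * d != 0 by rewrite mulf_neq0 ?gt_eqF.
apply: (mulIf dn).
have -> : u * (d * d) = (P1 - P3) - (P2 - P4) by rewrite F1 F2; ring.
have -> : v * (d * d) = (P1 - P2) - (P3 - P4) by rewrite E1 E2; ring.
by ring.
Qed.

Lemma schwarz p z :
  (\forall w \near z, [/\ C1_at p w, C1_at (dx p) w & C1_at (dy p) w]) ->
  dx (dy p) z = dy (dx p) z.
Proof.
case: z => x y H; apply/eqP; rewrite -subr_eq0 -normr_le0.
apply/ler_addgt0Pl => eps eps0; rewrite addr0.
have e2 : 0 < eps / 2 by rewrite divr_gt0.
have [_ [_ _ _ c1] [_ _ c2 _]] := nbhs_singleton H.
have /cvgrPdist_le/(_ _ e2) k1 := c1.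
have /cvgrPdist_le/(_ _ e2) k2 := c2.
have /near_pairP[d d0 Hd] : \forall w \near (x, y),
    [/\ C1_at p w, C1_at (dx p) w & C1_at (dy p) w] /\
    (`|dy (dx p) (x, y) - dy (dx p) w| <= eps / 2 /\
     `|dx (dy p) (x, y) - dx (dy p) w| <= eps / 2).
  exact: filterI H (filterI k1 k2).
have dd : `|x + d - x| = d /\ `|y + d - y| = d.
  by rewrite ![_ + d]addrC !addrK !gtr0_norm.
have [dd1 dd2] := dd.
have dd1' : `|x + d - x| <= d by rewrite dd1.
have dd2' : `|y + d - y| <= d by rewrite dd2.
have yd : `|y - y| <= d by rewrite subrr normr0 ltW.
have xd : `|x - x| <= d by rewrite subrr normr0 ltW.
have [c1'|c c1' E1] := @mvt (fun t => p (t, y + d) - p (t, y))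
   (fun t => dx p (t, y + d) - dx p (t, y)) x (x + d).
  rewrite dd1 => tx; have [[h1 _ _] _] := Hd _ (y + d) tx dd2'.
  have [[h2 _ _] _] := Hd _ y tx yd.
  exact: is_deriveB (C1_dx h1) (C1_dx h2).
rewrite dd1 in c1'.
have [c2'|c' c2' E2] := @mvt (fun t => dx p (c, t)) (fun t => dy (dx p) (c, t)) y (y + d).
  by rewrite dd2 => ty; have [[_ h _] _] := Hd _ _ c1' ty; exact: C1_dy.
rewrite dd2 in c2'.
have [b1'|b b1' F1] := @mvt (fun t => p (x + d, t) - p (x, t))
   (fun t => dy p (x + d, t) - dy p (x, t)) y (y + d).
  rewrite dd2 => ty; have [[h1 _ _] _] := Hd (x + d) _ dd1' ty.
  have [[h2 _ _] _] := Hd x _ xd ty.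
  exact: is_deriveB (C1_dy h1) (C1_dy h2).
rewrite dd2 in b1'.
have [b2'|b' b2' F2] := @mvt (fun t => dy p (t, b)) (fun t => dx (dy p) (t, b)) x (x + d).
  by rewrite dd1 => tx; have [[_ _ h] _] := Hd _ _ tx b1'; exact: C1_dx.
rewrite dd1 in b2'.
have E : dx (dy p) (b', b) = dy (dx p) (c, c').
  exact: cross_difference d0 E1 E2 F1 F2.
have [_ [A _]] := Hd _ _ c1' c2'.
have [_ [_ B]] := Hd _ _ b2' b1'.
exact: two_close B A E.
Qed.

End Calculus.

Section Partials.
Context {R : realType}.
Implicit Types (p P Q : R * R -> R) (z w : R * R).

Lemma C1_at_intro p P Q z :
  (\forall w \near z, is_derive (w.1 : R) 1 (fun t : R => p (t, w.2)) (P w) /\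
                      is_derive (w.2 : R) 1 (fun t : R => p (w.1, t)) (Q w)) ->
  {for z, continuous P} -> {for z, continuous Q} ->
  [/\ C1_at p z, dx p z = P z & dy p z = Q z].
Proof.
move=> H cP cQ.
have H2 : \forall w \near z, [/\ derivable p w ((1, 0) : R * R),
    derivable p w ((0, 1) : R * R), dx p w = P w & dy p w = Q w].
  apply: filterS H => -[x y] /= [d1 d2].
  have [a1 E1] := (is_derive_dxP _ _ _ _).1 d1; have [a2 E2] := (is_derive_dyP _ _ _ _).1 d2.
  by split; [exact: a1|exact: a2|exact: E1|exact: E2].
have [D1 D2 Ex Ey] := nbhs_singleton H2.
have near_cont (g h : R * R -> R) : (\forall w \near z, g w = h w) ->
    {for z, continuous h} -> {for z, continuous g}.
  move=> gh ch; have E := nbhs_singleton gh.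
  rewrite /continuous_at /prop_for E; apply: cvg_trans ch.
  by apply: near_eq_cvg; apply: filterS gh => w ->.
split; [split|exact: Ex|exact: Ey]; [exact: D1|exact: D2| |].
- by apply: near_cont cP; apply: filterS H2 => w [_ _ E _]; exact: E.
- by apply: near_cont cQ; apply: filterS H2 => w [_ _ _ E]; exact: E.
Qed.

End Partials.

Section Rules.
Context {R : realType}.
Implicit Types (f g : R -> R) (x a b c : R).

(** A copy of [is_derive] that type class resolution leaves alone, so that the
    rules below can be chained while the derivative is still unknown. *)
Definition isd f x a : Prop := is_derive x 1 f a.

Lemma isd_eq f x a b : isd f x a -> a = b -> is_derive x 1 f b.
Proof. by move=> df <-. Qed.

Lemma dD f g x a b : isd f x a -> isd g x b ->
  isd (fun t => f t + g t) x (a + b).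
Proof. by move=> df dg; exact: is_deriveD. Qed.

Lemma dN f x a : isd f x a -> isd (fun t => - f t) x (- a).
Proof. by move=> df; exact: is_deriveN. Qed.

Lemma dM f g x a b : isd f x a -> isd g x b ->
  isd (fun t => f t * g t) x (f x * b + g x * a).
Proof. by move=> df dg; exact: is_deriveM. Qed.

Lemma dC x c : isd (fun=> c) x 0.
Proof. exact: is_derive_cst. Qed.

Lemma dI x : isd (fun t : R => t) x 1.
Proof. exact: is_derive_id. Qed.

Lemma dcomp f g x a b : isd g (f x) b -> isd f x a ->
  isd (fun t => g (f t)) x (b * a).
Proof. by move=> dg df; exact: (is_derive1_comp dg df). Qed.

Lemma dV f x a : f x != 0 -> isd f x a ->
  isd (fun t => (f t)^-1) x (- (a / f x ^+ 2)).
Proof.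
move=> fx df; apply: (is_derive_eq (is_deriveV fx df)).
by rewrite scaleRE; field.
Qed.

Lemma dX2 f x a : isd f x a ->
  isd (fun t => f t ^+ 2) x (2 * f x * a).
Proof.
by move=> df; apply: (is_derive_eq (dM df df)); ring.
Qed.

Lemma d_atan f x a : isd f x a ->
  isd (fun t => atan (f t)) x (a / (1 + f x ^+ 2)).
Proof.
move=> df; rewrite mulrC; apply: dcomp df; exact: is_derive1_atan.
Qed.

Lemma d_ln f x a : 0 < f x -> isd f x a ->
  isd (fun t => ln (f t)) x (a / f x).
Proof. by move=> f0 df; rewrite mulrC; apply: dcomp df; exact: is_derive1_ln. Qed.

End Rules.

Section ContRules.
Context {R : realType} {T : topologicalType}.
Implicit Types (f g : T -> R) (z : T).

Lemma cD f g z : {for z, continuous f} -> {for z, continuous g} ->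
  {for z, continuous (fun w => f w + g w)}.
Proof. by move=> cf cg; exact: continuousD. Qed.

Lemma cN f z : {for z, continuous f} -> {for z, continuous (fun w => - f w)}.
Proof. by move=> cf; exact: continuousN. Qed.

Lemma cM f g z : {for z, continuous f} -> {for z, continuous g} ->
  {for z, continuous (fun w => f w * g w)}.
Proof. by move=> cf cg; exact: continuousM. Qed.

Lemma cV f z : f z != 0 -> {for z, continuous f} ->
  {for z, continuous (fun w => (f w)^-1)}.
Proof. by move=> f0 cf; exact: continuousV. Qed.

Lemma cX2 f z : {for z, continuous f} -> {for z, continuous (fun w => f w ^+ 2)}.
Proof. by move=> cf; exact: (continuousM cf cf). Qed.

Lemma cC c z : {for z, continuous (fun=> c : R)}.
Proof. exact: cst_continuous. Qed.

Lemma ccomp f (h : R -> R) z : {for f z, continuous h} -> {for z, continuous f} ->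
  {for z, continuous (fun w => h (f w))}.
Proof. by move=> ch cf; exact: (continuous_comp cf ch). Qed.

End ContRules.

Section Cont2.
Context {R : realType}.
Lemma cI (x : R) : {for x, continuous (fun t : R => t)}.
Proof. exact: cvg_id. Qed.

Lemma cfst (z : R * R) : {for z, continuous (fun w : R * R => w.1)}.
Proof. exact: cvg_fst. Qed.

Lemma csnd (z : R * R) : {for z, continuous (fun w : R * R => w.2)}.
Proof. exact: cvg_snd. Qed.
End Cont2.

(** Differentiates along the syntax of an expression; what remains is that the
    denominators do not vanish and that the derivative is the expected one. *)
Ltac deriv := refine (isd_eq _ _); [repeat match goal with
  | |- isd (fun=> ?c) _ _ => refine (dC _ _)
  | |- isd (fun t => t) _ _ => refine (dI _)
  | |- isd -%R _ _ => refine (dN (dI _))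
  | |- isd ( *%R _) _ _ => refine (dM (dC _ _) (dI _))
  | |- isd ( +%R _) _ _ => refine (dD (dC _ _) (dI _))
  | |- isd (fun t => @?f t + @?g t) _ _ => refine (dD _ _)
  | |- isd (fun t => - @?f t) _ _ => refine (dN _)
  | |- isd (fun t => @?f t * @?g t) _ _ => refine (dM _ _)
  | |- isd (fun t => (@?f t)^-1) _ _ => refine (dV _ _)
  | |- isd (fun t => @?f t ^+ 2) _ _ => refine (dX2 _)
  | H : isd ?f ?x _ |- isd ?f ?x _ => exact H
  | H : is_derive ?x _ ?f _ |- isd ?f ?x _ => exact H
  end |].
Ltac conti := repeat match goal with
  | |- continuous_at ?x ?f => change {for x, continuous f}
  | |- {for _, continuous (fun=> ?c)} => refine (@cC _ _ _ _)
  | |- {for _, continuous (fun t => t)} => refine (cI _)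
  | |- {for _, continuous -%R} => refine (cN (cI _))
  | |- {for _, continuous ( *%R _)} => refine (cM (@cC _ _ _ _) (cI _))
  | |- {for _, continuous ( +%R _)} => refine (cD (@cC _ _ _ _) (cI _))
  | |- {for _, continuous (fun t => t.1)} => eapply cfst
  | |- {for _, continuous (fun t => t.2)} => eapply csnd
  | |- {for _, continuous (fun t => @?f t + @?g t)} => refine (cD _ _)
  | |- {for _, continuous (fun t => - @?f t)} => refine (cN _)
  | |- {for _, continuous (fun t => @?f t * @?g t)} => refine (cM _ _)
  | |- {for _, continuous (fun t => (@?f t)^-1)} => refine (cV _ _)
  | |- {for _, continuous (fun t => @?f t ^+ 2)} => refine (cX2 _)
  | H : {for _, continuous ?f} |- {for _, continuous ?f} => exact H
  | H : continuous ?f |- {for ?x, continuous ?f} => exact (H x)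
  | |- {for _, continuous ?f} => lazymatch f with
      | @fst _ _ => eapply cfst | @snd _ _ => eapply csnd end
  end.

Section Atan.
Context {R : realType}.

Lemma atan_inv (u : R) : 0 < u -> atan u + atan u^-1 = pi / 2.
Proof.
move=> u0; have a0 : 0 < atan u by rewrite -(@atan0 R); exact: lt_atan.
have a1 := @atan_ltpi2 R u.
have E : tan (pi / 2 - atan u) = u^-1.
  rewrite -[u in RHS]atanK /tan invf_div; congr (_ / _).
    by rewrite sinB sin_pihalf cos_pihalf mul1r mul0r subr0.
  by rewrite cosB sin_pihalf cos_pihalf mul1r mul0r add0r.
rewrite -E tanK; first by ring.
by rewrite in_itv /=; apply/andP; split; lra.
Qed.

Lemma atan_inv_sign (e u : R) : `|e| = 1 -> 0 < e * u ->
  atan u + atan u^-1 = e * (pi / 2).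
Proof.
move=> e1; have [e0|e0] := lerP 0 e.
  by rewrite -(ger0_norm e0) e1 !mul1r => /atan_inv ->.
have -> : e = - 1 by rewrite -e1 ltr0_norm// opprK.
rewrite !mulN1r => /atan_inv <-.
by rewrite invrN !atanN; ring.
Qed.
End Atan.

(** * Green's theorem on rectangles *)
Section Rectangles.
Context {R : realType}.
Implicit Types (A B E : R * R -> R) (a b c d : R).

Lemma cont_pairl (x y : R) : {for x, continuous (fun t : R => (t, y) : R * R)}.
Proof.
have H : (t, y) @[t --> x] --> (x, y).
  exact: (@cvg_pair _ _ _ (nbhs x) (nbhs x) (nbhs y) _ _ _ id (fun=> y) cvg_id (cvg_cst y)).
exact: H.
Qed.

Lemma cont_pairr (x y : R) : {for y, continuous (fun t : R => (x, t) : R * R)}.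
Proof.
have H : (x, t) @[t --> y] --> (x, y).
  exact: (@cvg_pair _ _ _ (nbhs y) (nbhs x) (nbhs y) _ _ _ (fun=> x) id (cvg_cst x) cvg_id).
exact: H.
Qed.

Lemma cont_slice1 A (x y : R) : {for (x, y), continuous A} ->
  {for x, continuous (fun t => A (t, y))}.
Proof.
by move=> cA; apply: (continuous_comp (@cont_pairl x y)).
Qed.

Lemma cont_slice2 A (x y : R) : {for (x, y), continuous A} ->
  {for y, continuous (fun t => A (x, t))}.
Proof.
by move=> cA; apply: (continuous_comp (@cont_pairr x y)).
Qed.

Lemma unif_segment A a b (y eps : R) : 0 < eps ->
  (forall x, a <= x <= b -> {for (x, y), continuous A}) ->
  \forall t \near y, forall x, a <= x <= b -> `|A (x, t) - A (x, y)| <= eps.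
Proof.
move=> eps0 cA.
have /compact_near_coveringP cpt := @segment_compact R a b.
have e2 : 0 < eps / 2 by rewrite divr_gt0.
have : \forall t \near y, `[a, b] `<=` [set x | `|A (x, t) - A (x, y)| <= eps].
  apply: (cpt _ (nbhs y) (fun t x => `|A (x, t) - A (x, y)| <= eps)) => x.
  rewrite /= in_itv => /cA /cvgrPdist_le /(_ _ e2) /near_pairP[r r0 Hr].
  exists (ball x r, ball y r) => /=; first by split; exact: nbhsx_ballx.
  move=> [x' t] [] /=; rewrite /ball /= => /ltW xx /ltW yt.
  have h1 : `|A (x, y) - A (x', t)| <= eps / 2 by apply: Hr; rewrite distrC.
  have h2 : `|A (x, y) - A (x', y)| <= eps / 2.
    by apply: Hr; rewrite ?subrr ?normr0 1?distrC// ltW.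
  by move: h1 h2; rewrite !ler_norml => /andP[? ?] /andP[? ?]; apply/andP; split; lra.
by apply: filterS => t H x xab; apply: H; rewrite /= in_itv.
Qed.

Lemma cont_integ A a b (y : R) : a <= b ->
  (\forall t \near y, forall x, a <= x <= b -> {for (x, t), continuous A}) ->
  {for y, continuous (fun t => integ `[a, b] (fun x => A (x, t)))}.
Proof.
move=> ab cA; apply/cvgrPdist_le => eps eps0.
have ba : 0 < b - a + 1 by lra.
have e2 : 0 < eps / (b - a + 1) by rewrite divr_gt0.
near=> t.
have cy x : a <= x <= b -> {for x, continuous (fun u => A (u, y))}.
  by move=> xab; apply: cont_slice1; exact: (nbhs_singleton cA).
have ct x : a <= x <= b -> {for x, continuous (fun u => A (u, t))}.
  by move=> xab; apply: cont_slice1; move: x xab; near: t.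
rewrite -RintegralB//; [|exact: continuous_itg..].
apply: (@le_trans _ _ (eps / (b - a + 1) * (b - a))).
  apply: (@integ_bound _ _ _ (fun x => A (x, y) - A (x, t))) => //.
    by move=> x xab; apply: continuousB; [exact: cy|exact: ct].
  move=> x xab; rewrite distrC; move: x xab; near: t.
  apply: unif_segment => // x xab; exact: (nbhs_singleton cA).
by rewrite mulrAC ler_pdivrMr// ler_wpM2l ?ltW//; lra.
Unshelve. all: by end_near. Qed.

Lemma is_derive_integ A E a b (y : R) : a <= b ->
  (\forall t \near y, forall x, a <= x <= b ->
     [/\ {for (x, t), continuous A}, {for (x, t), continuous E} &
         is_derive t 1 (fun u => A (x, u)) (E (x, t))]) ->
  is_derive y 1 (fun t => integ `[a, b] (fun x => A (x, t)))
    (integ `[a, b] (fun x => E (x, y))).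
Proof.
move=> ab H; apply: is_derive_eps => eps eps0.
have ba : 0 < b - a + 1 by lra.
have e2 : 0 < eps / (b - a + 1) by rewrite divr_gt0.
have Hy := nbhs_singleton H.
have cE x : a <= x <= b -> {for (x, y), continuous E} by move=> /Hy[].
have cA x : a <= x <= b -> {for (x, y), continuous A} by move=> /Hy[].
have U := unif_segment e2 cE.
have HU : \forall t \near y,
   (forall x, a <= x <= b ->
     [/\ {for (x, t), continuous A}, {for (x, t), continuous E} &
         is_derive t 1 (fun u => A (x, u)) (E (x, t))]) /\
   (forall x, a <= x <= b -> `|E (x, t) - E (x, y)| <= eps / (b - a + 1)).
  exact: filterI H U.
have /nbhs_ballP[r /= r0 Hr] := HU.
near=> t.
have yt : ball y r t by near: t; exact: nbhsx_ballx.
have ct x : a <= x <= b -> {for x, continuous (fun u => A (u, t))}.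
  by move=> xab; apply: cont_slice1; have [/(_ _ xab) []] := Hr _ yt.
have cy x : a <= x <= b -> {for x, continuous (fun u => A (u, y))}.
  by move=> /cA; exact: cont_slice1.
have cEy x : a <= x <= b -> {for x, continuous (fun u => E (u, y))}.
  by move=> /cE; exact: cont_slice1.
have cZ x : a <= x <= b -> {for x, continuous (fun u => E (u, y) * (t - y))}.
  by move=> xab; apply: continuousM; [exact: cEy|exact: cst_continuous].
have cB x : a <= x <= b -> {for x, continuous (fun u => A (u, t) - A (u, y))}.
  by move=> xab; apply: continuousB; [exact: ct|exact: cy].
rewrite -RintegralB//; [|exact: continuous_itg..].
rewrite -RintegralZr//; last exact: continuous_itg.
rewrite -RintegralB//; [|exact: (continuous_itg cB)|exact: (continuous_itg cZ)].
apply: (@le_trans _ _ (eps / (b - a + 1) * `|t - y| * (b - a))).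
  apply: (@integ_bound _ _ _ (fun x => A (x, t) - A (x, y) - E (x, y) * (t - y))) => //.
    by move=> x xab; apply: continuousB; [exact: cB|exact: cZ].
  move=> x xab.
  have [u|u uy ->] := @mvt _ (fun u => A (x, u)) (fun u => E (x, u)) y t.
    move=> uy; have yu : ball y r u.
      by move: yt; rewrite /ball /= distrC => yt; rewrite distrC (le_lt_trans uy).
    by have [/(_ _ xab) []] := Hr _ yu.
  have yu : ball y r u.
    by move: yt; rewrite /ball /= distrC => yt; rewrite distrC (le_lt_trans uy).
  rewrite -mulrBl normrM ler_wpM2r//.
  by have [_ /(_ _ xab)] := Hr _ yu.
rewrite mulrAC ler_wpM2r// mulrAC ler_pdivrMr// ler_wpM2l ?ltW//; lra.
Unshelve. all: by end_near. Qed.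

(** Green's theorem for a rectangle: a closed form [A dx + B dy] has no
    circulation; closedness is only asked for off the two horizontal sides. *)
Lemma closed_form_rectangle A B E a b c d (r : R) : a <= b -> c <= d -> 0 < r ->
  (forall x y, a <= x <= b -> c - r < y < d + r -> {for (x, y), continuous A}) ->
  (forall x y, a <= x <= b -> c <= y <= d -> {for (x, y), continuous B}) ->
  (forall x y, a <= x <= b -> c < y < d ->
     [/\ {for (x, y), continuous E},
         is_derive y 1 (fun t => A (x, t)) (E (x, y)) &
         is_derive x 1 (fun t => B (t, y)) (E (x, y))]) ->
  integ `[a, b] (fun x => A (x, d)) - integ `[a, b] (fun x => A (x, c)) =
  integ `[c, d] (fun y => B (b, y) - B (a, y)).
Proof.
move=> ab cd r0 cA cB dAB.
have near_in (u v y : R) : u < y < v -> \forall t \near y, u < t < v.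
  move=> /andP[uy yv]; near=> t; apply/andP; split; near: t.
    by apply: (cvgr_gt y) => //; exact: cvg_id.
  by apply: (cvgr_lt y) => //; exact: cvg_id.
apply/esym.
apply: (@FTC2 R c d _ (fun y => integ `[a, b] (fun x => A (x, y)))) => //.
- move=> y ycd; have aab : a <= a <= b by rewrite lexx.
  have bab : a <= b <= b by rewrite lexx andbT.
  by apply: continuousB; apply: cont_slice2; exact: cB.
- move=> y /andP[cy yd]; apply: cont_integ => //.
  have /near_in : c - r < y < d + r by apply/andP; split; lra.
  by apply: filterS => t tcd x xab; exact: cA.
- move=> y /andP[cy yd].
  have -> : B (b, y) - B (a, y) = integ `[a, b] (fun x => E (x, y)).
    apply/esym; apply: (@FTC2 R a b _ (fun x => B (x, y))) => //.
    + move=> x xab; apply: cont_slice1.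
      by have [|] := dAB x y xab; rewrite ?cy.
    + move=> x xab; apply: cont_slice1.
      by apply: cB => //; rewrite !ltW.
    + move=> x /andP[ax xb]; have [||] := dAB x y; rewrite ?cy//.
      by rewrite !ltW.
  apply: is_derive_integ => //.
  have /near_in : c < y < d by rewrite cy.
  apply: filterS => t tcd x xab; have [cEx dA _] := dAB x t xab tcd.
  split=> //; apply: cA => //; move/andP: tcd => [? ?].
  by apply/andP; split; lra.
Unshelve. all: by end_near. Qed.

End Rectangles.

(** * The half-plane picture of one phase *)
Section Flat.
Context {R : realType}.
Implicit Types (f m : R -> R) (G a b : R * R -> R) (e : R).

(** The half-plane picture of a divergence and curl free field (v1, v2) in the
    phase [0 < e * (y - f x)], where e is 1 or -1: [G1] and [G2] are v1 and v2 at
    the point (x, f x + e eta), and [a], [b] are the derivatives of v1 with respect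
    to x and y at that point.  [G1] and [G2] are continuous on the whole plane, so
    that they have boundary values at eta = 0. *)
Record flat_field e m G1 G2 a b : Prop := FlatField {
  ff_cont1 : continuous G1;
  ff_cont2 : continuous G2;
  ff_conta : forall x y : R, 0 < y -> {for (x, y), continuous a};
  ff_contb : forall x y : R, 0 < y -> {for (x, y), continuous b};
  ff_y1 : forall x y : R, 0 < y -> is_derive y 1 (fun t => G1 (x, t)) (e * b (x, y));
  ff_y2 : forall x y : R, 0 < y -> is_derive y 1 (fun t => G2 (x, t)) (- (e * a (x, y)));
  ff_x1 : forall x y : R, 0 < y ->
    is_derive x 1 (fun t => G1 (t, y)) (a (x, y) + m x * b (x, y));
  ff_x2 : forall x y : R, 0 < y ->
    is_derive x 1 (fun t => G2 (t, y)) (b (x, y) - m x * a (x, y)) }.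

Definition flat_vanish e f G1 G2 := forall eps, 0 < eps -> exists N, forall x y : R,
  0 <= y -> N < `|x| \/ N < `|f x + e * y| ->
  `|G1 (x, y)| <= eps /\ `|G2 (x, y)| <= eps.

(** Multiplying the complex velocity [v1 - i v2] by [i]. *)
Lemma flat_rotate e f m G1 G2 a b : flat_field e m G1 G2 a b ->
  flat_field e m G2 (fun z => - G1 z) b (fun z => - a z).
Proof.
case=> c1 c2 ca cb y1 y2 x1 x2; split; try assumption.
- by move=> z; apply: cN; exact: c1.
- by move=> x y y0; apply: cN; exact: ca.
- by move=> x y y0; rewrite mulrN; exact: y2.
- by move=> x y y0; exact: is_deriveN (y1 x y y0).
- by move=> x y y0; rewrite mulrN; exact: x2.
- move=> x y y0; have := is_deriveN (x1 x y y0); rewrite opprD; exact.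
Qed.

End Flat.

(** * Contour integrals around a boundary point *)
Section HalfPlane.
Context {R : realType}.
Context (e L : R) (f m : R -> R) (G1 G2 a b : R * R -> R) (x0 : R).
Context (e1 : `|e| = 1) (df : forall x : R, is_derive x 1 f (m x)).
Context (cm : continuous m) (mL : forall x, `|m x| <= L).
Context (GF : flat_field e m G1 G2 a b).

(* With X = - y and Y = f (x0 - y) + e eta - f x0, the complex number w1 - i w2 is
   the quotient (v1 - i v2) / (X + i Y), which is holomorphic in the phase; [A] and
   [B] are the coefficients of the closed form that it defines in the coordinates
   (y, eta).  [K] exceeds the slope bound [L], so the lid of a box of half-width d
   and height K d around the boundary point stays away from the graph. *)
Let K := L + 1.
Let Y (z : R * R) := f (x0 - z.1) + e * z.2 - f x0.
Let r2 z := z.1 ^+ 2 + Y z ^+ 2.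
Let g1 (z : R * R) := G1 (x0 - z.1, z.2).
Let g2 (z : R * R) := G2 (x0 - z.1, z.2).
Let w1 z := (g1 z * - z.1 - g2 z * Y z) / r2 z.
Let w2 z := (g2 z * - z.1 + g1 z * Y z) / r2 z.
Let A z := w1 z + m (x0 - z.1) * w2 z.
Let B z := - (e * w2 z).
Let a' (z : R * R) := a (x0 - z.1, z.2).
Let b' (z : R * R) := b (x0 - z.1, z.2).
Let P z := (a' z * - z.1 - b' z * Y z) / r2 z
  - (g1 z * (z.1 ^+ 2 - Y z ^+ 2) + 2 * (g2 z * (z.1 * Y z))) / r2 z ^+ 2.
Let Q z := (b' z * - z.1 + a' z * Y z) / r2 z
  - (g2 z * (z.1 ^+ 2 - Y z ^+ 2) - 2 * (g1 z * (z.1 * Y z))) / r2 z ^+ 2.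
Let E z := e * (Q z - m (x0 - z.1) * P z).

Lemma halfplane_L_ge0 : 0 <= L. Proof. exact: le_trans (mL 0). Qed.

Lemma lipschitz (x y : R) : `|f x - f y| <= L * `|x - y|.
Proof.
have [t _ ->] := @mvt _ f m y x (fun t _ => df t).
by rewrite normrM ler_wpM2r.
Qed.

Lemma ccompf (T : topologicalType) (h : R -> R) (u : T -> R) z : continuous h ->
  {for z, continuous u} -> {for z, continuous (fun w => h (u w))}.
Proof. by move=> ch cu; apply: ccomp cu; exact: ch. Qed.

Lemma ccompf2 (T : topologicalType) (h : R * R -> R) (u v : T -> R) z :
  {for (u z, v z), continuous h} ->
  {for z, continuous u} -> {for z, continuous v} ->
  {for z, continuous (fun w => h (u w, v w))}.
Proof.
move=> ch cu cv.
have H : (u w, v w) @[w --> z] --> (u z, v z).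
  exact: (@cvg_pair _ _ _ (nbhs z) (nbhs (u z)) (nbhs (v z)) _ _ _ u v cu cv).
exact: (cvg_comp _ _ H ch).
Qed.

Lemma cont_f : continuous f.
Proof. by move=> x; exact: is_derive_cont (df x). Qed.

Lemma contY z : {for z, continuous Y}.
Proof.
have c1 : {for z, continuous (fun w : R * R => x0 - w.1)} by conti.
have c2 : {for z, continuous (fun w : R * R => f (x0 - w.1))}.
  exact: ccompf cont_f c1.
by rewrite /Y; conti.
Qed.

Lemma contr2 z : {for z, continuous r2}.
Proof. by have cY := @contY z; rewrite /r2; conti. Qed.

Lemma contg1 z : {for z, continuous g1}.
Proof.
have c : {for z, continuous (fun w : R * R => x0 - w.1)} by conti.
exact: (ccompf2 (@ff_cont1 _ _ _ _ _ _ _ GF _) c (@csnd R z)).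
Qed.

Lemma contg2 z : {for z, continuous g2}.
Proof.
have c : {for z, continuous (fun w : R * R => x0 - w.1)} by conti.
exact: (ccompf2 (@ff_cont2 _ _ _ _ _ _ _ GF _) c (@csnd R z)).
Qed.

Lemma contm z : {for z, continuous (fun w : R * R => m (x0 - w.1))}.
Proof.
have c : {for z, continuous (fun w : R * R => x0 - w.1)} by conti.
exact: (ccompf cm c).
Qed.

Lemma contw1 z : r2 z != 0 -> {for z, continuous w1}.
Proof.
move=> rz; have cY := @contY z; have c1 := @contg1 z; have c2 := @contg2 z.
by have cr := @contr2 z; rewrite /w1; conti.
Qed.

Lemma contw2 z : r2 z != 0 -> {for z, continuous w2}.
Proof.
move=> rz; have cY := @contY z; have c1 := @contg1 z; have c2 := @contg2 z.
by have cr := @contr2 z; rewrite /w2; conti.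
Qed.

Lemma contA z : r2 z != 0 -> {for z, continuous A}.
Proof.
move=> rz; have c1 := contw1 rz; have c2 := contw2 rz; have c3 := @contm z.
by rewrite /A; conti.
Qed.

Lemma contB z : r2 z != 0 -> {for z, continuous B}.
Proof. by move=> rz; have c2 := contw2 rz; rewrite /B; conti. Qed.

Lemma contE z : 0 < z.2 -> r2 z != 0 -> {for z, continuous E}.
Proof.
move=> z0 rz; have cY := @contY z; have c1 := @contg1 z; have c2 := @contg2 z.
have cr := @contr2 z; have c3 := @contm z.
have ca : {for z, continuous a'}.
  have c : {for z, continuous (fun w : R * R => x0 - w.1)} by conti.
  exact: (ccompf2 (@ff_conta _ _ _ _ _ _ _ GF _ _ z0) c (@csnd R z)).
have cb : {for z, continuous b'}.
  have c : {for z, continuous (fun w : R * R => x0 - w.1)} by conti.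
  exact: (ccompf2 (@ff_contb _ _ _ _ _ _ _ GF _ _ z0) c (@csnd R z)).
by rewrite /E /P /Q; conti; rewrite ?expf_neq0.
Qed.

Lemma derA_y (y h : R) : 0 < h -> r2 (y, h) != 0 ->
  is_derive h 1 (fun t => A (y, t)) (E (y, h)).
Proof.
move=> h0 rz.
have d1 : isd (fun t => G1 (x0 - y, t)) h _ := ff_y1 GF (x0 - y) h0.
have d2 : isd (fun t => G2 (x0 - y, t)) h _ := ff_y2 GF (x0 - y) h0.
move: rz; rewrite /A /w1 /w2 /E /P /Q /r2 /Y /g1 /g2 /a' /b' /= => rz.
deriv; try exact: rz.
move: (G1 _) (G2 _) (a _) (b _) (m _) (f (x0 - y) + _ - _) rz => *; cbv beta.
by field.
Qed.

Lemma derB_x (y h : R) : 0 < h -> r2 (y, h) != 0 ->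
  is_derive y 1 (fun t => B (t, h)) (E (y, h)).
Proof.
move=> h0 rz.
have dx0 : isd (fun t => x0 - t) y (0 - 1) by exact: dD (dC _ _) (dN (dI _)).
have d0 : isd (fun t => f (x0 - t)) y _ := @dcomp R (fun t => x0 - t) f y _ _ (df (x0 - y)) dx0.
have d1 : isd (fun t => G1 (x0 - t, h)) y _ :=
  @dcomp R (fun t => x0 - t) (fun t => G1 (t, h)) y _ _ (ff_x1 GF (x0 - y) h0) dx0.
have d2 : isd (fun t => G2 (x0 - t, h)) y _ :=
  @dcomp R (fun t => x0 - t) (fun t => G2 (t, h)) y _ _ (ff_x2 GF (x0 - y) h0) dx0.
move: rz; rewrite /B /w2 /E /P /Q /r2 /Y /g1 /g2 /a' /b' /= => rz.
deriv; try exact: rz.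
cbv beta.
move: (G1 _) (G2 _) (a _) (b _) (m _) (f (x0 - y) + _ - _) rz => *.
by field.
Qed.

Lemma e_sq : e * e = 1.
Proof. by rewrite -expr2 -real_normK ?num_real// e1 expr1n. Qed.

Lemma eY_ge z : z.2 - L * `|z.1| <= e * Y z.
Proof.
have -> : e * Y z = z.2 + e * (f (x0 - z.1) - f x0).
  by rewrite /Y -[X in _ = X + _]mul1r -e_sq; ring.
have H : `|e * (f (x0 - z.1) - f x0)| <= L * `|z.1|.
  rewrite normrM e1 mul1r (le_trans (lipschitz _ _))//.
  by rewrite addrAC subrr add0r normrN.
by move: H; rewrite ler_norml => /andP[? _]; lra.
Qed.

Lemma r2_neq0 z : z.1 != 0 \/ L * `|z.1| < z.2 -> r2 z != 0.
Proof.
move=> H; rewrite /r2 paddr_eq0 ?sqr_ge0// !sqrf_eq0.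
case: H => [/negPf->//|H]; apply/negP => /andP[_ /eqP Y0].
by have := eY_ge z; rewrite Y0 mulr0; lra.
Qed.

(** The integral of the closed form over the path that leaves the boundary at
    [y = d], follows the sides and the lid of a box of half-width [d] and height
    [K * d], and comes back at [y = - d]. *)
Definition box_path (d : R) : R :=
  integ `[0, K * d] (fun h => B (d, h) - B (- d, h)) -
  integ `[- d, d] (fun y => A (y, K * d)).

Lemma K_gt0 : 0 < K. Proof. by have := halfplane_L_ge0; rewrite /K; lra. Qed.

Lemma contB_side (y h : R) : y != 0 -> {for h, continuous (fun t => B (y, t))}.
Proof. by move=> y0; apply: cont_slice2; apply: contB; apply: r2_neq0; left. Qed.

Lemma contA_line (y h : R) : y != 0 \/ L * `|y| < h ->
  {for y, continuous (fun t => A (t, h))}.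
Proof. by move=> H; apply: cont_slice1; apply: contA; exact: r2_neq0. Qed.

Lemma rect_side (c d M : R) : c <= d -> 0 < c \/ d < 0 -> 0 <= M ->
  integ `[c, d] (fun y => A (y, M)) - integ `[c, d] (fun y => A (y, 0)) =
  integ `[0, M] (fun h => B (d, h)) - integ `[0, M] (fun h => B (c, h)).
Proof.
move=> cd c0 M0.
have y0 y : c <= y <= d -> y != 0.
  move=> /andP[? ?]; case: c0 => ?; first by rewrite gt_eqF//; lra.
  by rewrite lt_eqF//; lra.
have dd : c <= d <= d by rewrite cd lexx.
have cc : c <= c <= d by rewrite cd lexx.
rewrite -[RHS]RintegralB//; last 2 first.
- by apply: (@continuous_itg R _ _ (fun h => B (d, h))) => h _; apply: contB_side; exact: y0.
- by apply: (@continuous_itg R _ _ (fun h => B (c, h))) => h _; apply: contB_side; exact: y0.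
apply: (@closed_form_rectangle R A B E c d 0 M 1) => //.
- by move=> y h /y0 yn _; apply: contA; apply: r2_neq0; left.
- by move=> y h /y0 yn _; apply: contB; apply: r2_neq0; left.
- move=> y h /y0 yn /andP[h0 _].
  have rz : r2 (y, h) != 0 by apply: r2_neq0; left.
  by split; [exact: contE|exact: derA_y|exact: derB_x].
Qed.

(** Green's theorem on the strips to the left and right of the small box. *)
Lemma box_path_identity (d N : R) : 0 < d -> d <= N ->
  integ `[- N, - d] (fun y => A (y, 0)) + integ `[d, N] (fun y => A (y, 0)) =
  box_path d - box_path N.
Proof.
move=> d0 dN; have K0 := K_gt0.
have KN : 0 <= K * N by rewrite mulr_ge0 ?ltW//; lra.
have Kd : 0 <= K * d by rewrite mulr_ge0 ?ltW.
have KdN : K * d <= K * N by rewrite ler_pM2l.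
have E1 := @rect_side (- N) (- d) (K * N) ltac:(lra) ltac:(right; lra) KN.
have E2 := @rect_side d N (K * N) dN ltac:(left; lra) KN.
have cd0 h : {for h, continuous (fun t => B (d, t))}.
  by apply: contB_side; rewrite gt_eqF.
have cmd0 h : {for h, continuous (fun t => B (- d, t))}.
  by apply: contB_side; rewrite oppr_eq0 gt_eqF.
have cN0 h : {for h, continuous (fun t => B (N, t))}.
  by apply: contB_side; rewrite gt_eqF//; lra.
have cmN0 h : {for h, continuous (fun t => B (- N, t))}.
  by apply: contB_side; rewrite oppr_eq0 gt_eqF//; lra.
have iB M1 M2 : integ `[M1, M2] (fun h => B (d, h) - B (- d, h)) =
    integ `[M1, M2] (fun h => B (d, h)) - integ `[M1, M2] (fun h => B (- d, h)).
  by rewrite RintegralB//; apply: continuous_itg => *; [exact: cd0|exact: cmd0].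
have iBN M1 M2 : integ `[M1, M2] (fun h => B (N, h) - B (- N, h)) =
    integ `[M1, M2] (fun h => B (N, h)) - integ `[M1, M2] (fun h => B (- N, h)).
  by rewrite RintegralB//; apply: continuous_itg => *; [exact: cN0|exact: cmN0].
have big (y h : R) : - d <= y <= d -> K * d - d / 2 < h -> L * `|y| < h.
  move=> yd hh; have yd' : `|y| <= d by rewrite ler_norml.
  have : L * `|y| <= L * d by rewrite ler_wpM2l ?halfplane_L_ge0.
  by move: hh; rewrite /K mulrDl mul1r; lra.
have E3 : integ `[- d, d] (fun y => A (y, K * N)) -
    integ `[- d, d] (fun y => A (y, K * d)) =
    integ `[K * d, K * N] (fun h => B (d, h) - B (- d, h)).
  apply: (@closed_form_rectangle R A B E _ _ _ _ (d / 2)) => //; try lra.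
  - by move=> y h /big yd /andP[hh _]; apply: contA; apply: r2_neq0; right; exact: yd.
  - move=> y h /big yd /andP[hh _]; apply: contB; apply: r2_neq0; right.
    by apply: yd => /=; lra.
  - move=> y h /big yd /andP[hh _].
    have rz : r2 (y, h) != 0.
      by apply: r2_neq0; right; apply: yd => /=; lra.
    have h0 : 0 < h by lra.
    by split; [exact: contE|exact: derA_y|exact: derB_x].
have cAN y : - N <= y <= N -> {for y, continuous (fun t => A (t, K * N))}.
  move=> yN; apply: contA_line; right.
  have yd' : `|y| <= N by rewrite ler_norml.
  have : L * `|y| <= L * N by rewrite ler_wpM2l ?halfplane_L_ge0.
  by rewrite /K mulrDl mul1r; lra.
have C1 : integ `[- N, N] (fun y => A (y, K * N)) =
    integ `[- N, - d] (fun y => A (y, K * N)) +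
    integ `[- d, N] (fun y => A (y, K * N)).
  by apply: integ_chasles => //; apply/andP; split; lra.
have C2 : integ `[- d, N] (fun y => A (y, K * N)) =
    integ `[- d, d] (fun y => A (y, K * N)) +
    integ `[d, N] (fun y => A (y, K * N)).
  apply: integ_chasles => //; first by apply/andP; split; lra.
  by move=> y /andP[? ?]; apply: cAN; apply/andP; split; lra.
have C3 : integ `[0, K * N] (fun h => B (d, h)) =
    integ `[0, K * d] (fun h => B (d, h)) + integ `[K * d, K * N] (fun h => B (d, h)).
  by apply: integ_chasles => [|*]; [rewrite Kd|exact: cd0].
have C4 : integ `[0, K * N] (fun h => B (- d, h)) =
    integ `[0, K * d] (fun h => B (- d, h)) +
    integ `[K * d, K * N] (fun h => B (- d, h)).
  by apply: integ_chasles => [|*]; [rewrite Kd|exact: cmd0].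
move: E1 E2 E3; rewrite /box_path C1 C2 !iB iBN C3 C4.
lra.
Qed.

Let kA (c1 c2 : R) (z : R * R) := (c1 * - z.1 - c2 * Y z) / r2 z +
  m (x0 - z.1) * ((c2 * - z.1 + c1 * Y z) / r2 z).
Let kB (c1 c2 : R) (z : R * R) := - (e * ((c2 * - z.1 + c1 * Y z) / r2 z)).

Definition box_const c1 c2 (d : R) : R :=
  integ `[0, K * d] (fun h => kB c1 c2 (d, h) - kB c1 c2 (- d, h)) -
  integ `[- d, d] (fun y => kA c1 c2 (y, K * d)).

Lemma contkB c1 c2 (y h : R) : y != 0 ->
  {for h, continuous (fun t => kB c1 c2 (y, t))}.
Proof.
move=> y0; have rz : r2 (y, h) != 0 by apply: r2_neq0; left.
have cY := @contY (y, h); have cr := @contr2 (y, h).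
by apply: (@cont_slice2 R (kB c1 c2)); rewrite /kB; conti.
Qed.

Lemma contkA c1 c2 (y h : R) : L * `|y| < h ->
  {for y, continuous (fun t => kA c1 c2 (t, h))}.
Proof.
move=> H; have rz : r2 (y, h) != 0 by apply: r2_neq0; right.
have cY := @contY (y, h); have cr := @contr2 (y, h); have c3 := @contm (y, h).
by apply: (@cont_slice1 R (kA c1 c2)); rewrite /kA; conti.
Qed.

(** On a box of half-width d the Cauchy kernel has size 1 / d, like the inverse of
    the length of the path. *)
Lemma kernel_bound (y Z d c1 c2 eps : R) : 0 < d -> d ^+ 2 <= y ^+ 2 + Z ^+ 2 ->
  `|c1| <= eps -> `|c2| <= eps ->
  `|(c1 * y + c2 * Z) / (y ^+ 2 + Z ^+ 2)| <= 2 * eps / d.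
Proof.
move=> d0 dr c1e c2e; have d2 : 0 < d ^+ 2 by rewrite exprn_gt0.
have r0 : 0 < y ^+ 2 + Z ^+ 2 by apply: lt_le_trans dr.
have eps0 : 0 <= eps by apply: le_trans c1e.
rewrite normrM normfV (gtr0_norm r0) ler_pdivrMr// mulrAC ler_pdivlMr//.
have half (t : R) : t ^+ 2 <= y ^+ 2 + Z ^+ 2 -> `|t| * d <= y ^+ 2 + Z ^+ 2.
  move=> tr; have : 0 <= (`|t| - d) ^+ 2 by exact: sqr_ge0.
  by rewrite sqrrB real_normK ?num_real//; lra.
have hy : `|y| * d <= y ^+ 2 + Z ^+ 2 by apply: half; rewrite lerDl sqr_ge0.
have hZ : `|Z| * d <= y ^+ 2 + Z ^+ 2 by apply: half; rewrite lerDr sqr_ge0.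
have : `|c1 * y + c2 * Z| <= eps * `|y| + eps * `|Z|.
  by rewrite (le_trans (ler_normD _ _))// !normrM lerD// ler_wpM2r.
move=> /(ler_wpM2r (ltW d0)) /le_trans; apply.
rewrite mulrDl -!mulrA (_ : 2 * _ = eps * (y ^+ 2 + Z ^+ 2) + eps * (y ^+ 2 + Z ^+ 2)).
  by rewrite lerD// ler_wpM2l.
by ring.
Qed.

Definition on_box (d : R) (z : R * R) :=
  (`|z.1| = d /\ 0 <= z.2 <= K * d) \/ (`|z.1| <= d /\ z.2 = K * d).

Lemma on_box_r2 d z : 0 < d -> on_box d z -> d ^+ 2 <= r2 z.
Proof.
move=> d0 [[z1 _]|[z1 z2]]; rewrite /r2.
  by rewrite -[z.1 ^+ 2]real_normK ?num_real// z1 lerDl sqr_ge0.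
have : L * `|z.1| <= L * d by rewrite ler_wpM2l ?halfplane_L_ge0.
move=> Lz; have dY : d <= e * Y z.
  by apply: le_trans (eY_ge z); rewrite z2 /K mulrDl mul1r; lra.
have -> : Y z ^+ 2 = (e * Y z) ^+ 2 by rewrite exprMn [e ^+ 2]expr2 e_sq mul1r.
have : d ^+ 2 <= (e * Y z) ^+ 2 by rewrite ler_pXn2r// nnegrE ?ltW// (lt_le_trans d0).
by have := sqr_ge0 z.1; lra.
Qed.

Lemma kB_bound c1 c2 (d eps : R) z : 0 < d -> on_box d z -> `|c1| <= eps -> `|c2| <= eps ->
  `|kB c1 c2 z| <= 2 * eps / d.
Proof.
move=> d0 bz h1 h2; rewrite /kB normrN normrM e1 mul1r mulrN -mulNr.
by apply: kernel_bound; rewrite ?normrN//; exact: on_box_r2.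
Qed.

Lemma kA_bound c1 c2 (d eps : R) z : 0 < d -> on_box d z -> `|c1| <= eps -> `|c2| <= eps ->
  `|kA c1 c2 z| <= K * (2 * eps / d).
Proof.
move=> d0 bz h1 h2; have -> : K * (2 * eps / d) = 2 * eps / d + L * (2 * eps / d) by rewrite /K; ring.
rewrite /kA; have dr := on_box_r2 d0 bz.
apply: le_trans (ler_normD _ _) _; apply: lerD.
  by rewrite mulrN -mulNr -(mulNr c2); apply: kernel_bound; rewrite ?normrN.
rewrite normrM ler_pM// mulrN -mulNr.
by apply: kernel_bound; rewrite ?normrN.
Qed.

Lemma box_close c1 c2 (d eps : R) : 0 < d ->
  (forall z, on_box d z -> `|g1 z - c1| <= eps /\ `|g2 z - c2| <= eps) ->
  `|box_path d - box_const c1 c2 d| <= 8 * K * eps.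
Proof.
move=> d0 H; have K0 := K_gt0; have L0 := halfplane_L_ge0.
have Kd : 0 <= K * d by rewrite mulr_ge0 ?ltW.
have big (y : R) : - d <= y <= d -> L * `|y| < K * d.
  rewrite -ler_norml => yd; have : L * `|y| <= L * d by rewrite ler_wpM2l.
  by rewrite /K mulrDl mul1r; lra.
have dn : d != 0 by rewrite gt_eqF.
have mdn : - d != 0 by rewrite oppr_eq0.
have cAd y : - d <= y <= d -> {for y, continuous (fun t => A (t, K * d))}.
  by move=> /big yd; apply: contA_line; right.
have ckAd y : - d <= y <= d -> {for y, continuous (fun t => kA c1 c2 (t, K * d))}.
  by move=> /big; exact: contkA.
have cBd h : {for h, continuous (fun t => B (d, t) - B (- d, t))}.
  by apply: cD; [|apply: cN]; exact: contB_side.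
have ckBd h : {for h, continuous (fun t => kB c1 c2 (d, t) - kB c1 c2 (- d, t))}.
  by apply: cD; [|apply: cN]; exact: contkB.
have I1 : `|integ `[0, K * d] (fun h => B (d, h) - B (- d, h)) -
    integ `[0, K * d] (fun h => kB c1 c2 (d, h) - kB c1 c2 (- d, h))| <= 4 * K * eps.
  rewrite -RintegralB//; [|by apply: continuous_itg => h _; exact: cBd
    |by apply: continuous_itg => h _; exact: ckBd].
  have -> : 4 * K * eps = (2 * eps / d + 2 * eps / d) * (K * d - 0).
    by field.
  apply: integ_bound => //.
    by move=> h _; apply: cD; [exact: cBd|apply: cN; exact: ckBd].
  move=> h hK.
  have b1 : on_box d (d, h) by left; rewrite /= gtr0_norm.
  have b2 : on_box d (- d, h) by left; rewrite /= normrN gtr0_norm.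
  have -> : B (d, h) - B (- d, h) - (kB c1 c2 (d, h) - kB c1 c2 (- d, h)) =
    kB (g1 (d, h) - c1) (g2 (d, h) - c2) (d, h)
     - kB (g1 (- d, h) - c1) (g2 (- d, h) - c2) (- d, h).
    by rewrite /B /w2 /kB; ring.
  have [u1 u2] := H _ b1; have [u3 u4] := H _ b2.
  by rewrite (le_trans (ler_normB _ _))// lerD//; exact: kB_bound.
have I2 : `|integ `[- d, d] (fun y => A (y, K * d)) -
    integ `[- d, d] (fun y => kA c1 c2 (y, K * d))| <= 4 * K * eps.
  rewrite -RintegralB//; [|exact: continuous_itg|exact: continuous_itg].
  have -> : 4 * K * eps = K * (2 * eps / d) * (d - - d) by field.
  apply: integ_bound => //; first by lra.
    by move=> y yd; apply: cD; [exact: cAd|apply: cN; exact: ckAd].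
  move=> y yd.
  have b1 : on_box d (y, K * d) by right; rewrite /= ler_norml.
  have -> : A (y, K * d) - kA c1 c2 (y, K * d) =
    kA (g1 (y, K * d) - c1) (g2 (y, K * d) - c2) (y, K * d).
    by rewrite /A /w1 /w2 /kA; ring.
  by have [u1 u2] := H _ b1; exact: kA_bound.
move: I1 I2; rewrite /box_path /box_const !ler_norml => /andP[? ?] /andP[? ?].
by apply/andP; split; lra.
Qed.

Lemma box_const0 d : box_const 0 0 d = 0.
Proof.
rewrite /box_const.
have -> : (fun h => kB 0 0 (d, h) - kB 0 0 (- d, h)) = (fun=> 0 * 0).
  by apply/funext => h; rewrite /kB !mul0r addr0 !mul0r; ring.
have -> : (fun y => kA 0 0 (y, K * d)) = (fun=> 0 * 0).
  by apply/funext => h; rewrite /kA !mul0r subr0 addr0 !mul0r; ring.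
by rewrite !mul0r /Rintegral !integral0 subr0.
Qed.

Lemma side_val c1 c2 (y H : R) : y != 0 -> 0 <= H ->
  integ `[0, H] (fun h => kB c1 c2 (y, h)) =
  (- (c1 / 2 * ln (r2 (y, H))) + c2 * atan (Y (y, H) / y)) -
  (- (c1 / 2 * ln (r2 (y, 0))) + c2 * atan (Y (y, 0) / y)).
Proof.
move=> y0 H0.
have r0 h : 0 < r2 (y, h).
  by rewrite lt_neqAle eq_sym r2_neq0 ?addr_ge0 ?sqr_ge0//; left.
have D (h : R) : is_derive h 1
    (fun h => - (c1 / 2 * ln (r2 (y, h))) + c2 * atan (Y (y, h) / y)) (kB c1 c2 (y, h)).
  have dY : isd (fun t => Y (y, t)) h e.
    by rewrite /Y /=; deriv; cbv beta; ring.
  have dr : isd (fun t => r2 (y, t)) h (2 * Y (y, h) * e).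
    by rewrite /r2 /=; deriv; cbv beta; ring.
  have dl := @d_ln R (fun t => r2 (y, t)) h _ (r0 h) dr.
  have da : isd (fun t => atan (Y (y, t) / y)) h _ := d_atan (dM dY (dC h (y^-1))).
  deriv; cbv beta.
  have := r0 h; rewrite /kB /r2 /=; move: (Y (y, h)) => Z rZ.
  have n1 : y ^+ 2 + Z ^+ 2 != 0 by rewrite gt_eqF.
  by field; rewrite y0 n1.
apply: (@FTC2 R 0 H (fun h => kB c1 c2 (y, h))
  (fun h => - (c1 / 2 * ln (r2 (y, h))) + c2 * atan (Y (y, h) / y))) => //.
- by move=> h _; exact: contkB.
- by move=> h _; exact: is_derive_cont (D h).
Qed.

Lemma lid_val c1 c2 (d H : R) : 0 <= d -> L * d < H ->
  integ `[- d, d] (fun y => kA c1 c2 (y, H)) =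
  (- (c1 / 2 * ln (r2 (d, H))) - c2 * atan (d / Y (d, H))) -
  (- (c1 / 2 * ln (r2 (- d, H))) - c2 * atan (- d / Y (- d, H))).
Proof.
move=> d0 LH.
have big (y : R) : - d <= y <= d -> L * `|y| < H.
  rewrite -ler_norml => yd; apply: le_lt_trans LH.
  by rewrite ler_wpM2l ?halfplane_L_ge0.
have Y0 (y : R) : - d <= y <= d -> Y (y, H) != 0.
  move=> /big yd; apply/negP => /eqP Z; have := eY_ge (y, H).
  by rewrite Z mulr0 /=; lra.
have D (y : R) : - d <= y <= d -> is_derive y 1
    (fun y => - (c1 / 2 * ln (r2 (y, H))) - c2 * atan (y / Y (y, H))) (kA c1 c2 (y, H)).
  move=> yd; have yn := Y0 _ yd.
  have r0 : 0 < r2 (y, H).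
    by rewrite lt_neqAle eq_sym r2_neq0 ?addr_ge0 ?sqr_ge0//; right; exact: big.
  have dx0 : isd (fun t => x0 - t) y (0 - 1) by exact: dD (dC _ _) (dN (dI _)).
  have d0' : isd (fun t => f (x0 - t)) y _ :=
    @dcomp R (fun t => x0 - t) f y _ _ (df (x0 - y)) dx0.
  have dY : isd (fun t => Y (t, H)) y (- m (x0 - y)).
    by rewrite /Y /=; deriv; cbv beta; ring.
  have dr : isd (fun t => r2 (t, H)) y (2 * y - 2 * Y (y, H) * m (x0 - y)).
    by rewrite /r2 /=; deriv; cbv beta; ring.
  have dl := @d_ln R (fun t => r2 (t, H)) y _ r0 dr.
  have da : isd (fun t => atan (t / Y (t, H))) y _ :=
    d_atan (dM (dI y) (@dV R (fun t => Y (t, H)) y _ yn dY)).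
  deriv; cbv beta.
  move: r0 yn; rewrite /kA /r2 /=; move: (Y (y, H)) (m _) => Z mm rZ Zn.
  have n1 : y ^+ 2 + Z ^+ 2 != 0 by rewrite gt_eqF.
  by field; rewrite Zn n1.
apply: (@FTC2 R (- d) d (fun y => kA c1 c2 (y, H))
  (fun y => - (c1 / 2 * ln (r2 (y, H))) - c2 * atan (y / Y (y, H)))).
- lra.
- by move=> y /big; exact: contkA.
- by move=> y yd; exact: is_derive_cont (D y yd).
- by move=> y /andP[? ?]; apply: D; rewrite !ltW.
Qed.

(** For a constant field the closed form is the differential of an argument and of
    a logarithm: the integral is a sum of arctangents of the slopes of the two
    chords of the graph, plus logarithms whose difference tends to 0. *)
Lemma box_const_val c1 c2 (d : R) (sp := (f (x0 - d) - f x0) / d)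
    (sm := (f (x0 + d) - f x0) / d) : 0 < d ->
  box_const c1 c2 d = c1 / 2 * (ln (1 + sp ^+ 2) - ln (1 + sm ^+ 2)) +
    c2 * (e * pi - atan sp - atan sm).
Proof.
move=> d0; have K0 := K_gt0; have L0 := halfplane_L_ge0.
have Kd : 0 <= K * d by rewrite mulr_ge0 ?ltW.
have dn : d != 0 by rewrite gt_eqF.
have mdn : - d != 0 by rewrite oppr_eq0.
have LK : L * d < K * d by rewrite ltr_pM2r// /K; lra.
rewrite /box_const RintegralB//; last 2 first.
- by apply: (@continuous_itg R _ _ (fun h => kB c1 c2 (d, h))) => h _; exact: contkB.
- by apply: (@continuous_itg R _ _ (fun h => kB c1 c2 (- d, h))) => h _; exact: contkB.
rewrite !side_val// lid_val ?ltW//.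
have rp : ln (r2 (d, 0)) = ln (d ^+ 2) + ln (1 + sp ^+ 2).
  rewrite -lnM ?posrE ?exprn_gt0 ?ltr_wpDr ?sqr_ge0//; congr ln.
  by rewrite /r2 /Y /sp /=; field.
have rm : ln (r2 (- d, 0)) = ln (d ^+ 2) + ln (1 + sm ^+ 2).
  rewrite -lnM ?posrE ?exprn_gt0 ?ltr_wpDr ?sqr_ge0//; congr ln.
  by rewrite /r2 /Y /sm /= opprK; field.
have Yp : Y (d, 0) / d = sp by rewrite /Y /sp /= mulr0 addr0.
have Ym : Y (- d, 0) / - d = - sm.
  by rewrite /Y /sm /= mulr0 addr0 opprK invrN mulrN.
have lift y : `|y| = d -> 0 < e * Y (y, K * d).
  move=> yd; apply: lt_le_trans (eY_ge _); rewrite /= yd; lra.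
have Ap : atan (Y (d, K * d) / d) + atan (d / Y (d, K * d)) = e * (pi / 2).
  rewrite -[d / _]invf_div; apply: atan_inv_sign => //.
  by rewrite mulrA divr_gt0// lift// gtr0_norm.
have Am : atan (Y (- d, K * d) / - d) + atan (- d / Y (- d, K * d)) = - (e * (pi / 2)).
  rewrite invrN mulrN mulNr !atanN -[d / _]invf_div -opprD; congr (- _).
  apply: atan_inv_sign => //.
  by rewrite mulrA divr_gt0// lift// normrN gtr0_norm.
rewrite Yp Ym rp rm atanN.
move: Ap Am; set u1 := atan _; set u2 := atan _ => Ap.
set u3 := atan _; set u4 := atan _ => Am.
have -> : u1 = e * (pi / 2) - u2 by rewrite -Ap; ring.
have -> : u3 = - (e * (pi / 2)) - u4 by rewrite -Am; ring.
by field.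
Qed.

Lemma slope_right (s : R) : `|s| = 1 ->
  (f (x0 + s * d) - f x0) / d @[d --> 0^'+] --> s * m x0.
Proof.
move=> s1; apply/cvgrPdist_le => eps eps0.
have /nbhs_ballP[r /= r0 Hr] := is_derive_epsP (df x0) eps0.
near=> d.
have d0 : 0 < d by near: d; exact: nbhs_right_gt.
have sd : `|x0 + s * d - x0| = d by rewrite addrC addKr normrM s1 mul1r gtr0_norm.
have /Hr : ball x0 r (x0 + s * d).
  by rewrite /ball /= distrC sd; near: d; exact: nbhs_right_lt.
rewrite sd => H.
have -> : s * m x0 - (f (x0 + s * d) - f x0) / d =
    - ((f (x0 + s * d) - f x0 - m x0 * (x0 + s * d - x0)) / d).
  by field; rewrite gt_eqF.
by rewrite normrN normrM normfV (gtr0_norm d0) ler_pdivrMr.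
Unshelve. all: by end_near. Qed.

Lemma box_const_cvg c1 c2 : box_const c1 c2 d @[d --> 0^'+] --> e * pi * c2.
Proof.
have Sp : (f (x0 - d) - f x0) / d @[d --> 0^'+] --> - m x0.
  have := @slope_right (- 1) ltac:(by rewrite normrN normr1).
  by rewrite mulN1r; under eq_fun do rewrite mulN1r.
have Sm : (f (x0 + d) - f x0) / d @[d --> 0^'+] --> m x0.
  have := @slope_right 1 (normr1 _).
  by rewrite mul1r; under eq_fun do rewrite mul1r.
have Ln (u : R) : {for u, continuous (fun t : R => ln (1 + t ^+ 2))}.
  apply: (@is_derive_cont _ _ _ ((0 + 2 * u * 1) / (1 + u ^+ 2))).
  by apply: d_ln; [rewrite ltr_wpDr ?sqr_ge0|exact: dD (dC _ _) (dX2 (dI _))].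
have -> : e * pi * c2 = c1 / 2 * (ln (1 + (- m x0) ^+ 2) - ln (1 + (m x0) ^+ 2)) +
    c2 * (e * pi - atan (- m x0) - atan (m x0)).
  by rewrite sqrrN subrr atanN; ring.
have Hc : (c1 / 2 * (ln (1 + ((f (x0 - d) - f x0) / d) ^+ 2) -
      ln (1 + ((f (x0 + d) - f x0) / d) ^+ 2)) +
    c2 * (e * pi - atan ((f (x0 - d) - f x0) / d) - atan ((f (x0 + d) - f x0) / d)))
   @[d --> 0^'+] --> c1 / 2 * (ln (1 + (- m x0) ^+ 2) - ln (1 + (m x0) ^+ 2)) +
    c2 * (e * pi - atan (- m x0) - atan (m x0)).
  apply: cvgD; apply: cvgMr.
    by apply: cvgB; [exact: (cvg_comp _ _ Sp (Ln _))|exact: (cvg_comp _ _ Sm (Ln _))].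
  apply: cvgB; last exact: (cvg_comp _ _ Sm (@continuous_atan R _)).
  apply: cvgB; first exact: cvg_cst.
  exact: (cvg_comp _ _ Sp (@continuous_atan R _)).
apply: cvg_trans Hc; apply: near_eq_cvg; near=> d.
by rewrite box_const_val//; near: d; exact: nbhs_right_gt.
Unshelve. all: by end_near. Qed.

(** Comparison with the constant field frozen at the boundary point. *)
Lemma box_path_cvg : box_path d @[d --> 0^'+] --> e * pi * G2 (x0, 0).
Proof.
have K0 := K_gt0.
apply/cvgrPdist_le => eps eps0.
pose eta := eps / 2 / (8 * K).
have eta0 : 0 < eta by rewrite !divr_gt0// mulr_gt0.
have e2 : 0 < eps / 2 by rewrite divr_gt0.
have /cvgrPdist_le/(_ _ eta0) H1 := @contg1 (0, 0).
have /cvgrPdist_le/(_ _ eta0) H2 := @contg2 (0, 0).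
have H : \forall z \near (0 : R, 0 : R),
    `|g1 (0, 0) - g1 z| <= eta /\ `|g2 (0, 0) - g2 z| <= eta by exact: filterI H1 H2.
have [r r0 Hr] := near_pairP H.
have /cvgrPdist_le/(_ _ e2) Hc := @box_const_cvg (g1 (0, 0)) (g2 (0, 0)).
near=> d.
have d0 : 0 < d by near: d; exact: nbhs_right_gt.
have dr : d <= r by near: d; exact: nbhs_right_le.
have Kdr : K * d <= r.
  by rewrite mulrC -ler_pdivlMr//; near: d; apply: nbhs_right_le; rewrite divr_gt0.
have C : `|e * pi * g2 (0, 0) - box_const (g1 (0, 0)) (g2 (0, 0)) d| <= eps / 2.
  by near: d; exact: Hc.
have B2 : `|box_path d - box_const (g1 (0, 0)) (g2 (0, 0)) d| <= eps / 2.
  have -> : eps / 2 = 8 * K * eta by rewrite /eta; field; rewrite gt_eqF.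
  apply: box_close => // -[y h] bz.
  rewrite [`|g1 _ - _|]distrC [`|g2 _ - _|]distrC.
  have [hy hh] : `|y| <= d /\ `|h| <= K * d.
    have Kd : 0 <= K * d by rewrite mulr_ge0 ?ltW.
    case: bz => /= -[hy hh].
      by move/andP: hh => [h0 hK]; split; [rewrite hy|rewrite ger0_norm].
    by split; [|rewrite hh (ger0_norm Kd)].
  by apply: Hr; rewrite subr0; [exact: le_trans hy _|exact: le_trans hh _].
have -> : G2 (x0, 0) = g2 (0, 0) by rewrite /g2 /= subr0.
by move: C B2; rewrite !ler_norml => /andP[? ?] /andP[? ?]; apply/andP; split; lra.
Unshelve. all: by end_near. Qed.

Lemma box_path_infty : flat_vanish e f G1 G2 -> box_path N @[N --> +oo] --> 0.
Proof.
move=> V; have K0 := K_gt0; apply/cvgrPdist_le => eps eps0.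
have eta0 : 0 < eps / (8 * K) by rewrite !divr_gt0// mulr_gt0.
have [M HM] := V _ eta0.
near=> N.
have N0 : 0 < N by near: N; exact: nbhs_pinfty_gt.
have NM : M + `|x0| + `|f x0| < N.
  by near: N; apply: nbhs_pinfty_gt; rewrite num_real.
rewrite sub0r normrN -[box_path N]subr0 -(box_const0 N).
have -> : eps = 8 * K * (eps / (8 * K)) by field; rewrite gt_eqF.
apply: box_close => // z bz; rewrite !subr0.
have z2 : 0 <= z.2.
  by case: bz => -[_]; [case/andP|move=> ->; rewrite mulr_ge0 ?ltW].
apply: HM => //=.
have [zN|zN] := eqVneq `|z.1| N.
  left; have := ler_normB x0 (x0 - z.1); rewrite opprB addrC subrK zN.
  by have := normr_ge0 (f x0); lra.
right; have [[]|[z1 E2]] := bz; first by move=> E1; rewrite E1 eqxx in zN.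
have YN : N <= e * Y z.
  apply: le_trans (eY_ge z); rewrite E2 /K mulrDl mul1r.
  have : L * `|z.1| <= L * N by rewrite ler_wpM2l ?halfplane_L_ge0.
  by lra.
have Yle : e * Y z <= `|Y z| by rewrite (le_trans (ler_norm _))// normrM e1 mul1r.
have : `|Y z| <= `|f (x0 - z.1) + e * z.2| + `|f x0| by exact: ler_normB.
by have := normr_ge0 x0; lra.
Unshelve. all: by end_near. Qed.

(** The inner path gives half a residue, the outer path nothing, because the field
    vanishes at infinity. *)
Lemma half_plane_limit : flat_vanish e f G1 G2 ->
  integ `[- d^-1, - d] (fun y => A (y, 0)) + integ `[d, d^-1] (fun y => A (y, 0))
    @[d --> 0^'+] --> e * pi * G2 (x0, 0).
Proof.
move=> V.
have inv : (d : R)^-1 @[d --> 0^'+] --> +oo.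
  apply/cvgryPgt => M; near=> d.
  have d0 : 0 < d by near: d; exact: nbhs_right_gt.
  have M0 : 0 < `|M| + 1 by rewrite ltr_pwDr.
  have dM : d < (`|M| + 1)^-1 by near: d; apply: nbhs_right_lt; rewrite invr_gt0.
  apply: (@lt_trans _ _ (`|M| + 1)); first by rewrite (le_lt_trans (ler_norm _))// ltrDl.
  by rewrite -[X in X < _]invrK ltf_pV2 ?posrE ?invr_gt0.
have H : box_path d - box_path d^-1 @[d --> 0^'+] --> e * pi * G2 (x0, 0) - 0.
  apply: cvgB; first exact: box_path_cvg.
  exact: (cvg_comp _ _ inv (box_path_infty V)).
rewrite subr0 in H; apply: cvg_trans H; apply: near_eq_cvg; near=> d.
have d0 : 0 < d by near: d; exact: nbhs_right_gt.
have d1 : d <= 1 by near: d; exact: nbhs_right_le.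
rewrite box_path_identity// (le_trans d1)//.
by rewrite invf_ge1.
Unshelve. all: by end_near. Qed.

End HalfPlane.

(** * Principal values *)
Section PrincipalValue.
Context {R : realType}.
Local Notation mu := (@lebesgue_measure R).
Implicit Types (k : R -> R) (d : R).

Lemma annulusE d : 0 < d ->
  annulus d = `]d, d^-1[%classic `|` `]- d^-1, - d[%classic.
Proof.
move=> d0; apply/seteqP; split=> y; rewrite /annulus /= !in_itv /=.
  have [y0|y0] := ger0P y => /andP[h1 h2]; first by left; rewrite h1.
  by right; apply/andP; split; lra.
case=> /andP[h1 h2].
  by rewrite ger0_norm ?h1// ltW// (lt_trans d0).
have y0 : y < 0 by lra.
by rewrite ltr0_norm//; apply/andP; split; lra.
Qed.

Lemma itgU (A B : set R) k : measurable A -> measurable B ->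
  itg A k -> itg B k -> itg (A `|` B) k.
Proof.
move=> mA mB iA iB; have mAB : measurable (A `|` B) by exact: measurableU.
have ir (C : set R) : measurable C -> C `<=` A `|` B -> itg C k ->
    itg (A `|` B) (fun y => `|(k \_ C) y|).
  move=> mC CAB iC; apply: itg_norm => //; rewrite -restrict_EFin.
  have [H _] := @integrable_restrict _ _ R mu C mC (A `|` B) mAB (EFin \o k).
  by apply: H; rewrite setIidr.
apply: (@itg_le R _ _ (fun y => `|(k \_ A) y| + `|(k \_ B) y|)) => //.
- by apply/measurable_funU => //; split; exact: itg_meas.
- move=> y [] yD; rewrite !patchE; first by rewrite (mem_set yD) lerDl.
  by rewrite (mem_set yD) lerDr.
- by apply: itgD => //; apply: ir.
Qed.

Lemma annulus_itg k d : 0 < d -> (forall y, y != 0 -> {for y, continuous k}) ->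
  itg (annulus d) k.
Proof.
move=> d0 ck; rewrite annulusE//; apply: itgU => //.
  apply: (@itg_sub R _ `[d, d^-1]) => //; first by apply: subset_itv; rewrite bnd_simp.
  by apply: continuous_itg => y /andP[dy _]; apply: ck; rewrite gt_eqF// (lt_le_trans d0).
apply: (@itg_sub R _ `[- d^-1, - d]) => //; first by apply: subset_itv; rewrite bnd_simp.
apply: continuous_itg => y /andP[_ yd]; apply: ck; rewrite lt_eqF//.
by rewrite (le_lt_trans yd)// oppr_lt0.
Qed.

Lemma integ_open a b k : a <= b -> (forall y, a <= y <= b -> {for y, continuous k}) ->
  integ `]a, b[ k = integ `[a, b] k.
Proof.
move=> ab ck; have ik := continuous_itg ck.
rewrite -(@Rintegral_itv_obnd_cbnd R a (BRight b) k); last first.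
  by apply: (@itg_sub R _ `[a, b]) => //; apply: subset_itv; rewrite bnd_simp.
rewrite -(@Rintegral_itv_bndo_bndc R (BRight a) b k)//.
by apply: (@itg_sub R _ `[a, b]) => //; apply: subset_itv; rewrite bnd_simp.
Qed.

Lemma annulus_integ k d : 0 < d <= 1 -> (forall y, y != 0 -> {for y, continuous k}) ->
  integ (annulus d) k = integ `[- d^-1, - d] k + integ `[d, d^-1] k.
Proof.
move=> /andP[d0 d1] ck; have dd : d <= d^-1 by rewrite (le_trans d1)// invf_ge1.
rewrite addrC annulusE// Rintegral_setU//; last 2 first.
- by rewrite -annulusE//; exact: annulus_itg.
- apply/disj_setPS => y [] /=; rewrite !in_itv /= => /andP[h1 _] /andP[_ h2].
  by lra.
congr (_ + _); apply: integ_open => //.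
- by move=> y /andP[dy _]; apply: ck; rewrite gt_eqF// (lt_le_trans d0).
- by rewrite lerN2.
- by move=> y /andP[_ yd]; apply: ck; rewrite lt_eqF// (le_lt_trans yd)// oppr_lt0.
Qed.

Definition has_PV k (l : R) := PV_exists k /\ PV k = l.

Lemma has_PV_intro k l : (forall y, y != 0 -> {for y, continuous k}) ->
  integ `[- d^-1, - d] k + integ `[d, d^-1] k @[d --> 0^'+] --> l -> has_PV k l.
Proof.
move=> ck H.
have C : integ (annulus d) k @[d --> 0^'+] --> l.
  apply: cvg_trans H; apply: near_eq_cvg; near=> d.
  rewrite annulus_integ//; apply/andP; split.
    by near: d; exact: nbhs_right_gt.
  by near: d; exact: nbhs_right_le.
split; last exact/cvg_lim.
split; first by move=> d d0; exact: annulus_itg.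
by apply/cvg_ex; exists l.
Unshelve. all: by end_near. Qed.

Lemma has_PV_cvg k l : has_PV k l -> integ (annulus d) k @[d --> 0^'+] --> l.
Proof. by move=> [[_ C] <-]. Qed.

Lemma has_PV_lim k l :
  (forall d, 0 < d -> itg (annulus d) k) ->
  integ (annulus d) k @[d --> 0^'+] --> l -> has_PV k l.
Proof.
move=> ik C; split; last exact/cvg_lim.
by split=> //; apply/cvg_ex; exists l.
Qed.

Lemma measurable_annulus d : 0 < d -> measurable (annulus d).
Proof. by move=> d0; rewrite annulusE//; exact: measurableU. Qed.

Lemma has_PVD k1 k2 l1 l2 : has_PV k1 l1 -> has_PV k2 l2 ->
  has_PV (fun y => k1 y + k2 y) (l1 + l2).
Proof.
move=> h1 h2; have [[i1 _] _] := h1; have [[i2 _] _] := h2.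
apply: has_PV_lim.
  move=> d d0; apply: itgD; [exact: measurable_annulus|exact: i1|exact: i2].
apply: cvg_trans (cvgD (has_PV_cvg h1) (has_PV_cvg h2)); apply: near_eq_cvg.
near=> d.
have d0 : 0 < d by near: d; exact: nbhs_right_gt.
by rewrite /= RintegralD//; [exact: measurable_annulus|exact: i1|exact: i2].
Unshelve. all: by end_near. Qed.

Lemma has_PVZ k c l : has_PV k l -> has_PV (fun y => c * k y) (c * l).
Proof.
move=> h1; have [[i1 _] _] := h1.
apply: has_PV_lim.
  move=> d d0; apply: itgZ; [exact: measurable_annulus|exact: i1].
have H : c * integ (annulus d) k @[d --> 0^'+] --> c * l.
  by apply: cvgMr; exact: has_PV_cvg.
apply: cvg_trans H; apply: near_eq_cvg; near=> d.
have d0 : 0 < d by near: d; exact: nbhs_right_gt.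
by rewrite /= RintegralZl//; [exact: measurable_annulus|exact: i1].
Unshelve. all: by end_near. Qed.

Lemma has_PV_eq k1 k2 l1 l2 : has_PV k1 l1 -> k1 =1 k2 -> l1 = l2 -> has_PV k2 l2.
Proof. by move=> h /funext <- <-. Qed.

Lemma has_PV_unique k l1 l2 : has_PV k l1 -> has_PV k l2 -> l1 = l2.
Proof. by move=> [_ <-] [_ <-]. Qed.

End PrincipalValue.

(** * Plemelj's formula for one phase *)
Section Plemelj.
Context {R : realType}.
Implicit Types (f m : R -> R) (G : R * R -> R).

(** Plemelj's formula for one phase: the principal value over the boundary of a
    field that is analytic on one side picks up half the residue. *)
Lemma plemelj_phase (e L : R) f m G1 G2 a b (x : R) : `|e| = 1 ->
  (forall x : R, is_derive x 1 f (m x)) -> continuous m -> (forall x, `|m x| <= L) ->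
  flat_field e m G1 G2 a b -> flat_vanish e f G1 G2 ->
  has_PV (fun y => - ((G1 (x - y, 0) + m (x - y) * G2 (x - y, 0)) * y
     + (G2 (x - y, 0) - m (x - y) * G1 (x - y, 0)) * (f (x - y) - f x)) /
     denominator f x y) (e * pi * G2 (x, 0)).
Proof.
move=> e1 df cm mL GF V.
have H := @half_plane_limit _ _ _ _ _ _ _ _ _ x e1 df cm mL GF V.
have E y : - ((G1 (x - y, 0) + m (x - y) * G2 (x - y, 0)) * y
     + (G2 (x - y, 0) - m (x - y) * G1 (x - y, 0)) * (f (x - y) - f x)) /
     denominator f x y =
  (G1 (x - y, 0) * - y - G2 (x - y, 0) * (f (x - y) + e * 0 - f x)) /
     (y ^+ 2 + (f (x - y) + e * 0 - f x) ^+ 2) +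
   m (x - y) * ((G2 (x - y, 0) * - y + G1 (x - y, 0) * (f (x - y) + e * 0 - f x)) /
     (y ^+ 2 + (f (x - y) + e * 0 - f x) ^+ 2)).
  rewrite /denominator mulr0 addr0 -[(f x - f (x - y)) ^+ 2]sqrrN opprB.
  by rewrite mulrA -mulrDl; congr (_ / _); ring.
rewrite (funext E); apply: has_PV_intro; last exact: H.
move=> y y0.
exact: (@contA_line _ e L f m G1 G2 a b x e1 df cm mL GF y 0 (or_introl y0)).
Qed.

End Plemelj.

(** * Scaling and the Lorentz kernel *)
Section LineIntegrals.
Context {R : realType}.
Local Notation mu := (@lebesgue_measure R).
Implicit Types (g G : R -> R).

Lemma scale_ge0 g (x h : R) : 0 < h -> continuous g -> (forall s, 0 <= g s) ->
  itg setT g -> itg setT (fun t => g (x + h * t)) /\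
  integ setT g = h * integ setT (fun t => g (x + h * t)).
Proof.
move=> h0 cg g0 ig.
pose F (t : R) := x + h * t.
have dF (t : R) : is_derive t 1 F h.
  by rewrite /F; deriv; cbv beta; ring.
have cF : continuous F by move=> t; exact: is_derive_cont (dF t).
have F'E : F^`() = fun=> h.
  by apply/funext => t; rewrite derive1E; have [_ ->] := dF t.
have cgF : continuous (fun t => g (F t)).
  by move=> t; exact: (@ccomp R R F g t (cg _) (cF t)).
have E : (\int[mu]_t (g t)%:E = \int[mu]_t (g (F t) * h)%:E)%E.
  rewrite (@increasing_ge0_integration_by_substitutionT R F g) ?F'E//.
  - by move=> s t st; rewrite /F ltrD2l ltr_pM2l.
  - by move=> t; exact: cst_continuous.
  - exact: is_cvg_cst.
  - exact: is_cvg_cst.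
  - apply/cvgrNyPle => A; near=> t.
    rewrite /F -lerBrDl mulrC -ler_pdivlMr//; near: t; exact: nbhs_ninfty_le.
  - apply/cvgryPge => A; near=> t.
    rewrite /F -lerBlDl mulrC -ler_pdivrMr//; near: t; exact: nbhs_pinfty_ge.
have gF0 t : 0 <= g (F t) * h by rewrite mulr_ge0// ltW.
have mgF : measurable_fun setT (fun t => g (F t) * h).
  by apply: cont_meas => t; apply: cM; [exact: cgF|exact: cC].
have igh : itg setT (fun t => g (F t) * h).
  apply/integrableP; split; first exact/measurable_EFinP.
  under eq_integral do rewrite gee0_abs ?lee_fin//.
  rewrite -E; have /integrableP[_] := ig.
  by under eq_integral do rewrite gee0_abs ?lee_fin//.
have hn : h != 0 by rewrite gt_eqF.
have igF : itg setT (fun t => g (F t)).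
  have -> : (fun t => g (F t)) = (fun t => h^-1 * (g (F t) * h)).
    by apply/funext => t; field.
  exact: itgZ.
split=> //.
rewrite /Rintegral E -/(Rintegral _ _ _) -RintegralZl//.
by apply: eq_Rintegral => t _; rewrite mulrC.
Unshelve. all: by end_near. Qed.

Lemma integ_scale g (x h : R) : 0 < h -> continuous g -> itg setT g ->
  itg setT (fun t => g (x + h * t)) /\
  integ setT g = h * integ setT (fun t => g (x + h * t)).
Proof.
move=> h0 cg ig.
have cn : continuous (fun s => `|g s|).
  by move=> s; exact: (@ccomp R R g Num.norm s (@norm_continuous _ R _) (cg s)).
have in_ := itg_norm measurableT ig.
pose gp s := 2^-1 * (`|g s| + g s); pose gm s := 2^-1 * (`|g s| - g s).
have [ip Ep] : itg setT (fun t => gp (x + h * t)) /\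
    integ setT gp = h * integ setT (fun t => gp (x + h * t)).
  apply: scale_ge0 => //.
  - move=> s; have c1 : {for s, continuous g} := cg s.
    by have c2 : {for s, continuous (fun s => `|g s|)} := cn s; rewrite /gp; conti.
  - by move=> s; rewrite mulr_ge0// -lerBlDr sub0r -normrN ler_norm.
  - by apply: itgZ => //; exact: itgD.
have [im Em] : itg setT (fun t => gm (x + h * t)) /\
    integ setT gm = h * integ setT (fun t => gm (x + h * t)).
  apply: scale_ge0 => //.
  - move=> s; have c1 : {for s, continuous g} := cg s.
    by have c2 : {for s, continuous (fun s => `|g s|)} := cn s; rewrite /gm; conti.
  - by move=> s; rewrite mulr_ge0// subr_ge0 ler_norm.
  - by apply: itgZ => //; exact: itgB.
have gE s : g s = gp s - gm s by rewrite /gp /gm; field.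
have -> : (fun t => g (x + h * t)) = (fun t => gp (x + h * t) - gm (x + h * t)).
  by apply/funext => t; exact: gE.
split; first exact: itgB.
rewrite RintegralB// mulrBr -Ep -Em -RintegralB//; last 2 first.
- by apply: itgZ => //; exact: itgD.
- by apply: itgZ => //; exact: itgB.
by apply: eq_Rintegral => s _; exact: gE.
Qed.

(** [1 / ((s - x)^2 + eta^2)], the square of the size of the Cauchy kernel. *)
Lemma lorentz (x eta : R) : 0 < eta ->
  itg setT (fun s => ((s - x) ^+ 2 + eta ^+ 2)^-1) /\
  integ setT (fun s => ((s - x) ^+ 2 + eta ^+ 2)^-1) <= pi / eta.
Proof.
move=> e0; have en : eta != 0 by rewrite gt_eqF.
have r0 s : 0 < (s - x) ^+ 2 + eta ^+ 2.
  by rewrite ltr_wpDl ?sqr_ge0// exprn_gt0.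
have rn s : (s - x) ^+ 2 + eta ^+ 2 != 0 by rewrite gt_eqF.
have -> : pi / eta = 2 * (pi / 2 / eta) by field.
apply: (@line_itg R _ (fun s => eta^-1 * atan ((s - x) / eta))).
- by move=> s; have n0 := rn s; conti.
- by move=> s; rewrite invr_ge0 ltW.
- move=> s; have da : isd (fun s => atan ((s - x) / eta)) s _ :=
    d_atan (dM (dD (dI s) (dC s (- x))) (dC s (eta^-1))).
  by deriv; cbv beta; field; rewrite en rn.
- move=> s; rewrite normrM gtr0_norm ?invr_gt0// mulrC ler_pM2r ?invr_gt0//.
  by rewrite ler_norml !ltW ?atan_gtNpi2 ?atan_ltpi2.
Qed.

Lemma lorentz1 : itg setT (fun s : R => (1 + s ^+ 2)^-1).
Proof.
have [i _] := @lorentz 0 1 ltr01; apply: (@itg_le R _ _ _ measurableT _ _ i).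
  apply: cont_meas => s; have n0 : 1 + s ^+ 2 != 0.
    by rewrite gt_eqF// ltr_wpDr ?sqr_ge0.
  by conti.
by move=> s _; rewrite subr0 expr1n addrC ger0_norm// invr_ge0 addr_ge0 ?sqr_ge0.
Qed.

End LineIntegrals.

(** * The Cauchy integral over a graph *)
Section CauchyIntegral.
Context {R : realType}.
Local Notation mu := (@lebesgue_measure R).
Context (L W : R) (f m w : R -> R).
Context (df : forall x : R, is_derive x 1 f (m x)).
Context (cm : continuous m) (mL : forall x, `|m x| <= L).
Context (cw : continuous w) (wW : forall x, `|w x| <= W).
Context (w2 : itg setT (fun s => w s ^+ 2)).
Implicit Types (z : R * R) (s : R).

Definition rr z s := (s - z.1) ^+ 2 + (f s - z.2) ^+ 2.
Definition ker1 z s := (s - z.1) / rr z s.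
Definition ker2 z s := (f s - z.2) / rr z s.
Definition dker1 z s := ((s - z.1) ^+ 2 - (f s - z.2) ^+ 2) / rr z s ^+ 2.
Definition dker2 z s := 2 * ((s - z.1) * (f s - z.2)) / rr z s ^+ 2.

Definition off_graph z := z.2 != f z.1.

Definition C0 := 2 + 2 * L ^+ 2.

Lemma C0_gt0 : 0 < C0.
Proof. by rewrite /C0 ltr_wpDr// mulr_ge0// sqr_ge0. Qed.

(** Seen from a point at height Z above it, a graph of slope at most L behaves like
    its horizontal tangent, up to the constant [C0]. *)
Lemma sq_le_C0 (X Z D : R) : `|D| <= L * `|X| ->
  X ^+ 2 + Z ^+ 2 <= C0 * (X ^+ 2 + (D - Z) ^+ 2).
Proof.
move=> DX; have D2 : D ^+ 2 <= L ^+ 2 * X ^+ 2.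
  rewrite -[D ^+ 2]real_normK ?num_real// -[X ^+ 2]real_normK ?num_real// -exprMn.
  by rewrite ler_pXn2r// nnegrE// (le_trans _ DX).
have h1 : 0 <= (2 * D - Z) ^+ 2 by exact: sqr_ge0.
have h2 := mulr_ge0 (sqr_ge0 L) (sqr_ge0 (D - Z)).
have h3 := sqr_ge0 X.
have -> : C0 * (X ^+ 2 + (D - Z) ^+ 2) = X ^+ 2 + Z ^+ 2 + (2 * D - Z) ^+ 2 +
  2 * (L ^+ 2 * (D - Z) ^+ 2) + X ^+ 2 + 2 * (L ^+ 2 * X ^+ 2 - D ^+ 2).
  by rewrite /C0; ring.
by lra.
Qed.

Lemma rr_ge z s : (s - z.1) ^+ 2 + (z.2 - f z.1) ^+ 2 <= C0 * rr z s.
Proof.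
rewrite /rr (_ : f s - z.2 = (f s - f z.1) - (z.2 - f z.1)); last by ring.
by apply: sq_le_C0; exact: (lipschitz df mL).
Qed.

Lemma rr_gt0 z s : off_graph z -> 0 < rr z s.
Proof.
move=> zn; rewrite -(pmulr_rgt0 _ C0_gt0); apply: lt_le_trans (rr_ge z s).
by rewrite ltr_wpDl ?sqr_ge0// lt_neqAle sqr_ge0 andbT eq_sym sqrf_eq0 subr_eq0.
Qed.

Lemma off_graph_near z : off_graph z -> exists2 c : R, 0 < c &
  exists2 d, 0 < d & forall x y, `|x - z.1| <= d -> `|y - z.2| <= d ->
    off_graph (x, y) /\ forall s, 1 + s ^+ 2 <= c * rr (x, y) s.
Proof.
move=> zn; pose h := `|z.2 - f z.1| / 2.
have h0 : 0 < h by rewrite divr_gt0// normr_gt0 subr_eq0.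
have L0 : 0 <= L by exact: le_trans (mL 0).
pose b := `|z.1| + 1; pose d := Num.min 1 (h / (L + 1)).
have L1 : 0 < L + 1 by lra.
have d0 : 0 < d by rewrite lt_min ltr01 divr_gt0.
have d1 : d <= 1 by rewrite ge_min lexx.
have dL : d * (L + 1) <= h.
  by rewrite -ler_pdivlMr// ge_min lexx orbT.
pose c := (2 + (1 + 2 * b ^+ 2) / h ^+ 2) * C0.
have c0 : 0 < c.
  by rewrite mulr_gt0 ?C0_gt0// ltr_wpDr// divr_ge0 ?sqr_ge0// addr_ge0// mulr_ge0 ?sqr_ge0.
exists c => //; exists d => // x y xd yd.
have fx : `|f x - f z.1| <= L * d.
  by apply: le_trans (lipschitz df mL _ _) _; rewrite ler_wpM2l.
have hy : h <= `|y - f x|.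
  have : 2 * h <= `|y - f x| + `|y - z.2| + `|f x - f z.1|.
    have -> : 2 * h = `|z.2 - f z.1| by rewrite /h; field.
    have -> : z.2 - f z.1 = (y - f x) - (y - z.2) + (f x - f z.1) by ring.
    by rewrite (le_trans (ler_normD _ _))// lerD2r ler_normB.
  by move: dL; rewrite mulrDr mulr1 mulrC; lra.
split; first by rewrite /off_graph -subr_eq0 -normr_gt0 (lt_le_trans h0).
move=> s; have xb : x ^+ 2 <= b ^+ 2.
  rewrite -[x ^+ 2]real_normK ?num_real// ler_pXn2r// ?nnegrE// /b ?addr_ge0//.
  have -> : x = z.1 + (x - z.1) by ring.
  by rewrite (le_trans (ler_normD _ _))// lerD2l (le_trans xd).
rewrite /c -mulrA; apply: le_trans (ler_wpM2l _ (rr_ge (x, y) s)); last first.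
  by rewrite addr_ge0// divr_ge0 ?sqr_ge0// addr_ge0// mulr_ge0 ?sqr_ge0.
have hy2 : h ^+ 2 <= (y - f x) ^+ 2.
  rewrite -[(y - f x) ^+ 2]real_normK ?num_real// ler_pXn2r// nnegrE//.
  exact: ltW.
have k1 : 1 + 2 * b ^+ 2 <= (1 + 2 * b ^+ 2) / h ^+ 2 * (y - f x) ^+ 2.
  rewrite mulrAC ler_pdivlMr ?exprn_gt0// ler_wpM2l// addr_ge0// mulr_ge0 ?sqr_ge0//.
have k2 : 0 <= (1 + 2 * b ^+ 2) / h ^+ 2 * (s - x) ^+ 2.
  rewrite mulr_ge0 ?sqr_ge0// divr_ge0 ?sqr_ge0// addr_ge0// mulr_ge0 ?sqr_ge0//.
have k3 : 0 <= (s - 2 * x) ^+ 2 by exact: sqr_ge0.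
have k4 : 0 <= (y - f x) ^+ 2 by exact: sqr_ge0.
move: k1 k2; rewrite /=; move: ((1 + 2 * b ^+ 2) / h ^+ 2) => q; lra.
Qed.

(** The majorant w^2 + (1 + W) / r^2 is common to the Cauchy kernels, of order -1,
    and to their derivatives, of order -2, so that one dominated convergence
    argument serves all of them. *)
Record admissible (K : R * R -> R -> R) : Prop := Admissible {
  adm_z : forall z s, off_graph z -> {for z, continuous (fun z => K z s)};
  adm_s : forall z s, off_graph z -> {for s, continuous (fun s => K z s)};
  adm_dom : forall z s, off_graph z -> `|w s * K z s| <= w s ^+ 2 + (1 + W) / rr z s }.

Lemma W_ge0 : 0 <= W. Proof. exact: le_trans (wW 0). Qed.

Lemma cont_fs : continuous f.
Proof. by move=> x; exact: is_derive_cont (df x). Qed.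

Lemma rr_contz z s : {for z, continuous (fun z => rr z s)}.
Proof. by rewrite /rr; conti. Qed.

Lemma rr_conts z s : {for s, continuous (fun s => rr z s)}.
Proof. by have cf := cont_fs; rewrite /rr; conti. Qed.

Lemma dom_first (X r v : R) : 0 < r -> X ^+ 2 <= r ->
  `|v * (X / r)| <= v ^+ 2 + (1 + W) / r.
Proof.
move=> r0 Xr; have rn : r != 0 by rewrite gt_eqF.
have h1 : (X / r) ^+ 2 <= r^-1.
  by rewrite expr_div_n ler_pdivrMr ?exprn_gt0// [r ^+ 2]expr2 mulKf.
have h2 : 0 <= (`|v| - `|X / r|) ^+ 2 by exact: sqr_ge0.
have h3 : 0 <= W / r by rewrite divr_ge0 ?W_ge0// ltW.
have h4 : 0 <= r^-1 by rewrite invr_ge0 ltW.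
rewrite normrM mulrDl mul1r.
move: h2; rewrite sqrrB !real_normK ?num_real//.
have h5 := sqr_ge0 v; have h6 := sqr_ge0 (X / r); lra.
Qed.

Lemma dom_second (Q r v : R) : 0 < r -> `|Q| <= r -> `|v| <= W ->
  `|v * (Q / r ^+ 2)| <= v ^+ 2 + (1 + W) / r.
Proof.
move=> r0 Qr vW; have rn : r != 0 by rewrite gt_eqF.
have h1 : `|Q / r ^+ 2| <= r^-1.
  rewrite normrM normfV (ger0_norm (sqr_ge0 r)) ler_pdivrMr ?exprn_gt0//.
  by rewrite expr2 mulKf.
have h4 : 0 <= r^-1 by rewrite invr_ge0 ltW.
rewrite normrM mulrDl mul1r.
have : `|v| * `|Q / r ^+ 2| <= W * r^-1 by rewrite ler_pM.
by have := sqr_ge0 v; lra.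
Qed.

Lemma adm_ker1 : admissible ker1.
Proof.
have cf := cont_fs; split.
- move=> z s zn; have n0 : rr z s != 0 by rewrite gt_eqF ?rr_gt0.
  by have cr := @rr_contz z s; rewrite /ker1; conti.
- move=> z s zn; have n0 : rr z s != 0 by rewrite gt_eqF ?rr_gt0.
  by have cr := @rr_conts z s; rewrite /ker1; conti.
- by move=> z s zn; apply: dom_first; rewrite ?rr_gt0// /rr lerDl sqr_ge0.
Qed.

Lemma adm_ker2 : admissible ker2.
Proof.
have cf := cont_fs; split.
- move=> z s zn; have n0 : rr z s != 0 by rewrite gt_eqF ?rr_gt0.
  by have cr := @rr_contz z s; rewrite /ker2; conti.
- move=> z s zn; have n0 : rr z s != 0 by rewrite gt_eqF ?rr_gt0.
  by have cr := @rr_conts z s; rewrite /ker2; conti.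
- by move=> z s zn; apply: dom_first; rewrite ?rr_gt0// /rr lerDr sqr_ge0.
Qed.

Lemma adm_dker1 : admissible dker1.
Proof.
have cf := cont_fs; split.
- move=> z s zn; have n0 : rr z s ^+ 2 != 0 by rewrite expf_neq0// gt_eqF ?rr_gt0.
  by have cr := @rr_contz z s; rewrite /dker1; conti.
- move=> z s zn; have n0 : rr z s ^+ 2 != 0 by rewrite expf_neq0// gt_eqF ?rr_gt0.
  by have cr := @rr_conts z s; rewrite /dker1; conti.
- move=> z s zn; apply: dom_second; rewrite ?rr_gt0// /rr ler_norml.
  have := sqr_ge0 (s - z.1); have := sqr_ge0 (f s - z.2).
  by move=> h1 h2; apply/andP; split; lra.
Qed.

Lemma adm_dker2 : admissible dker2.
Proof.
have cf := cont_fs; split.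
- move=> z s zn; have n0 : rr z s ^+ 2 != 0 by rewrite expf_neq0// gt_eqF ?rr_gt0.
  by have cr := @rr_contz z s; rewrite /dker2; conti.
- move=> z s zn; have n0 : rr z s ^+ 2 != 0 by rewrite expf_neq0// gt_eqF ?rr_gt0.
  by have cr := @rr_conts z s; rewrite /dker2; conti.
- move=> z s zn; apply: dom_second; rewrite ?rr_gt0// /rr ler_norml.
  have := sqr_ge0 ((s - z.1) + (f s - z.2)); have := sqr_ge0 ((s - z.1) - (f s - z.2)).
  by rewrite sqrrD sqrrB => h1 h2; apply/andP; split; lra.
Qed.

Definition cint (K : R * R -> R -> R) z := integ setT (fun s => w s * K z s).

Definition majorant (c : R) s := w s ^+ 2 + (1 + W) * c * (1 + s ^+ 2)^-1.

Lemma majorant_itg c : itg setT (majorant c).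
Proof. by apply: itgD => //; apply: itgZ => //; exact: lorentz1. Qed.

Lemma adm_majorant K z c s : admissible K -> off_graph z ->
  1 + s ^+ 2 <= c * rr z s -> `|w s * K z s| <= majorant c s.
Proof.
move=> aK zn crr; apply: le_trans (@adm_dom _ aK z s zn) _.
rewrite /majorant lerD2l -mulrA ler_wpM2l ?addr_ge0 ?W_ge0//.
have r0 := rr_gt0 s zn; have s0 : 0 < 1 + s ^+ 2 by rewrite ltr_wpDr ?sqr_ge0.
by rewrite -[X in X <= _]mul1r ler_pdivrMr// mulrAC ler_pdivlMr// mul1r.
Qed.

Lemma cint_meas K z : admissible K -> off_graph z ->
  measurable_fun setT (fun s => w s * K z s).
Proof.
by move=> aK zn; apply: cont_meas => s; have cK := @adm_s _ aK z s zn; conti.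
Qed.

Lemma cint_itg K z : admissible K -> off_graph z -> itg setT (fun s => w s * K z s).
Proof.
move=> aK zn; have [c c0 [d d0 H]] := off_graph_near zn.
have zz (t : R) : `|t - t| <= d by rewrite subrr normr0 ltW.
have [zn' rs] := H z.1 z.2 (zz _) (zz _).
apply: (@itg_le R _ _ (majorant c)) => //; [exact: cint_meas| |exact: majorant_itg].
by move=> s _; apply: adm_majorant => //; rewrite (surjective_pairing z).
Qed.

Lemma cint_cont K z : admissible K -> off_graph z -> {for z, continuous (cint K)}.
Proof.
move=> aK zn; have [c c0 [d d0 H]] := off_graph_near zn.
have N : \forall z' \near z, off_graph z' /\ forall s, 1 + s ^+ 2 <= c * rr z' s.
  rewrite (surjective_pairing z); apply: (pair_nearP d0) => x y xd yd.
  by apply: H; exact: ltW.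
apply: (@cvg_param R (R * R)%type (fun z s => w s * K z s) z setT (majorant c)) => //.
- exact: majorant_itg.
- by apply: filterS N => z' [zn' _]; exact: cint_meas.
- by apply: filterS N => z' [zn' rs] s _; exact: adm_majorant.
- by move=> s _; have cK := @adm_z _ aK z s zn; have : {for z, continuous (fun z => w s * K z s)} by conti.
Qed.

Lemma cint_derx K dK z : admissible K -> admissible dK ->
  (forall x y s, off_graph (x, y) -> is_derive x 1 (fun t => K (t, y) s) (dK (x, y) s)) ->
  off_graph z -> is_derive z.1 1 (fun t => cint K (t, z.2)) (cint dK z).
Proof.
move=> aK adK dE zn; have [c c0 [d d0 H]] := off_graph_near zn.
have yy : `|z.2 - z.2| <= d by rewrite subrr normr0 ltW.
have -> : cint dK z = integ setT (fun s => w s * dK (z.1, z.2) s).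
  by rewrite -surjective_pairing.
apply: (@is_derive_param R (fun t s => w s * K (t, z.2) s)
  (fun t s => w s * dK (t, z.2) s) setT (majorant c) z.1 d) => //.
- exact: majorant_itg.
- by move=> t /ltW td; have [zn' _] := H t z.2 td yy; exact: cint_itg.
- move=> t s /ltW td _; have [zn' _] := H t z.2 td yy.
  have dk : isd (fun t => K (t, z.2) s) t _ := dE _ _ s zn'.
  by deriv; cbv beta; rewrite mulr0 addr0.
- by move=> t s /ltW td _; have [zn' rs] := H t z.2 td yy; exact: adm_majorant.
Qed.

Lemma cint_dery K dK z : admissible K -> admissible dK ->
  (forall x y s, off_graph (x, y) -> is_derive y 1 (fun t => K (x, t) s) (dK (x, y) s)) ->
  off_graph z -> is_derive z.2 1 (fun t => cint K (z.1, t)) (cint dK z).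
Proof.
move=> aK adK dE zn; have [c c0 [d d0 H]] := off_graph_near zn.
have xx : `|z.1 - z.1| <= d by rewrite subrr normr0 ltW.
have -> : cint dK z = integ setT (fun s => w s * dK (z.1, z.2) s).
  by rewrite -surjective_pairing.
apply: (@is_derive_param R (fun t s => w s * K (z.1, t) s)
  (fun t s => w s * dK (z.1, t) s) setT (majorant c) z.2 d) => //.
- exact: majorant_itg.
- by move=> t /ltW td; have [zn' _] := H z.1 t xx td; exact: cint_itg.
- move=> t s /ltW td _; have [zn' _] := H z.1 t xx td.
  have dk : isd (fun t => K (z.1, t) s) t _ := dE _ _ s zn'.
  by deriv; cbv beta; rewrite mulr0 addr0.
- by move=> t s /ltW td _; have [zn' rs] := H z.1 t xx td; exact: adm_majorant.
Qed.

Lemma dker (x y s : R) : off_graph (x, y) ->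
  [/\ is_derive x 1 (fun t => ker1 (t, y) s) (dker1 (x, y) s),
      is_derive y 1 (fun t => ker1 (x, t) s) (dker2 (x, y) s),
      is_derive x 1 (fun t => ker2 (t, y) s) (dker2 (x, y) s) &
      is_derive y 1 (fun t => ker2 (x, t) s) (- dker1 (x, y) s)].
Proof.
move=> zn; have r0 := rr_gt0 s zn.
have n0 : (s - x) ^+ 2 + (f s - y) ^+ 2 != 0 by rewrite gt_eqF.
rewrite /ker1 /ker2 /dker1 /dker2 /rr /=; split; deriv; try exact: n0; cbv beta; by field.
Qed.

Lemma cint_opp K z : admissible K -> off_graph z ->
  cint (fun z s => - K z s) z = - cint K z.
Proof.
move=> aK zn; rewrite /cint -[RHS]mulN1r -RintegralZl//; last exact: cint_itg.
by apply: eq_Rintegral => s _; rewrite mulrN mulN1r.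
Qed.

Lemma adm_opp K : admissible K -> admissible (fun z s => - K z s).
Proof.
case=> cz cs dm; split.
- by move=> z s zn; have c1 := cz z s zn; conti.
- by move=> z s zn; have c1 := cs z s zn; conti.
- by move=> z s zn; rewrite mulrN normrN; exact: dm.
Qed.

Lemma off_graph_open z : off_graph z -> \forall z' \near z, off_graph z'.
Proof.
move=> zn; have [c c0 [d d0 H]] := off_graph_near zn.
rewrite (surjective_pairing z); apply: (pair_nearP d0) => x y xd yd.
by have [] := H x y (ltW xd) (ltW yd).
Qed.

Definition J1 := cint ker1.
Definition J2 := cint ker2.
Definition M1 := cint dker1.
Definition M2 := cint dker2.

Lemma dJ x y : off_graph (x, y) ->
  [/\ is_derive x 1 (fun t => J1 (t, y)) (M1 (x, y)),
      is_derive y 1 (fun t => J1 (x, t)) (M2 (x, y)),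
      is_derive x 1 (fun t => J2 (t, y)) (M2 (x, y)) &
      is_derive y 1 (fun t => J2 (x, t)) (- M1 (x, y))].
Proof.
move=> zn; split.
- apply: (cint_derx adm_ker1 adm_dker1 _ zn) => x' y' s zn'.
  by have [] := dker s zn'.
- apply: (cint_dery adm_ker1 adm_dker2 _ zn) => x' y' s zn'.
  by have [] := dker s zn'.
- apply: (cint_derx adm_ker2 adm_dker2 _ zn) => x' y' s zn'.
  by have [] := dker s zn'.
- rewrite /M1 -(cint_opp adm_dker1 zn).
  apply: (cint_dery adm_ker2 (adm_opp adm_dker1) _ zn) => x' y' s zn'.
  by have [] := dker s zn'.
Qed.

(* The two identities below say that w ds = (ph1 + i ph2) d zeta with
   zeta = s + i f(s), so that one can integrate by parts along the graph. *)
Context (ph1 ph2 q1 q2 : R -> R).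
Context (dph1 : forall x : R, is_derive x 1 ph1 (q1 x)).
Context (dph2 : forall x : R, is_derive x 1 ph2 (q2 x)).
Context (cq1 : continuous q1) (cq2 : continuous q2).
Context (ph1W : forall x, `|ph1 x| <= W) (ph2W : forall x, `|ph2 x| <= W).
Context (w_ph : forall x, ph1 x - m x * ph2 x = w x).
Context (ph_w : forall x, ph2 x + m x * ph1 x = 0).
Context (q1L2 : itg setT (fun s => q1 s ^+ 2)) (q2L2 : itg setT (fun s => q2 s ^+ 2)).

Lemma rrV_itg z : off_graph z -> itg setT (fun s => (rr z s)^-1) /\
  integ setT (fun s => (rr z s)^-1) <= C0 * (pi / `|z.2 - f z.1|).
Proof.
move=> zn; have h0 : 0 < `|z.2 - f z.1| by rewrite normr_gt0 subr_eq0.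
have [il bl] := lorentz z.1 h0.
have le s : (rr z s)^-1 <= C0 * ((s - z.1) ^+ 2 + `|z.2 - f z.1| ^+ 2)^-1.
  have r0 := rr_gt0 s zn; rewrite real_normK ?num_real//.
  have d0 : 0 < (s - z.1) ^+ 2 + (z.2 - f z.1) ^+ 2.
    by rewrite ltr_wpDl ?sqr_ge0// -real_normK ?num_real// exprn_gt0.
  rewrite ler_pdivlMr// mulrC ler_pdivrMr// ?mulr_gt0//.
  exact: rr_ge.
have iC := itgZ C0 measurableT il.
have ir : itg setT (fun s => (rr z s)^-1).
  apply: (@itg_le R _ _ _ measurableT _ _ iC) => [|s _].
    apply: cont_meas => s; have n0 : rr z s != 0 by rewrite gt_eqF// rr_gt0.
    by have cr := @rr_conts z s; conti.
  by rewrite ger0_norm ?le// invr_ge0 ltW// rr_gt0.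
split=> //; apply: le_trans (ler_wpM2l (ltW C0_gt0) bl).
by rewrite -RintegralZl//; apply: le_Rintegral => // s _; exact: le.
Qed.

Lemma ker_sq z s : off_graph z -> ker1 z s ^+ 2 + ker2 z s ^+ 2 = (rr z s)^-1.
Proof.
move=> /(rr_gt0 s) r0; have : rr z s != 0 by rewrite gt_eqF.
by rewrite /ker1 /ker2 /rr => rn; field.
Qed.

(** Young's inequality with a weight adapted to the distance h to the graph: a
    square integrable function against a Cauchy kernel costs only h^(-1/2), which
    is integrable up to the graph. *)
Definition sqrt_const := (integ setT (fun s => q1 s ^+ 2) +
  integ setT (fun s => q2 s ^+ 2) + C0 * pi) / 2.

Lemma half_order g z : off_graph z -> continuous g ->
  (forall s, `|g s| <= `|q1 s| * `|ker1 z s| + `|q2 s| * `|ker2 z s| \/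
             `|g s| <= `|q2 s| * `|ker1 z s| + `|q1 s| * `|ker2 z s|) ->
  itg setT g /\ `|integ setT g| <= sqrt_const / Num.sqrt `|z.2 - f z.1|.
Proof.
move=> zn cg gle; have h0 : 0 < `|z.2 - f z.1| by rewrite normr_gt0 subr_eq0.
set t := Num.sqrt _; have t0 : 0 < t by rewrite sqrtr_gt0.
have tt : t * t = `|z.2 - f z.1| by rewrite -expr2 sqr_sqrtr// ltW.
have [ir br] := rrV_itg zn.
have tn : t != 0 by rewrite gt_eqF.
pose b s := (2 * t)^-1 * (q1 s ^+ 2 + q2 s ^+ 2) + t / 2 * (rr z s)^-1.
have young (u v : R) : `|u| * `|v| <= (2 * t)^-1 * u ^+ 2 + t / 2 * v ^+ 2.
  have : 0 <= (2 * t)^-1 * (`|u| - t * `|v|) ^+ 2.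
    by rewrite mulr_ge0 ?sqr_ge0// invr_ge0 mulr_ge0// ltW.
  have -> : (2 * t)^-1 * (`|u| - t * `|v|) ^+ 2 =
     (2 * t)^-1 * `|u| ^+ 2 + t / 2 * `|v| ^+ 2 - `|u| * `|v| by field.
  by rewrite !real_normK ?num_real// subr_ge0.
have gb s : `|g s| <= b s.
  rewrite /b -(ker_sq s zn).
  have a1 := young (q1 s) (ker1 z s); have a2 := young (q2 s) (ker2 z s).
  have a3 := young (q2 s) (ker1 z s); have a4 := young (q1 s) (ker2 z s).
  by rewrite !mulrDr; case: (gle s) => H; apply: le_trans H _; lra.
have iq : itg setT (fun s => q1 s ^+ 2 + q2 s ^+ 2) by exact: itgD.
have i1 := itgZ (2 * t)^-1 measurableT iq.
have i2 := itgZ (t / 2) measurableT ir.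
have ib : itg setT b by exact: itgD.
have ig : itg setT g.
  by apply: (@itg_le R _ _ b) => //; exact: cont_meas.
split=> //; apply: le_trans (le_normr_Rintegral measurableT ig) _.
apply: (@le_trans _ _ (integ setT b)).
  by apply: le_Rintegral => //; exact: itg_norm.
rewrite /b RintegralD// !RintegralZl// RintegralD//.
have : t / 2 * integ setT (fun s => (rr z s)^-1) <= C0 * pi / 2 / t.
  have -> : C0 * pi / 2 / t = t / 2 * (C0 * (pi / `|z.2 - f z.1|)).
    by rewrite -tt; field.
  by rewrite ler_wpM2l// divr_ge0// ltW.
rewrite /sqrt_const.
move: (integ setT (fun s => (rr z s)^-1)) => I3 H3.
rewrite [X in _ <= X](_ : _ = (2 * t)^-1 * (integ setT (fun s => q1 s ^+ 2) +
  integ setT (fun s => q2 s ^+ 2)) + C0 * pi / 2 / t); last by field.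
by rewrite lerD2l.
Qed.

Lemma ker_le z s : s != z.1 -> off_graph z ->
  `|ker1 z s| <= `|s - z.1|^-1 /\ `|ker2 z s| <= `|s - z.1|^-1.
Proof.
move=> sz zn; have r0 := rr_gt0 s zn.
have x0 : 0 < `|s - z.1| by rewrite normr_gt0 subr_eq0.
have H (u : R) : `|u| * `|s - z.1| <= rr z s -> `|u / rr z s| <= `|s - z.1|^-1.
  move=> H; rewrite normrM normfV (gtr0_norm r0) ler_pdivrMr//.
  by rewrite ler_pdivlMl// mulrC.
split; apply: H; rewrite /rr.
  by rewrite -normrM -expr2 ger0_norm ?sqr_ge0// lerDl sqr_ge0.
rewrite -[X in _ <= X + _]real_normK ?num_real// -[X in _ <= _ + X]real_normK ?num_real//.
have := sqr_ge0 (`|f s - z.2| - `|s - z.1|); have := sqr_ge0 (`|f s - z.2| + `|s - z.1|).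
by rewrite sqrrB sqrrD; lra.
Qed.

Lemma ker_cvg z (u : R -> R) (K : R * R -> R -> R) : off_graph z ->
  (forall s, `|u s| <= W) ->
  (forall s, s != z.1 -> `|K z s| <= `|s - z.1|^-1) ->
  (u s * K z s @[s --> +oo] --> 0) /\ (u s * K z s @[s --> -oo] --> 0).
Proof.
move=> zn uW Kle; have W0 := W_ge0.
have main (s eps : R) : 0 < eps -> (W + 1) / eps < `|s - z.1| -> `|u s * K z s| <= eps.
  move=> eps0 H; have x0 : 0 < `|s - z.1|.
    by apply: le_lt_trans H; rewrite divr_ge0 ?ltW//; lra.
  have sz : s != z.1 by rewrite -subr_eq0 -normr_gt0.
  rewrite normrM; apply: (@le_trans _ _ (W * `|s - z.1|^-1)).
    by rewrite ler_pM// Kle.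
  rewrite ler_pdivrMr//; move: H; rewrite ltr_pdivrMr// mulrC; lra.
split; apply/cvgr0Pnorm_le => eps eps0; near=> s; apply: main => //.
  apply: (@lt_le_trans _ _ (s - z.1)); last exact: ler_norm.
  by rewrite ltrBrDr; near: s; apply: nbhs_pinfty_gt; rewrite num_real.
rewrite -normrN opprB.
apply: (@lt_le_trans _ _ (z.1 - s)); last exact: ler_norm.
by rewrite ltrBrDr -ltrBrDl; near: s; apply: nbhs_ninfty_lt; rewrite num_real.
Unshelve. all: by end_near. Qed.

Lemma dker_s z s : off_graph z ->
  isd (fun s => ker1 z s) s ((rr z s - (s - z.1) * (2 * (s - z.1) + 2 * (f s - z.2) * m s)) / rr z s ^+ 2) /\
  isd (fun s => ker2 z s) s ((m s * rr z s - (f s - z.2) * (2 * (s - z.1) + 2 * (f s - z.2) * m s)) / rr z s ^+ 2).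
Proof.
move=> zn; have n0 : (s - z.1) ^+ 2 + (f s - z.2) ^+ 2 != 0.
  by rewrite gt_eqF//; exact: (rr_gt0 s zn).
have d1 : isd f s (m s) := df s.
by rewrite /ker1 /ker2 /rr; split; deriv; try exact: n0; cbv beta; field.
Qed.

(** The derivative of the Cauchy kernel in z is minus its derivative along the
    graph, which is moved to the density: the singularity drops by one order. *)
Lemma M1_parts z : off_graph z ->
  M1 z = integ setT (fun s => q1 s * ker1 z s + q2 s * ker2 z s).
Proof.
move=> zn; have rn s : rr z s != 0 by rewrite gt_eqF ?rr_gt0.
have c1 : continuous (fun s => ker1 z s) by move=> s; exact: (@adm_s _ adm_ker1 z s zn).
have c2 : continuous (fun s => ker2 z s) by move=> s; exact: (@adm_s _ adm_ker2 z s zn).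
have c3 : continuous (fun s => dker1 z s) by move=> s; exact: (@adm_s _ adm_dker1 z s zn).
have cg : continuous (fun s => q1 s * ker1 z s + q2 s * ker2 z s) by move=> s; conti.
have ig : itg setT (fun s => q1 s * ker1 z s + q2 s * ker2 z s).
  apply: (half_order zn cg _).1 => s; left.
  by rewrite (le_trans (ler_normD _ _))// !normrM.
have iw := cint_itg adm_dker1 zn.
have H : integ setT (fun s => (q1 s * ker1 z s + q2 s * ker2 z s) - w s * dker1 z s) = 0 - 0.
  apply: (@line_FTC R _ (fun s => ph1 s * ker1 z s + ph2 s * ker2 z s)).
  - by move=> s; conti.
  - move=> s; have [k1 k2] := dker_s s zn.
    have e1 : isd ph1 s (q1 s) := dph1 s; have e2 : isd ph2 s (q2 s) := dph2 s.
    deriv; cbv beta; rewrite -w_ph /ker1 /ker2 /dker1.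
    have E := ph_w s; have := rn s; rewrite /rr.
    move: (s - z.1) (f s - z.2) => X Y r.
    have -> : ph2 s = - (m s * ph1 s) by rewrite -[LHS]addr0 -[X in _ + X](subrr (m s * ph1 s)) addrA E add0r.
    by field.
  - exact: itgB.
  - rewrite -[X in _ --> X]addr0; apply: cvgD.
    + by have [] := @ker_cvg z ph1 ker1 zn ph1W (fun s sz => (ker_le sz zn).1).
    + by have [] := @ker_cvg z ph2 ker2 zn ph2W (fun s sz => (ker_le sz zn).2).
  - rewrite -[X in _ --> X]addr0; apply: cvgD.
    + by have [] := @ker_cvg z ph1 ker1 zn ph1W (fun s sz => (ker_le sz zn).1).
    + by have [] := @ker_cvg z ph2 ker2 zn ph2W (fun s sz => (ker_le sz zn).2).
by move: H; rewrite subr0 RintegralB// => /eqP; rewrite subr_eq0 => /eqP ->.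
Qed.

Lemma M2_parts z : off_graph z ->
  M2 z = integ setT (fun s => q1 s * ker2 z s - q2 s * ker1 z s).
Proof.
move=> zn; have rn s : rr z s != 0 by rewrite gt_eqF ?rr_gt0.
have c1 : continuous (fun s => ker1 z s) by move=> s; exact: (@adm_s _ adm_ker1 z s zn).
have c2 : continuous (fun s => ker2 z s) by move=> s; exact: (@adm_s _ adm_ker2 z s zn).
have c3 : continuous (fun s => dker2 z s) by move=> s; exact: (@adm_s _ adm_dker2 z s zn).
have cg : continuous (fun s => q1 s * ker2 z s - q2 s * ker1 z s) by move=> s; conti.
have ig : itg setT (fun s => q1 s * ker2 z s - q2 s * ker1 z s).
  apply: (half_order zn cg _).1 => s; right.
  by rewrite [X in _ <= X]addrC (le_trans (ler_normB _ _))// !normrM.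
have iw := cint_itg adm_dker2 zn.
have H : integ setT (fun s => (q1 s * ker2 z s - q2 s * ker1 z s) - w s * dker2 z s) = 0 - 0.
  apply: (@line_FTC R _ (fun s => ph1 s * ker2 z s - ph2 s * ker1 z s)).
  - by move=> s; conti.
  - move=> s; have [k1 k2] := dker_s s zn.
    have e1 : isd ph1 s (q1 s) := dph1 s; have e2 : isd ph2 s (q2 s) := dph2 s.
    deriv; cbv beta; rewrite -w_ph /ker1 /ker2 /dker2.
    have E := ph_w s; have := rn s; rewrite /rr.
    move: (s - z.1) (f s - z.2) => X Y r.
    have -> : ph2 s = - (m s * ph1 s) by rewrite -[LHS]addr0 -[X in _ + X](subrr (m s * ph1 s)) addrA E add0r.
    by field.
  - exact: itgB.
  - rewrite -[X in _ --> X]subr0; apply: cvgB.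
    + by have [] := @ker_cvg z ph1 ker2 zn ph1W (fun s sz => (ker_le sz zn).2).
    + by have [] := @ker_cvg z ph2 ker1 zn ph2W (fun s sz => (ker_le sz zn).1).
  - rewrite -[X in _ --> X]subr0; apply: cvgB.
    + by have [] := @ker_cvg z ph1 ker2 zn ph1W (fun s sz => (ker_le sz zn).2).
    + by have [] := @ker_cvg z ph2 ker1 zn ph2W (fun s sz => (ker_le sz zn).1).
by move: H; rewrite subr0 RintegralB// => /eqP; rewrite subr_eq0 => /eqP ->.
Qed.

Lemma M_bound z : off_graph z ->
  `|M1 z| <= sqrt_const / Num.sqrt `|z.2 - f z.1| /\
  `|M2 z| <= sqrt_const / Num.sqrt `|z.2 - f z.1|.
Proof.
move=> zn; rewrite M1_parts// M2_parts//.
have c1 : continuous (fun s => ker1 z s) by move=> s; exact: (@adm_s _ adm_ker1 z s zn).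
have c2 : continuous (fun s => ker2 z s) by move=> s; exact: (@adm_s _ adm_ker2 z s zn).
split.
  apply: (half_order zn _ _).2 => s; first by conti.
  by left; rewrite (le_trans (ler_normD _ _))// !normrM.
apply: (half_order zn _ _).2 => s; first by conti.
by right; rewrite [X in _ <= X]addrC (le_trans (ler_normB _ _))// !normrM.
Qed.

(** The half-order bound of the derivative, integrated by comparing with a multiple
    of the square root. *)
Lemma sqrt_mvt (g dg : R -> R) (C : R) :
  (forall t : R, 0 < t -> is_derive t 1 g (dg t)) ->
  (forall t : R, 0 < t -> `|dg t| <= C / Num.sqrt t) ->
  forall t u : R, 0 < t -> t <= u -> `|g u - g t| <= 2 * C * (Num.sqrt u - Num.sqrt t).
Proof.
move=> dgE dgC t u t0 tu; have u0 : 0 < u by exact: lt_le_trans tu.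
have dpos (v : R) : `|v - u| <= `|t - u| -> 0 < v.
  by rewrite [X in _ <= X]ler0_norm ?subr_le0// ler_norml => /andP[? _]; lra.
have dC (v sg : R) : 0 < v -> is_derive v 1 (fun v => 2 * C * Num.sqrt v + sg * g v)
     (C / Num.sqrt v + sg * dg v).
  move=> v0; have dg' : isd g v (dg v) := dgE v v0.
  have ds : isd Num.sqrt v ((2 * Num.sqrt v)^-1) := is_derive1_sqrt v0.
  have sn : Num.sqrt v != 0 by rewrite gt_eqF// sqrtr_gt0.
  by deriv; cbv beta; field.
have main (sg : R) : `|sg| = 1 ->
    0 <= (2 * C * Num.sqrt u + sg * g u) - (2 * C * Num.sqrt t + sg * g t).
  move=> s1.
  have [v vu|v vu E] := @mvt R (fun v => 2 * C * Num.sqrt v + sg * g v)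
     (fun v => C / Num.sqrt v + sg * dg v) u t.
    exact/dC/dpos.
  rewrite -[X in 0 <= X]opprB E -mulrN opprB mulr_ge0 ?subr_ge0//.
  have := dgC v (dpos _ vu); have : `|sg * dg v| = `|dg v| by rewrite normrM s1 mul1r.
  by move=> <-; rewrite ler_norml => /andP[? _]; lra.
have m1 := main 1 (normr1 _).
have m2 := main (- 1) ltac:(by rewrite normrN normr1).
by rewrite ler_norml; apply/andP; split; lra.
Qed.

Lemma sqrt_sub (t u : R) : 0 <= t -> t <= u -> Num.sqrt u - Num.sqrt t <= Num.sqrt (u - t).
Proof.
move=> t0 tu; rewrite lerBlDr -[X in _ <= X]ger0_norm ?addr_ge0 ?sqrtr_ge0//.
rewrite -sqrtr_sqr ler_wsqrtr// sqrrD !sqr_sqrtr ?subr_ge0//.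
by have := mulr_ge0 (sqrtr_ge0 (u - t)) (sqrtr_ge0 t); lra.
Qed.

Context (e : R) (e1 : `|e| = 1).

Lemma phase_dist (x t : R) : 0 < t ->
  off_graph (x, f x + e * t) /\ `|f x + e * t - f x| = t.
Proof.
move=> t0; have E : `|f x + e * t - f x| = t.
  by rewrite addrAC subrr add0r normrM e1 mul1r gtr0_norm.
by split; rewrite // /off_graph /= -subr_eq0 -normr_gt0 E.
Qed.

Lemma sqrt_const_ge0 : 0 <= sqrt_const.
Proof.
rewrite /sqrt_const divr_ge0// !addr_ge0//.
- by apply: Rintegral_ge0 => s _; exact: sqr_ge0.
- by apply: Rintegral_ge0 => s _; exact: sqr_ge0.
- by rewrite mulr_ge0 ?pi_ge0// ltW// C0_gt0.
Qed.

(** Both components satisfy the same estimates and are treated together. *)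
Definition JJ (b : bool) := if b then J1 else J2.

Lemma JJ_vertical b (x t u : R) : 0 < t -> t <= u ->
  `|JJ b (x, f x + e * u) - JJ b (x, f x + e * t)| <= 2 * sqrt_const * Num.sqrt (u - t).
Proof.
move=> t0 tu; apply: (@le_trans _ _ (2 * sqrt_const * (Num.sqrt u - Num.sqrt t))).
  apply: (@sqrt_mvt (fun t => JJ b (x, f x + e * t))
    (fun t => (if b then M2 (x, f x + e * t) else - M1 (x, f x + e * t)) * e)) => //.
    move=> v v0; have [zn _] := phase_dist x v0.
    have dl : isd (fun v => f x + e * v) v e by deriv; cbv beta; ring.
    have [_ d1 _ d2] := dJ zn.
    case: b.
      exact: (@dcomp R (fun v => f x + e * v) (fun t => J1 (x, t)) v _ _ d1 dl).
    exact: (@dcomp R (fun v => f x + e * v) (fun t => J2 (x, t)) v _ _ d2 dl).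
  move=> v v0; have [zn E] := phase_dist x v0.
  have [] := M_bound zn; rewrite /= E normrM e1 mulr1.
  by case: b; rewrite ?normrN.
apply: ler_wpM2l; first by rewrite mulr_ge0 ?sqrt_const_ge0.
by apply: sqrt_sub => //; exact: ltW.
Qed.

Definition approx b (n : nat) (z : R * R) :=
  JJ b (z.1, f z.1 + e * (Num.max z.2 0 + n.+1%:R^-1)).

Lemma approx_cauchy b z n k : (n <= k)%N ->
  `|approx b n z - approx b k z| <= 2 * sqrt_const * Num.sqrt n.+1%:R^-1.
Proof.
move=> nk; have t0 : 0 < Num.max z.2 0 + k.+1%:R^-1.
  by rewrite ltr_wpDl ?le_max ?lexx ?orbT// invr_gt0.
apply: le_trans (JJ_vertical b z.1 t0 _) _.
  by rewrite lerD2l lef_pV2 ?posrE// ler_nat.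
apply: ler_wpM2l; first by rewrite mulr_ge0 ?sqrt_const_ge0.
by apply: ler_wsqrtr; rewrite opprD addrACA subrr add0r lerBlDr lerDl invr_ge0.
Qed.

Lemma sqrt_inv_cvg : 2 * sqrt_const * Num.sqrt (n.+1%:R : R)^-1 @[n --> \oo] --> 0.
Proof.
rewrite -[X in _ --> X](mulr0 (2 * sqrt_const)); apply: cvgMr.
rewrite -[X in _ --> X](@sqrtr0 R).
have H : (n.+1%:R : R)^-1 @[n --> \oo] --> 0 by exact: cvg_harmonic.
exact: (cvg_comp _ _ H (@sqrt_continuous R 0)).
Qed.

Lemma approx_cvg b z : cvg (approx b n z @[n --> \oo]).
Proof.
apply/cauchy_cvgP/cauchyP => eps eps0.
have /cvgr0_norm_lt/(_ _ eps0)[N _ HN] := sqrt_inv_cvg.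
exists (approx b N z).
suff : \forall k \near \oo, ball (approx b N z) eps (approx b k z) by [].
near=> k; rewrite /ball /=.
apply: le_lt_trans (approx_cauchy b z _) _.
  by near: k; exact: nbhs_infty_ge.
by apply: le_lt_trans (ler_norm _) (HN N _) => /=.
Unshelve. all: by end_near. Qed.

(** The approximations from height 1 / (n + 1) converge uniformly, which yields
    continuity up to the boundary. *)
Definition ext b (z : R * R) := lim (approx b n z @[n --> \oo]).

Lemma approx_ext b z n :
  `|approx b n z - ext b z| <= 2 * sqrt_const * Num.sqrt n.+1%:R^-1.
Proof.
have C : `|approx b n z - approx b k z| @[k --> \oo] --> `|approx b n z - ext b z|.
  by apply: cvg_norm; apply: cvgB; [exact: cvg_cst|exact: approx_cvg].
rewrite -(cvg_lim _ C)//; apply: limr_le; first by apply/cvg_ex; eexists; exact: C.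
by near=> k; apply: approx_cauchy; near: k; exact: nbhs_infty_ge.
Unshelve. all: by end_near. Qed.

Lemma JJ_cont b z : off_graph z -> {for z, continuous (JJ b)}.
Proof. by case: b; apply: cint_cont; [exact: adm_ker1|exact: adm_ker2]. Qed.

Lemma max_cont (z : R * R) : {for z, continuous (fun z : R * R => Num.max z.2 0)}.
Proof.
have -> : (fun z : R * R => Num.max z.2 0) = (fun z : R * R => 2^-1 * (z.2 + `|z.2|)).
  apply/funext => y; case: (ger0P y.2) => ?; by field.
have c1 : {for z, continuous (fun z : R * R => z.2)} by conti.
have c2 : {for z, continuous (fun z : R * R => `|z.2|)}.
  exact: (@ccomp R _ (fun z : R * R => z.2) Num.norm z (@norm_continuous _ R _) c1).
by conti.
Qed.

Lemma approx_cont b n z : {for z, continuous (approx b n)}.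
Proof.
have t0 : 0 < Num.max z.2 0 + n.+1%:R^-1.
  by rewrite ltr_wpDl ?le_max ?lexx ?orbT// invr_gt0.
have [zn _] := phase_dist z.1 t0.
have c1 := @max_cont z.
have c0 : {for z, continuous (fun z : R * R => z.1)} by conti.
have c2 : {for z, continuous (fun z : R * R => f z.1)}.
  exact: (ccompf cont_fs c0).
have c3 : {for z, continuous (fun z : R * R => f z.1 + e * (Num.max z.2 0 + n.+1%:R^-1))}.
  by conti.
rewrite /approx.
exact: (@ccompf2 R _ (JJ b) (fun z : R * R => z.1)
  (fun z : R * R => f z.1 + e * (Num.max z.2 0 + n.+1%:R^-1)) z (@JJ_cont b _ zn) c0 c3).
Qed.

Lemma ext_cont b : continuous (ext b).
Proof.
move=> z; apply/cvgrPdist_le => eps eps0.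
have e3 : 0 < eps / 3 by rewrite divr_gt0.
have /cvgr0_norm_le/(_ _ e3)[N _ /(_ N (leqnn _)) HN] := sqrt_inv_cvg.
have /cvgrPdist_le/(_ _ e3) HA := @approx_cont b N z.
near=> z'.
have A1 : `|approx b N z - approx b N z'| <= eps / 3 by near: z'; exact: HA.
have A2 := le_trans (approx_ext b z N) (le_trans (ler_norm _) HN).
have A3 := le_trans (approx_ext b z' N) (le_trans (ler_norm _) HN).
move: A1 A2 A3; rewrite !ler_norml => /andP[? ?] /andP[? ?] /andP[? ?].
by apply/andP; split; lra.
Unshelve. all: by end_near. Qed.

Lemma ext_inside b (x y : R) : 0 < y -> ext b (x, y) = JJ b (x, f x + e * y).
Proof.
move=> y0; apply/cvg_lim => //.
have [zn _] := phase_dist x y0.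
have H : f x + e * (y + n.+1%:R^-1) @[n --> \oo] --> f x + e * (y + 0).
  apply: cvgD; first exact: cvg_cst.
  apply: cvgMr; apply: cvgD; first exact: cvg_cst.
  exact: cvg_harmonic.
rewrite addr0 in H.
have C := cvg_comp _ _ H (@cont_slice2 R (JJ b) x _ (@JJ_cont b _ zn)).
by apply: cvg_trans C; apply: near_eq_cvg; near=> n; rewrite /approx /= max_l// ltW.
Unshelve. all: by end_near. Qed.

Lemma inv_sq_le (k r c : R) : 0 < c -> 0 < r -> k ^+ 2 <= r^-1 -> c ^+ 2 <= r ->
  `|k| <= c^-1.
Proof.
move=> c0 r0 kr cr; have rc : r^-1 <= c^-1 ^+ 2.
  by rewrite exprVn lef_pV2 ?posrE ?exprn_gt0.
have H : `|k| ^+ 2 <= c^-1 ^+ 2 by rewrite real_normK ?num_real// (le_trans kr).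
by move: H; rewrite ler_pXn2r ?nnegrE ?normr_ge0 ?invr_ge0 ?(ltW c0).
Qed.

(** By contradiction along a sequence of points z_n.  The part min(|w K|, w^2 / t)
    of the integrand tends to 0 and is dominated by w^2 / t; the rest is at most
    t / r^2, whose integral is bounded in terms of the distance h to the graph. *)
Lemma far_field b (h eps : R) : 0 < h -> 0 < eps -> exists N, forall z,
  h <= `|z.2 - f z.1| -> N < `|z.1| \/ N < `|z.2| -> `|JJ b z| <= eps.
Proof.
move=> h0 eps0; apply: contrapT => nex.
have /choice[u Hu] : forall n : nat, exists z, [/\ h <= `|z.2 - f z.1|,
    n%:R < `|z.1| \/ n%:R < `|z.2| & eps < `|JJ b z|].
  move=> n; apply: contrapT => nz; apply: nex; exists n%:R => z hz Nz.
  rewrite leNgt; apply/negP => ez; apply: nz; exists z; split=> //.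
have un n : off_graph (u n).
  by have [hu _ _] := Hu n; rewrite /off_graph -subr_eq0 -normr_gt0 (lt_le_trans h0).
pose K := if b then ker1 else ker2.
have aK : admissible K by rewrite /K; case: (b); [exact: adm_ker1|exact: adm_ker2].
have K2 z s : off_graph z -> K z s ^+ 2 <= (rr z s)^-1.
  by move=> zn; rewrite -ker_sq// /K; case: (b); rewrite ?lerDl ?lerDr sqr_ge0.
pose I := C0 * (pi / h).
have I0 : 0 < I by rewrite mulr_gt0 ?C0_gt0// divr_gt0 ?pi_gt0.
(* chosen so that the remainder t / r^2 contributes at most eps / 2 *)
pose t := eps / (2 * I); have t0 : 0 < t by rewrite divr_gt0// mulr_gt0.
pose q n s := Num.min `|w s * K (u n) s| (w s ^+ 2 / t).
have mK n : measurable_fun setT (fun s => w s * K (u n) s) by exact: cint_meas.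
have iw : itg setT (fun s => t^-1 * w s ^+ 2) by exact: itgZ.
have mq n : measurable_fun setT (q n).
  apply: measurable_minr; first exact: measurableT_comp.
  by apply: cont_meas => s; conti; rewrite gt_eqF.
have q0 n s : 0 <= q n s by rewrite le_min normr_ge0 divr_ge0 ?sqr_ge0// ltW.
have qle n s : `|q n s| <= t^-1 * w s ^+ 2.
  by rewrite ger0_norm// ge_min (mulrC t^-1) lexx orbT.
have qcvg s : setT s -> q n s @[n --> \oo] --> 0.
  move=> _; apply/cvgr0Pnorm_le => d d0.
  pose B := `|s| + `|f s| + W / d + 1.
  have Wd : 0 <= W / d by rewrite divr_ge0 ?W_ge0// ltW.
  near=> n.
  have nB : B < n%:R by near: n; exact: nbhs_infty_gtr.
  rewrite ger0_norm// ge_min; apply/orP; left.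
  have [_ far _] := Hu n; have r0 := rr_gt0 s (un n).
  have c0 : 0 < W / d + 1 by lra.
  have cr : (W / d + 1) ^+ 2 <= rr (u n) s.
    have sq (v : R) : W / d + 1 <= `|v| -> (W / d + 1) ^+ 2 <= v ^+ 2.
      by move=> H; rewrite -[v ^+ 2]real_normK ?num_real// ler_pXn2r// nnegrE// ltW.
    have s0 := normr_ge0 s; have f0 := normr_ge0 (f s).
    rewrite /rr; case: far => far.
      have H := sq (s - (u n).1).
      have : `|(u n).1| <= `|s| + `|s - (u n).1|.
        have := ler_normB (s) (s - (u n).1).
        by rewrite opprB addrCA subrr addr0.
      move=> H2; have := sqr_ge0 (f s - (u n).2).
      by have := H ltac:(move: nB; rewrite /B; lra); lra.
    have H := sq (f s - (u n).2).
    have : `|(u n).2| <= `|f s| + `|f s - (u n).2|.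
      have := ler_normB (f s) (f s - (u n).2).
      by rewrite opprB addrCA subrr addr0.
    move=> H2; have := sqr_ge0 (s - (u n).1).
    by have := H ltac:(move: nB; rewrite /B; lra); lra.
  have kle := inv_sq_le c0 r0 (K2 _ s (un n)) cr.
  rewrite normrM; apply: (@le_trans _ _ (W * (W / d + 1)^-1)); first by rewrite ler_pM.
  rewrite ler_pdivrMr// mulrDr mulr1 mulrCA divff ?gt_eqF// mulr1 lerDl ltW//.
have [_ C] := @dct R setT q (fun=> 0) (fun s => t^-1 * w s ^+ 2) measurableT mq qcvg iw
   (fun n s _ => qle n s).
have e2 : 0 < eps / 2 by rewrite divr_gt0.
have z0 : integ setT (fun=> 0 : R) = 0 by rewrite /Rintegral integral0.
rewrite z0 in C; have /cvgr0_norm_lt/(_ _ e2)[N _ /(_ N (leqnn _)) /= HN] := C.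
have [hu _ eu] := Hu N; have zn := un N.
have iq : itg setT (q N).
  by apply: (@itg_le R _ _ _ measurableT (mq N) _ iw) => s _; exact: qle.
have [ir br] := rrV_itg zn.
have brI : integ setT (fun s => (rr (u N) s)^-1) <= I.
  apply: le_trans br _; rewrite /I ler_wpM2l ?(ltW C0_gt0)//.
  by rewrite ler_wpM2l ?pi_ge0// lef_pV2 ?posrE// (lt_le_trans h0).
have itr := itgZ t measurableT ir.
have iK : itg setT (fun s => w s * K (u N) s) by exact: cint_itg.
have pw s : `|w s * K (u N) s| <= t * (rr (u N) s)^-1 + q N s.
  have k2 := K2 _ s zn; have r0 : 0 <= t * (rr (u N) s)^-1.
    by rewrite mulr_ge0 ?ltW ?invr_gt0 ?rr_gt0.
  rewrite /q; case: (leP `|w s * K (u N) s| (w s ^+ 2 / t)) => [_|lt]; first by rewrite lerDr.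
  suff H : `|w s * K (u N) s| <= t * (rr (u N) s)^-1.
    by rewrite (le_trans H)// lerDl divr_ge0 ?sqr_ge0// ltW.
  apply: le_trans (ler_wpM2l (ltW t0) k2).
  move: lt; rewrite ltr_pdivrMr// normrM => lt.
  have w0 : 0 < `|w s|.
    rewrite normr_gt0; apply/eqP => w0; move: lt.
    by rewrite w0 normr0 expr0n /= !mul0r ltxx.
  have : `|w s| < `|K (u N) s| * t.
    rewrite -(ltr_pM2l w0) mulrA; move: lt.
    by rewrite -[w s ^+ 2]real_normK ?num_real.
  move=> wk; rewrite -[K (u N) s ^+ 2]real_normK ?num_real// expr2 mulrA (mulrC t).
  by rewrite ler_wpM2r// ltW.
have E : JJ b (u N) = integ setT (fun s => w s * K (u N) s).
  by rewrite /JJ /K; case: (b).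
move: eu; apply/negP; rewrite -leNgt E.
apply: le_trans (le_normr_Rintegral measurableT iK) _.
apply: (@le_trans _ _ (integ setT (fun s => t * (rr (u N) s)^-1 + q N s))).
  by apply: le_Rintegral => //; [exact: itg_norm|exact: itgD].
rewrite RintegralD// RintegralZl//.
have : t * integ setT (fun s => (rr (u N) s)^-1) <= eps / 2.
  have -> : eps / 2 = t * I by rewrite /t; field; rewrite gt_eqF.
  by rewrite ler_wpM2l// ltW.
have := le_lt_trans (ler_norm _) HN.
by set v := integ setT (q N); lra.
Unshelve. all: by end_near. Qed.

Lemma ext_far b (eps : R) : 0 < eps -> exists N, forall x y,
  0 <= y -> N < `|x| \/ N < `|f x + e * y| -> `|ext b (x, y)| <= eps.
Proof.
move=> eps0; have e2 : 0 < eps / 2 by rewrite divr_gt0.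
have /cvgr0_norm_le/(_ _ e2)[n _ /(_ n (leqnn _)) Hn] := sqrt_inv_cvg.
have h0 : 0 < n.+1%:R^-1 :> R by rewrite invr_gt0.
have [N HN] := far_field b h0 e2.
exists (N + n.+1%:R^-1) => x y y0 far.
have A := le_trans (approx_ext b (x, y) n) (le_trans (ler_norm _) Hn).
have B : `|approx b n (x, y)| <= eps / 2.
  rewrite /approx /= max_l//.
  have t0 : 0 < y + n.+1%:R^-1 by rewrite ltr_wpDl.
  have [_ E] := phase_dist x t0.
  apply: HN; rewrite /= ?E ?lerDr//; case: far => far; [left|right].
    by apply: lt_trans far; rewrite ltrDl.
  have : `|f x + e * y| <= `|f x + e * (y + n.+1%:R^-1)| + n.+1%:R^-1.
    have -> : f x + e * y = f x + e * (y + n.+1%:R^-1) - e * n.+1%:R^-1 by ring.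
    by rewrite (le_trans (ler_normB _ _))// normrM e1 mul1r [`|n.+1%:R^-1|]gtr0_norm.
  by move: far; set h := n.+1%:R^-1; lra.
by move: A B; rewrite !ler_norml => /andP[? ?] /andP[? ?]; apply/andP; split; lra.
Qed.


(** Rescaling s = x + h t turns the difference of the kernels at (x, f x + h)
    and (x, f x - h) into h^-1 kap D t, where D is the difference quotient of f. *)
Definition kap (b : bool) (D t : R) :=
  if b then t / (t ^+ 2 + (D - 1) ^+ 2) - t / (t ^+ 2 + (D + 1) ^+ 2)
  else (D - 1) / (t ^+ 2 + (D - 1) ^+ 2) - (D + 1) / (t ^+ 2 + (D + 1) ^+ 2).

Lemma kap_den (D t : R) : `|D| <= L * `|t| ->
  [/\ 0 < t ^+ 2 + (D - 1) ^+ 2, 0 < t ^+ 2 + (D + 1) ^+ 2,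
      1 + t ^+ 2 <= C0 * (t ^+ 2 + (D - 1) ^+ 2) &
      1 + t ^+ 2 <= C0 * (t ^+ 2 + (D + 1) ^+ 2)].
Proof.
move=> Dt; have A := @sq_le_C0 t 1 D Dt; have B := @sq_le_C0 t (-1) D Dt.
rewrite opprK sqrrN in B; rewrite expr1n addrC in A; rewrite expr1n addrC in B.
have t1 : 0 < 1 + t ^+ 2 by rewrite ltr_wpDr ?sqr_ge0.
by split=> //; rewrite -(pmulr_rgt0 _ C0_gt0); [exact: lt_le_trans A|exact: lt_le_trans B].
Qed.

(** The majorant is uniform in the difference quotient D, hence in h. *)
Lemma kap_bound b (D t : R) : `|D| <= L * `|t| ->
  `|kap b D t| <= 2 * C0 * (1 + t ^+ 2)^-1.
Proof.
move=> /kap_den[]; set Qm := t ^+ 2 + (D - 1) ^+ 2; set Qp := t ^+ 2 + (D + 1) ^+ 2.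
move=> m0 p0 mC pC; have mn : Qm != 0 by rewrite gt_eqF.
have pn : Qp != 0 by rewrite gt_eqF.
have t1 : 0 < 1 + t ^+ 2 by rewrite ltr_wpDr ?sqr_ge0.
have E (v : R) : `|v| <= Qm + Qp -> `|v / (Qm * Qp)| <= 2 * C0 * (1 + t ^+ 2)^-1.
  move=> H; apply: (@le_trans _ _ (Qm^-1 + Qp^-1)).
    have QQ : 0 < (Qm * Qp)^-1 by rewrite invr_gt0 mulr_gt0.
    rewrite normrM [X in _ * X]gtr0_norm//.
    have -> : Qm^-1 + Qp^-1 = (Qm + Qp) / (Qm * Qp) by field; rewrite mn pn.
    by rewrite ler_wpM2r// ltW.
  have inv (q : R) : 0 < q -> 1 + t ^+ 2 <= C0 * q -> q^-1 <= C0 * (1 + t ^+ 2)^-1.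
    by move=> q0 qC; rewrite ler_pdivlMr// ler_pdivrMl// mulrC.
  by have := inv _ m0 mC; have := inv _ p0 pC; set u := (1 + _)^-1; lra.
have sq1 := sqr_ge0 (t - D); have sq2 := sqr_ge0 (t + D).
have sq3 := sqr_ge0 t; have sq4 := sqr_ge0 D.
case: b; rewrite /kap -/Qm -/Qp.
- have -> : t / Qm - t / Qp = (t * (Qp - Qm)) / (Qm * Qp) by field; rewrite mn pn.
  by apply: E; rewrite /Qm /Qp ler_norml; apply/andP; split; nra.
- have -> : (D - 1) / Qm - (D + 1) / Qp =
      ((D - 1) * Qp - (D + 1) * Qm) / (Qm * Qp) by field; rewrite mn pn.
  by apply: E; rewrite /Qm /Qp ler_norml; apply/andP; split; nra.
Qed.

Lemma kap_cont b (D t : R) : `|D| <= L * `|t| ->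
  {for D, continuous (fun D => kap b D t)}.
Proof.
move=> /kap_den[/gt_eqF/negbT n1 /gt_eqF/negbT n2 _ _].
by rewrite /kap; case: b; conti.
Qed.

Lemma kap_itg b (x : R) : itg setT (fun t => kap b (m x * t) t).
Proof.
have H t : `|m x * t| <= L * `|t| by rewrite normrM ler_wpM2r.
apply: (@itg_le R _ _ (fun t => 2 * C0 * (1 + t ^+ 2)^-1)) => //.
- apply: cont_meas => t; have [/gt_eqF/negbT n1 /gt_eqF/negbT n2 _ _] := kap_den (H t).
  have ct : {for t, continuous ( *%R (m x))} by exact: (cM (@cC _ _ (m x) t) (@cI R t)).
  by rewrite /kap; case: b; conti.
- by move=> t _; exact: kap_bound.
- by apply: itgZ => //; exact: lorentz1.
Qed.

(** In the rescaled integrals the graph becomes its tangent line at x. *)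
Lemma jump b (x : R) :
  JJ b (x, f x + n.+1%:R^-1) - JJ b (x, f x - n.+1%:R^-1) @[n --> \oo] -->
  w x * integ setT (fun t => kap b (m x * t) t).
Proof.
pose h n : R := n.+1%:R^-1; have h0 n : 0 < h n by rewrite invr_gt0.
have hn n : h n != 0 by rewrite gt_eqF.
pose D n t := (f (x + h n * t) - f x) / h n.
have DL n t : `|D n t| <= L * `|t|.
  rewrite /D normrM [`|(h n)^-1|]gtr0_norm ?invr_gt0// ler_pdivrMr//.
  apply: le_trans (lipschitz df mL _ _) _.
  by rewrite addrAC subrr add0r normrM (gtr0_norm (h0 n)) mulrCA mulrC.
pose K := if b then ker1 else ker2.
have aK : admissible K by rewrite /K; case: (b); [exact: adm_ker1|exact: adm_ker2].
have JK z : JJ b z = cint K z by rewrite /JJ /K; case: (b).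
have zp n : off_graph (x, f x + h n) by rewrite /off_graph /= -subr_eq0 addrAC subrr add0r.
have zm n : off_graph (x, f x - h n).
  by rewrite /off_graph /= -subr_eq0 addrAC subrr add0r oppr_eq0.
pose g n s := w s * K (x, f x + h n) s - w s * K (x, f x - h n) s.
have gi n : itg setT (g n) by apply: itgB => //; exact: cint_itg.
have cg n : continuous (g n).
  move=> s; have c1 := @adm_s _ aK _ s (zp n); have c2 := @adm_s _ aK _ s (zm n).
  by rewrite /g; conti; exact: cw.
pose u n t := w (x + h n * t) * kap b (D n t) t.
have gu n t : h n * g n (x + h n * t) = u n t.
  have [/gt_eqF/negbT q1n /gt_eqF/negbT q2n _ _] := kap_den (DL n t).
  have E1 : rr (x, f x + h n) (x + h n * t) = h n ^+ 2 * (t ^+ 2 + (D n t - 1) ^+ 2).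
    by rewrite /rr /D /=; field; exact: hn.
  have E2 : rr (x, f x - h n) (x + h n * t) = h n ^+ 2 * (t ^+ 2 + (D n t + 1) ^+ 2).
    by rewrite /rr /D /=; field; exact: hn.
  have F1 : f (x + h n * t) - (f x + h n) = h n * (D n t - 1).
    by rewrite /D; field; exact: hn.
  have F2 : f (x + h n * t) - (f x - h n) = h n * (D n t + 1).
    by rewrite /D; field; exact: hn.
  have hn' := hn n.
  rewrite /u /g /K /kap; case: (b); rewrite /ker1 /ker2 E1 E2 /= ?F1 ?F2.
    by field; rewrite hn' q1n q2n.
  by field; rewrite hn' q1n q2n.
have E n : JJ b (x, f x + h n) - JJ b (x, f x - h n) = integ setT (u n).
  rewrite !JK /cint -RintegralB//; try exact: cint_itg.
  have [i1 ->] := integ_scale x (h0 n) (cg n) (gi n).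
  by rewrite -RintegralZl//; apply: eq_Rintegral => t _; exact: gu.
have mu_ n : measurable_fun setT (u n).
  have [i1 _] := integ_scale x (h0 n) (cg n) (gi n).
  have := itg_meas (itgZ (h n) measurableT i1).
  by congr measurable_fun; apply/funext => t; exact: gu.
have hcvg : h n @[n --> \oo] --> 0 by exact: cvg_harmonic.
have ucvg t : setT t -> u n t @[n --> \oo] --> w x * kap b (m x * t) t.
  move=> _; apply: cvgM.
    have H : x + h n * t @[n --> \oo] --> x + 0 * t.
      by apply: cvgD; [exact: cvg_cst|apply: cvgMl].
    rewrite mul0r addr0 in H; exact: (cvg_comp _ _ H (@cw x)).
  have HD : D n t @[n --> \oo] --> m x * t.
    have dl : isd (fun s => x + s * t) 0 t.
      by deriv; cbv beta; ring.
    have dx0 : isd f (x + 0 * t) (m x) by rewrite mul0r addr0; exact: df.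
    have [d1 d2] := @dcomp R (fun s => x + s * t) f 0 _ _ dx0 dl.
    have C : s^-1 *: ((f (x + (s *: 1 + 0) * t)) - f (x + 0 * t)) @[s --> 0^'] --> m x * t.
      by rewrite -d2; exact: d1.
    have H : h n @[n --> \oo] --> 0^'.
      move=> A HA; have : \forall n \near \oo, (h n != 0 -> A (h n)) := hcvg _ HA.
      by apply: filterS => n /(_ (hn n)).
    have C2 := cvg_comp _ _ H C; apply: cvg_trans C2; apply: near_eq_cvg; near=> n => /=.
    by rewrite /D scaleRE [_ *: 1]scaleRE mulr1 addr0 mul0r addr0 mulrC.
  have H : `|m x * t| <= L * `|t| by rewrite normrM ler_wpM2r.
  exact: (cvg_comp _ _ HD (@kap_cont b _ t H)).
have [_ C] := @dct R setT u (fun t => w x * kap b (m x * t) t)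
  (fun t => W * (2 * C0) * (1 + t ^+ 2)^-1) measurableT mu_ ucvg
  (itgZ _ measurableT lorentz1) (fun n t _ => ltac:(by rewrite normrM -mulrA ler_pM// kap_bound)).
rewrite RintegralZl// in C; last exact: kap_itg.
by apply: cvg_trans C; apply: near_eq_cvg; near=> n; rewrite /= -E.
Unshelve. all: by end_near. Qed.


(** The integrand is the derivative of a sum of two arctangents. *)
Lemma kap_tangential (x : R) :
  m x * integ setT (fun t => kap true (m x * t) t)
  - integ setT (fun t => kap false (m x * t) t) = 2 * pi.
Proof.
set a := m x; have H t : `|a * t| <= L * `|t| by rewrite normrM ler_wpM2r// mL.
have i1 : itg setT (fun t => kap true (a * t) t) by exact: kap_itg.
have i2 : itg setT (fun t => kap false (a * t) t) by exact: kap_itg.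
have i3 := itgZ a measurableT i1.
rewrite -RintegralZl// -RintegralB//.
pose g t := a * kap true (a * t) t - kap false (a * t) t.
pose G t := atan ((1 + a ^+ 2) * t - a) + atan ((1 + a ^+ 2) * t + a).
have a1 : 1 <= 1 + a ^+ 2 by rewrite lerDl sqr_ge0.
have side (c : R) : atan ((1 + a ^+ 2) * t + c) @[t --> +oo] --> pi / 2.
  have U : (1 + a ^+ 2) * t + c @[t --> +oo] --> +oo.
    apply/cvgryPge => A; near=> t.
    have t0 : 0 <= t by near: t; apply: nbhs_pinfty_ge; rewrite num_real.
    have tA : A - c <= t by near: t; apply: nbhs_pinfty_ge; rewrite num_real.
    by have := ler_wpM2r t0 a1; rewrite mul1r; lra.
  exact: (cvg_comp _ _ U (@cvgy_atan R)).
have Gp : G t @[t --> +oo] --> pi / 2 + pi / 2 by apply: cvgD; exact: side.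
have Gm : G t @[t --> -oo] --> - (pi / 2 + pi / 2).
  apply/cvgNy_compNP; apply: cvg_trans (cvgN Gp); apply: near_eq_cvg; near=> t.
  change (- G t = G (- t)); rewrite /G opprD -!atanN addrC.
  by congr (_ + _); congr atan; ring.
have -> : 2 * pi = (pi / 2 + pi / 2) - - (pi / 2 + pi / 2) :> R by field.
apply: (@line_FTC R g G) => //.
- move=> t; have [/gt_eqF/negbT n1 /gt_eqF/negbT n2 _ _] := kap_den (H t).
  have ct : {for t, continuous ( *%R a)} by exact: (cM (@cC _ _ a t) (@cI R t)).
  by rewrite /g /kap; conti.
- move=> t; have [/gt_eqF/negbT n1 /gt_eqF/negbT n2 _ _] := kap_den (H t).
  have d1 : isd (fun t => (1 + a ^+ 2) * t - a) t (1 + a ^+ 2).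
    by deriv; cbv beta; ring.
  have d2 : isd (fun t => (1 + a ^+ 2) * t + a) t (1 + a ^+ 2).
    by deriv; cbv beta; ring.
  have an : 1 + a ^+ 2 != 0 by rewrite gt_eqF// (lt_le_trans ltr01).
  apply: (isd_eq (dD (d_atan d1) (d_atan d2))); rewrite /g /kap.
  have -> : 1 + ((1 + a ^+ 2) * t - a) ^+ 2 = (1 + a ^+ 2) * (t ^+ 2 + (a * t - 1) ^+ 2) by ring.
  have -> : 1 + ((1 + a ^+ 2) * t + a) ^+ 2 = (1 + a ^+ 2) * (t ^+ 2 + (a * t + 1) ^+ 2) by ring.
  by field; rewrite n1 n2 an.
- exact: itgB.
Unshelve. all: by end_near. Qed.

(** The primitive is half the logarithm of the quotient of the two denominators,
    which tends to 0 at both ends. *)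
Lemma kap_normal (x : R) :
  integ setT (fun t => kap true (m x * t) t)
  + m x * integ setT (fun t => kap false (m x * t) t) = 0.
Proof.
set a := m x; have H t : `|a * t| <= L * `|t| by rewrite normrM ler_wpM2r// mL.
have i1 : itg setT (fun t => kap true (a * t) t) by exact: kap_itg.
have i2 : itg setT (fun t => kap false (a * t) t) by exact: kap_itg.
have i3 := itgZ a measurableT i2.
rewrite -RintegralZl// -RintegralD//.
pose g t := kap true (a * t) t + a * kap false (a * t) t.
pose Qm t := t ^+ 2 + (a * t - 1) ^+ 2; pose Qp t := t ^+ 2 + (a * t + 1) ^+ 2.
have m0 t : 0 < Qm t by have [] := kap_den (H t).
have p0 t : 0 < Qp t by have [] := kap_den (H t).
pose G t := 2^-1 * (ln (Qm t) - ln (Qp t)).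
have Gp : G t @[t --> +oo] --> 0.
  have U : Qm t / Qp t @[t --> +oo] --> (1 : R).
    apply/cvgrPdist_le => eps eps0; near=> t.
    have t0 : 0 < t by near: t; apply: nbhs_pinfty_gt; rewrite num_real.
    have [_ _ _ pC] := kap_den (H t).
    have pn : Qp t != 0 by rewrite gt_eqF.
    have -> : 1 - Qm t / Qp t = 4 * (a * t) / Qp t.
      by move: pn; rewrite /Qm /Qp => pn; field.
    rewrite normrM [`|(Qp t)^-1|]gtr0_norm ?invr_gt0// ler_pdivrMr//.
    rewrite !normrM (gtr0_norm t0) ger0_norm//.
    have tA : 4 * `|a| * C0 / eps <= t.
      by near: t; apply: nbhs_pinfty_ge; rewrite num_real.
    rewrite ler_pdivrMr// in tA; rewrite -(ler_pM2l C0_gt0).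
    apply: (@le_trans _ _ (eps * (1 + t ^+ 2))); last first.
      by rewrite mulrCA ler_pM2l.
    apply: (@le_trans _ _ (eps * t ^+ 2)); last by rewrite ler_pM2l// lerDr.
    by have := ler_wpM2r (ltW t0) tA; rewrite expr2; set u := `|a|; lra.
  have C := cvg_comp _ _ U (continuous_ln (@ltr01 R)).
  rewrite -[X in _ --> X](mulr0 2^-1); apply: cvgMr.
  rewrite -(@ln1 R); apply: cvg_trans C; apply: near_eq_cvg; near=> t.
  by rewrite /= ln_div// posrE.
have Gm : G t @[t --> -oo] --> 0.
  rewrite -oppr0; apply/cvgNy_compNP; apply: cvg_trans (cvgN Gp); apply: near_eq_cvg; near=> t.
  change (- G t = G (- t)); rewrite /G -mulrN opprB.
  by congr (_ * (ln _ - ln _)); rewrite /Qm /Qp; ring.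
rewrite -(subrr (0 : R)); apply: (@line_FTC R g G) => //.
- move=> t; have [/gt_eqF/negbT n1 /gt_eqF/negbT n2 _ _] := kap_den (H t).
  have ct : {for t, continuous ( *%R a)} by exact: (cM (@cC _ _ a t) (@cI R t)).
  by rewrite /g /kap; conti.
- move=> t; have [/gt_eqF/negbT n1 /gt_eqF/negbT n2 _ _] := kap_den (H t).
  have d1 : isd Qm t (2 * t + 2 * (a * t - 1) * a).
    by rewrite /Qm; deriv; cbv beta; ring.
  have d2 : isd Qp t (2 * t + 2 * (a * t + 1) * a).
    by rewrite /Qp; deriv; cbv beta; ring.
  apply: (isd_eq (dM (dC t 2^-1) (dD (d_ln (m0 t) d1) (dN (d_ln (p0 t) d2))))).
  by rewrite /g /kap /Qm /Qp; field; rewrite n1 n2.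
- exact: itgD.
Unshelve. all: by end_near. Qed.


Lemma JJ_C1 b z : off_graph z ->
  [/\ C1_at (JJ b) z, dx (JJ b) z = (if b then M1 z else M2 z) &
      dy (JJ b) z = (if b then M2 z else - M1 z)].
Proof.
move=> zn; have c1 : {for z, continuous M1} := cint_cont adm_dker1 zn.
have c2 : {for z, continuous M2} := cint_cont adm_dker2 zn.
have N := off_graph_open zn.
have c1N : {for z, continuous (fun z => - M1 z)} by conti.
case: b.
- apply: (@C1_at_intro R J1 M1 M2) c1 c2.
  by apply: filterS N => -[x y] /dJ[d1 d2 _ _]; split; [exact: d1|exact: d2].
- apply: (@C1_at_intro R J2 M2 (fun z => - M1 z)) c2 c1N.
  by apply: filterS N => -[x y] /dJ[_ _ d1 d2]; split; [exact: d1|exact: d2].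
Qed.

(** The Cauchy integral v1 - i v2 = (2 pi i)^-1 int w / (zeta - z) ds over the
    points zeta = s + i f(s) of the graph, and the derivatives of v1. *)
Definition cauchy1 z := - (2 * pi)^-1 * ext false z.
Definition cauchy2 z := (2 * pi)^-1 * ext true z.
Definition cauchya z := - (2 * pi)^-1 * M2 (z.1, f z.1 + e * z.2).
Definition cauchyb z := (2 * pi)^-1 * M1 (z.1, f z.1 + e * z.2).

Lemma cauchy_flat_field : flat_field e m cauchy1 cauchy2 cauchya cauchyb.
Proof.
have cf := cont_fs; have ce := ext_cont.
have zn (x y : R) : 0 < y -> off_graph (x, f x + e * y) by case/(phase_dist x).
have cz (x y : R) (K : R * R -> R) : {for (x, f x + e * y), continuous K} ->
    {for (x, y), continuous (fun z => K (z.1, f z.1 + e * z.2))}.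
  move=> cK; have c1 := @cfst R (x, y); have c2 := @csnd R (x, y).
  have c3 : {for (x, y), continuous (fun z : R * R => f z.1)}.
    by apply: (@ccomp R _ _ f); [exact: cf|].
  by apply: (@ccompf2 R _ K (fun z => z.1) (fun z => f z.1 + e * z.2)) => //; conti.
have ext_eq b (x y : R) : 0 < y -> \forall t \near y, ext b (x, t) = JJ b (x, f x + e * t).
  by move=> y0; near=> t; apply: ext_inside; near: t; exact: lt_nbhsr.
have dy_ext b (x y : R) : 0 < y -> is_derive y 1 (fun t => ext b (x, t))
    (e * (if b then M2 else fun z => - M1 z) (x, f x + e * y)).
  move=> y0; have [C _ Ey] := JJ_C1 b (zn x y y0).
  have d1 := C1_dy C; rewrite Ey in d1.
  have d2 : isd (fun t : R => f x + e * t) y e by deriv; cbv beta; ring.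
  have d3 := @dcomp R (fun t => f x + e * t) (fun t => JJ b (x, t)) y _ _ d1 d2.
  have -> : e * (if b then M2 else fun z => - M1 z) (x, f x + e * y) =
      (if b then M2 (x, f x + e * y) else - M1 (x, f x + e * y)) * e.
    by case: (b); rewrite mulrC.
  apply: near_eq_is_derive d3; apply: filterS (ext_eq b x y y0) => t Et.
  exact: esym Et.
have dx_ext b (x y : R) : 0 < y -> is_derive x 1 (fun t => ext b (t, y))
    ((if b then M1 else M2) (x, f x + e * y) +
     m x * (if b then M2 else fun z => - M1 z) (x, f x + e * y)).
  move=> y0; have [_ Ex Ey] := JJ_C1 b (zn x y y0).
  have -> : (fun t => ext b (t, y)) = (fun t => JJ b (t, f t + e * y)).
    by apply/funext => t; exact: ext_inside.
  have d2 : isd (fun t : R => f t + e * y) x (m x).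
    have d1 : isd f x (m x) := df x.
    by deriv; cbv beta; ring.
  have N : \forall z \near (x, f x + e * y), C1_at (JJ b) z.
    by apply: filterS (off_graph_open (zn x y y0)) => z /(JJ_C1 b)[].
  have := chain2 (g := fun t => f t + e * y) N d2.
  by rewrite Ex Ey; case: (b).
split.
- by move=> z; have c := ce false z; rewrite /cauchy1; conti.
- by move=> z; have c := ce true z; rewrite /cauchy2; conti.
- move=> x y y0; have c := cz x y _ (cint_cont adm_dker2 (zn x y y0)).
  by rewrite /cauchya; conti.
- move=> x y y0; have c := cz x y _ (cint_cont adm_dker1 (zn x y y0)).
  by rewrite /cauchyb; conti.
- move=> x y y0; have d := dy_ext false x y y0.
  apply: (isd_eq (dM (dC _ _) d)); rewrite /cauchyb /=.
  by move: (M1 _) (ext _ _) => u v; rewrite mulr0 addr0; ring.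
- move=> x y y0; have d := dy_ext true x y y0.
  apply: (isd_eq (dM (dC _ _) d)); rewrite /cauchya /=.
  by move: (M2 _) (ext _ _) => u v; rewrite mulr0 addr0; ring.
- move=> x y y0; have d := dx_ext false x y y0.
  apply: (isd_eq (dM (dC _ _) d)); rewrite /cauchya /cauchyb /=.
  by move: (M1 _) (M2 _) (ext _ _) => u v t; rewrite mulr0 addr0; ring.
- move=> x y y0; have d := dx_ext true x y y0.
  apply: (isd_eq (dM (dC _ _) d)); rewrite /cauchya /cauchyb /=.
  by move: (M1 _) (M2 _) (ext _ _) => u v t; rewrite mulr0 addr0; ring.
Unshelve. all: by end_near. Qed.

Lemma cauchy_vanish : flat_vanish e f cauchy1 cauchy2.
Proof.
move=> eps eps0; have e0 : 0 < eps * (2 * pi) :> R.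
  by rewrite mulr_gt0// mulr_gt0// pi_gt0.
have [N1 H1] := ext_far false e0; have [N2 H2] := ext_far true e0.
have S b x y : `|ext b (x, y)| <= eps * (2 * pi) ->
    (2 * pi)^-1 * `|ext b (x, y)| <= eps.
  by move=> H; rewrite ler_pdivrMl 1?mulrC// mulr_gt0// pi_gt0.
have pp : `|(2 * pi : R)^-1| = (2 * pi)^-1.
  by rewrite gtr0_norm// invr_gt0 mulr_gt0// pi_gt0.
exists (Num.max N1 N2) => x y y0 far; rewrite /cauchy1 /cauchy2 !normrM normrN pp.
by split; apply: S; [apply: H1|apply: H2] => //; case: far => far; [left|right|left|right];
   apply: le_lt_trans far; rewrite le_max lexx ?orbT.
Qed.

End CauchyIntegral.

(** * Fields in two phases with a prescribed jump *)
Section TwoPhase.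
Context {R : realType}.
Local Notation mu := (@lebesgue_measure R).

(** The phase above the interface is [true], the phase below is [false]. *)
Definition side (i : bool) : R := if i then 1 else -1.

Lemma normr_side i : `|side i| = 1.
Proof. by case: i; rewrite /side ?normrN normr1. Qed.

(** A velocity field that is divergence and curl free in both phases, vanishes at
    infinity, and whose tangential component jumps by [w] across the graph, the
    normal component being continuous; both components are unnormalized. *)
Record two_phase (f m w : R -> R) (G1 G2 a b : bool -> R * R -> R) : Prop := TwoPhase {
  tp_field : forall i, flat_field (side i) m (G1 i) (G2 i) (a i) (b i);
  tp_vanish : forall i, flat_vanish (side i) f (G1 i) (G2 i);
  tp_tangential : forall x,
    (G1 true (x, 0) + m x * G2 true (x, 0))
    - (G1 false (x, 0) + m x * G2 false (x, 0)) = w x;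
  tp_normal : forall x, G2 true (x, 0) - m x * G1 true (x, 0)
                      = G2 false (x, 0) - m x * G1 false (x, 0) }.

Lemma itg_sq_comb (g u v : R -> R) (A B : R) : continuous g ->
  (forall s, `|g s| <= A * `|u s| + B * `|v s|) ->
  itg setT (fun s => u s ^+ 2) -> itg setT (fun s => v s ^+ 2) ->
  itg setT (fun s => g s ^+ 2).
Proof.
move=> cg gle iu iv.
apply: (@itg_le R _ _ (fun s => 2 * A ^+ 2 * u s ^+ 2 + 2 * B ^+ 2 * v s ^+ 2)) => //.
- by apply: cont_meas => s; have c := cg s; conti.
- move=> s _; have H := gle s; have g0 := normr_ge0 (g s).
  rewrite ger0_norm ?sqr_ge0//.
  rewrite -[g s ^+ 2]real_normK ?num_real// -[u s ^+ 2]real_normK ?num_real//.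
  rewrite -[v s ^+ 2]real_normK ?num_real//.
  have S := sqr_ge0 (A * `|u s| - B * `|v s|).
  move: H g0 S; move: `|g s| `|u s| `|v s| => p q r H g0 S.
  have H2 : p ^+ 2 <= (A * q + B * r) ^+ 2.
    by rewrite ler_sqr ?nnegrE ?(le_trans g0 H).
  by lra.
- by apply: itgD => //; apply: itgZ.
Qed.

(** The density is w ds = phi d zeta with phi = w / (1 + i m); the derivative of phi
    is square integrable, as the half-order estimate requires. *)
Theorem cauchy_two_phase (L K W : R) (f m m1 w w1 : R -> R) :
  (forall x : R, is_derive x 1 f (m x)) -> (forall x : R, is_derive x 1 m (m1 x)) ->
  continuous m1 -> (forall x, `|m x| <= L) -> (forall x, `|m1 x| <= K) ->
  (forall x : R, is_derive x 1 w (w1 x)) -> continuous w1 ->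
  (forall x, `|w x| <= W) -> itg setT (fun s => w s ^+ 2) ->
  itg setT (fun s => w1 s ^+ 2) ->
  exists G1 G2 a b, two_phase f m w G1 G2 a b.
Proof.
move=> df dm cm1 mL mK dw cw1 wW iw iw1.
have cm : continuous m by move=> x; exact: is_derive_cont (dm x).
have cw : continuous w by move=> x; exact: is_derive_cont (dw x).
have L0 : 0 <= L := le_trans (normr_ge0 _) (mL 0).
have K0 : 0 <= K := le_trans (normr_ge0 _) (mK 0).
have W0 : 0 <= W := le_trans (normr_ge0 _) (wW 0).
have r0 x : 0 < 1 + m x ^+ 2 by rewrite ltr_wpDr ?sqr_ge0.
have rn x : 1 + m x ^+ 2 != 0 by rewrite gt_eqF.
have r1 x : (1 + m x ^+ 2)^-1 <= 1 by rewrite invf_le1// lerDl sqr_ge0.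
pose ph1 x := w x / (1 + m x ^+ 2); pose ph2 x := - (m x * ph1 x).
pose q1 x := w1 x * (1 + m x ^+ 2)^-1 - 2 * m1 x * w x * (m x / (1 + m x ^+ 2) ^+ 2).
pose q2 x := - (m1 x * ph1 x + m x * q1 x).
have dph1 (x : R) : is_derive x 1 ph1 (q1 x).
  have d1 : isd m x (m1 x) := dm x; have d2 : isd w x (w1 x) := dw x.
  by rewrite /ph1; deriv; rewrite ?rn// /q1; cbv beta; field.
have dph2 (x : R) : is_derive x 1 ph2 (q2 x).
  have d1 : isd m x (m1 x) := dm x; have d2 : isd ph1 x (q1 x) := dph1 x.
  by rewrite /ph2; deriv; rewrite /q2; cbv beta; ring.
have cph1 : continuous ph1 by move=> x; exact: is_derive_cont (dph1 x).
have cq1 : continuous q1.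
  move=> x; have n0 := rn x; have c1 := cm x; have c2 := cm1 x; have c3 := cw x.
  have c4 := cw1 x; have n1 := expf_neq0 2 (rn x).
  by rewrite /q1; conti.
have cq2 : continuous q2.
  move=> x; have c1 := cm x; have c2 := cm1 x; have c3 := cph1 x; have c4 := cq1 x.
  by rewrite /q2; conti.
have mr x : `|m x / (1 + m x ^+ 2)| <= 1.
  rewrite normrM [`|(1 + _)^-1|]gtr0_norm ?invr_gt0// ler_pdivrMr// mul1r.
  have := sqr_ge0 (`|m x| - 1); rewrite sqrrB1 real_normK ?num_real//.
  by have := normr_ge0 (m x); lra.
have ph1w x : `|ph1 x| <= `|w x|.
  by rewrite /ph1 normrM ler_piMr// gtr0_norm// invr_gt0.
have ph2w x : `|ph2 x| <= `|w x|.
  rewrite /ph2 normrN /ph1 mulrCA normrM ler_piMr//.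
have q1le x : `|q1 x| <= 1 * `|w1 x| + 2 * K * `|w x|.
  rewrite /q1 (le_trans (ler_normB _ _))// lerD//.
    by rewrite mul1r normrM ler_piMr// gtr0_norm// invr_gt0.
  have -> : `|2 * m1 x * w x * (m x / (1 + m x ^+ 2) ^+ 2)| =
      2 * `|m1 x| * `|w x| * `|m x / (1 + m x ^+ 2) ^+ 2|.
    by rewrite !normrM (gtr0_norm (@ltr0Sn R 1)).
  apply: (@le_trans _ _ (2 * K * `|w x| * 1)); last by rewrite mulr1.
  have M : 0 <= 2 * `|m1 x| * `|w x| by rewrite !mulr_ge0.
  apply: ler_pM => //; first by rewrite ler_wpM2r// ler_pM2l.
  by rewrite expr2 invfM mulrA normrM mulr_ile1// gtr0_norm// invr_gt0.
have q2le x : `|q2 x| <= L * `|w1 x| + (K + L * (2 * K)) * `|w x|.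
  rewrite /q2 normrN (le_trans (ler_normD _ _))// (normrM (m1 x)) (normrM (m x)).
  have A : `|m1 x| * `|ph1 x| <= K * `|w x| by rewrite ler_pM.
  have B : `|m x| * `|q1 x| <= L * (1 * `|w1 x| + 2 * K * `|w x|) by rewrite ler_pM.
  apply: (le_trans (lerD A B)); rewrite le_eqVlt; apply/orP; left; apply/eqP; ring.
have iq1 := itg_sq_comb cq1 q1le iw1 iw.
have iq2 := itg_sq_comb cq2 q2le iw1 iw.
have ph1W x : `|ph1 x| <= W := le_trans (ph1w x) (wW x).
have ph2W x : `|ph2 x| <= W := le_trans (ph2w x) (wW x).
have E1 x : ph1 x - m x * ph2 x = w x by rewrite /ph2 /ph1; field.
have E2 x : ph2 x + m x * ph1 x = 0 by rewrite /ph2 addNr.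
have AC i b z : approx f w (side i) b n z @[n --> \oo] --> ext f w (side i) b z.
  exact: (approx_cvg df mL cw wW iw dph1 dph2 cq1 cq2 ph1W ph2W E1 E2 iq1 iq2 (normr_side i)).
have J b x : ext f w 1 b (x, 0) - ext f w (-1) b (x, 0) =
    w x * integ setT (fun t => kap b (m x * t) t).
  have C1 := AC true b (x, 0); have C2 := AC false b (x, 0).
  have C := @jump R L W f m w df mL cw wW iw b x.
  have D : approx f w 1 b n (x, 0) - approx f w (-1) b n (x, 0) @[n --> \oo] -->
      ext f w 1 b (x, 0) - ext f w (-1) b (x, 0) by apply: cvgB; [exact: C1|exact: C2].
  rewrite -(cvg_lim _ D)//; apply/cvg_lim => //.
  apply: cvg_trans C; apply: near_eq_cvg; near=> n.
  rewrite /approx /= maxxx add0r mul1r mulN1r.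
  by [].
have pi0 : (pi : R) != 0 by rewrite gt_eqF// pi_gt0.
exists (fun i => cauchy1 f w (side i)), (fun i => cauchy2 f w (side i)),
  (fun i => cauchya f w (side i)), (fun i => cauchyb f w (side i)); split.
- move=> i.
  exact: (cauchy_flat_field df mL cw wW iw dph1 dph2 cq1 cq2 ph1W ph2W E1 E2 iq1 iq2 (normr_side i)).
- move=> i.
  exact: (cauchy_vanish df mL cw wW iw dph1 dph2 cq1 cq2 ph1W ph2W E1 E2 iq1 iq2 (normr_side i)).
- move=> x; have K1 := kap_tangential mL x; have J1 := J true x; have J2 := J false x.
  rewrite /cauchy1 /cauchy2 /side /=.
  have inv (p c : R) : p != 0 -> c = (2 * p)^-1 * (c * (2 * p)).
    by move=> pn; field.
  rewrite [RHS](inv pi)// -[X in _ = _ * (_ * X)]K1.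
  have -> : forall c u v : R, c * (w x * (m x * u - v)) = c * (m x * (w x * u) - w x * v).
    by move=> c u v; ring.
  rewrite -J1 -J2. move: (2 * pi)^-1 (ext f w 1 true (x, 0)) (ext f w 1 false (x, 0))
    (ext f w (-1) true (x, 0)) (ext f w (-1) false (x, 0)) => c u1 u2 v1 v2; ring.
- move=> x; have K1 := kap_normal mL x; have J1 := J true x; have J2 := J false x.
  rewrite /cauchy1 /cauchy2 /side /=; apply/eqP; rewrite -subr_eq0; apply/eqP.
  rewrite -[RHS](mulr0 ((2 * pi)^-1 * w x)) -[X in _ = _ * X]K1.
  have -> : forall c u v : R, c * w x * (u + m x * v) = c * (w x * u + m x * (w x * v)).
    by move=> c u v; ring.
  rewrite -J1 -J2; move: (2 * pi)^-1 (ext f w 1 true (x, 0)) (ext f w 1 false (x, 0))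
    (ext f w (-1) true (x, 0)) (ext f w (-1) false (x, 0)) => c u1 u2 v1 v2; ring.
Unshelve. all: by end_near. Qed.
End TwoPhase.

(** * From planar to flat coordinates and back *)
Section Planar.
Context {R : realType}.
Context (e : R) (e1 : `|e| = 1) (f m : R -> R).
Context (df : forall x : R, is_derive x 1 f (m x)) (cm : continuous m).
Implicit Types (z w : R * R) (p : R * R -> R) (v : R * R -> R * R).

Lemma planar_ee : e * e = 1.
Proof. by rewrite -expr2 -[e ^+ 2]real_normK ?num_real// e1 expr1n. Qed.

Definition height z := e * (z.2 - f z.1).
Definition phase : set (R * R) := [set z | 0 < height z].

Lemma height_eq (x y : R) : height (x, f x + e * y) = y.
Proof. by rewrite /height /= addrAC subrr add0r mulrA planar_ee mul1r. Qed.

Lemma height_inv z : f z.1 + e * height z = z.2.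
Proof. by rewrite /height mulrA planar_ee mul1r addrC subrK. Qed.

Lemma cont_profile z : {for z, continuous (fun w => f w.1)}.
Proof.
by apply: (@ccomp R _ _ f); [exact: (is_derive_cont (df _))|exact: (@cfst R z)].
Qed.

Lemma height_cont z : {for z, continuous height}.
Proof.
by have c1 := @csnd R z; have c2 := @cont_profile z; rewrite /height; conti.
Qed.

Lemma phase_near z : phase z -> \forall w \near z, phase w.
Proof.
move=> zP; have H : height w @[w --> z] --> height z := @height_cont z.
have K : \forall w \near z, 0 < height w by apply: (cvgr_gt (height z) H).
exact: K.
Qed.

Lemma near_snd (x y : R) : 0 < y -> \forall w \near (x, y), 0 < w.2.
Proof.
move=> y0; apply: (pair_nearP y0) => x' y' _ yy.
by move: yy; rewrite ltr_norml => /andP[a _]; rewrite /=; lra.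
Qed.

Lemma closure_phase : closure phase = [set z | 0 <= height z].
Proof.
apply/seteqP; split => z /= zP.
  rewrite leNgt; apply/negP => h0.
  have N : \forall w \near z, height w < 0.
    have H : height w @[w --> z] --> height z := @height_cont z.
    by apply: (cvgr_lt (height z) H).
  by have [w [/= a b]] := zP _ N; have := lt_trans a b; rewrite ltxx.
move=> B; rewrite (surjective_pairing z) => /near_pairP[d d0 H].
exists (z.1, z.2 + e * d); split.
  rewrite /phase /= /height /= -addrAC mulrDr mulrA planar_ee mul1r.
  by move: zP; rewrite /height; lra.
apply: H; first by rewrite subrr normr0 ltW.
by rewrite addrAC subrr add0r normrM e1 mul1r gtr0_norm.
Qed.

(** Values of [g] in the coordinates (x, e (y - f x)), frozen outside the phase. *)
Definition flatten (T : Type) (g : R * R -> T) z := g (z.1, f z.1 + e * Num.max z.2 0).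

Lemma flatten_cont (T : topologicalType) (g : R * R -> T) :
  {within closure phase, continuous g} -> continuous (flatten g).
Proof.
move=> /subspace_continuousP cg z.
pose u w : R * R := (w.1, f w.1 + e * Num.max w.2 0).
have uP w : closure phase (u w).
  by rewrite closure_phase /= height_eq le_max lexx orbT.
have c1 : {for z, continuous (fun w => f w.1 + e * Num.max w.2 0)}.
  by have c2 := @cont_profile z; have c3 := @max_cont R z; conti.
have cu : u w @[w --> z] --> u z.
  exact: (@cvg_pair _ _ _ (nbhs z) (nbhs _) (nbhs _) _ _ _ (fun w => w.1) _ (@cfst R z) c1).
move=> A HA.
have H : \forall w \near z, closure phase (u w) -> A (g (u w)) := cu _ (cg _ (uP z) _ HA).
by apply: filterS H => w; apply; exact: uP.
Qed.

Lemma flatten_inside (T : Type) (g : R * R -> T) (x y : R) : 0 <= y ->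
  flatten g (x, y) = g (x, f x + e * y).
Proof. by move=> y0; rewrite /flatten /= max_l. Qed.

Lemma phase_coord (x y : R) : 0 < y -> phase (x, f x + e * y).
Proof. by move=> y0; rewrite /phase /= height_eq. Qed.

Lemma flat_coord_cont p (x y : R) : {for (x, f x + e * y), continuous p} ->
  {for (x, y), continuous (fun w => p (w.1, f w.1 + e * w.2))}.
Proof.
move=> cp; have c1 := @cfst R (x, y); have c2 := @csnd R (x, y).
have c3 := @cont_profile (x, y).
by apply: (@ccompf2 R _ p (fun w => w.1) (fun w => f w.1 + e * w.2)) => //; conti.
Qed.

Lemma flatten_dy p (x y : R) : C1_in phase p -> 0 < y ->
  is_derive y 1 (fun t => flatten p (x, t)) (e * dy p (x, f x + e * y)).
Proof.
move=> pC y0; have d1 := C1_dy (pC _ (phase_coord x y0)).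
have d2 : isd (fun t : R => f x + e * t) y e by deriv; cbv beta; ring.
have d3 := @dcomp R (fun t => f x + e * t) (fun t => p (x, t)) y _ _ d1 d2.
rewrite mulrC; apply: near_eq_is_derive d3; near=> t; rewrite /flatten /= max_l//.
by apply: ltW; near: t; exact: lt_nbhsr.
Unshelve. all: by end_near. Qed.

Lemma flatten_dx p (x y : R) : C1_in phase p -> 0 < y ->
  is_derive x 1 (fun t => flatten p (t, y))
    (dx p (x, f x + e * y) + m x * dy p (x, f x + e * y)).
Proof.
move=> pC y0; have -> : (fun t => flatten p (t, y)) = (fun t => p (t, f t + e * y)).
  by apply/funext => t; rewrite flatten_inside// ltW.
have d2 : isd (fun t : R => f t + e * y) x (m x).
  by have d1 : isd f x (m x) := df x; deriv; cbv beta; ring.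
apply: (chain2 (g := fun t => f t + e * y) _ d2).
by apply: filterS (phase_near (phase_coord x y0)) => z; exact: pC.
Qed.

Lemma enorm_ge (a : R * R) : `|a.1| <= enorm a /\ `|a.2| <= enorm a.
Proof.
by rewrite /enorm /dot -!expr2 -!sqrtr_sqr !ler_wsqrtr ?lerDl ?lerDr ?sqr_ge0.
Qed.

Lemma enorm_le (a : R * R) : enorm a <= `|a.1| + `|a.2|.
Proof.
rewrite /enorm /dot -!expr2 -[X in _ <= X]ger0_norm ?addr_ge0// -sqrtr_sqr.
rewrite ler_wsqrtr// sqrrD !real_normK ?num_real//.
by have : 0 <= `|a.1| * `|a.2| by []; lra.
Qed.

(** Divergence and curl zero leave only the two derivatives of the first component
    in the chain rules of all four partial derivatives. *)
Lemma flat_of_velocity v : {within closure phase, continuous v} ->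
  C1_in phase (fun z => (v z).1) -> C1_in phase (fun z => (v z).2) ->
  (forall z, phase z -> divergence v z = 0) ->
  (forall z, phase z -> dx (fun z => (v z).2) z = dy (fun z => (v z).1) z) ->
  flat_field e m (fun z => (flatten v z).1) (fun z => (flatten v z).2)
    (fun z => dx (fun z => (v z).1) (z.1, f z.1 + e * z.2))
    (fun z => dy (fun z => (v z).1) (z.1, f z.1 + e * z.2)).
Proof.
move=> /flatten_cont cv C1 C2 div0 curl0; split.
- by move=> z; apply: (continuous_comp (cv z)); exact: cvg_fst.
- by move=> z; apply: (continuous_comp (cv z)); exact: cvg_snd.
- move=> x y y0; apply: flat_coord_cont.
  by have [_ _ c _] := C1 _ (phase_coord x y0); exact: c.
- move=> x y y0; apply: flat_coord_cont.
  by have [_ _ _ c] := C1 _ (phase_coord x y0); exact: c.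
- by move=> x y y0; exact: (flatten_dy x C1 y0).
- move=> x y y0; have D := flatten_dy x C2 y0.
  apply: (isd_eq D); have := div0 _ (phase_coord x y0); rewrite /divergence /=.
  by move: (dx _ _) (dy _ _) => u t ut; rewrite -mulrN; congr (_ * _); lra.
- by move=> x y y0; exact: (flatten_dx x C1 y0).
- move=> x y y0; have D := flatten_dx x C2 y0.
  apply: (isd_eq D); have := div0 _ (phase_coord x y0); have := curl0 _ (phase_coord x y0).
  rewrite /divergence /=; move: (dx _ _) (dy _ _) (dx _ _) (dy _ _) => u1 u2 u3 u4 -> E.
  have -> : u2 = - u1 by lra.
  by rewrite mulrN.
Qed.

Lemma vanish_of_velocity v : vanishes_at_infinity phase v ->
  flat_vanish e f (fun z => (flatten v z).1) (fun z => (flatten v z).2).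
Proof.
move=> V eps eps0; have [M HM] := V _ eps0; exists M => x y y0 far.
have cz : closure phase (x, f x + e * y) by rewrite closure_phase /= height_eq.
have [g1 g2] := enorm_ge (x, f x + e * y).
have Mz : M < enorm (x, f x + e * y) by case: far => far; exact: lt_le_trans far _.
have lt := HM _ cz Mz; rewrite !flatten_inside//.
by have [h1 h2] := enorm_ge (v (x, f x + e * y)); split; apply: ltW; exact: le_lt_trans lt.
Qed.

Definition unflatten (g : R * R -> R) z := g (z.1, height z).

Lemma unflatten_cont_at g z : {for (z.1, height z), continuous g} ->
  {for z, continuous (unflatten g)}.
Proof.
by move=> cg; exact: (@ccompf2 R _ g (fun w => w.1) height z cg (@cfst R z) (@height_cont z)).
Qed.

Lemma unflatten_C1 (g A B : R * R -> R) z : phase z ->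
  (forall x y : R, 0 < y -> {for (x, y), continuous A}) ->
  (forall x y : R, 0 < y -> {for (x, y), continuous B}) ->
  (forall x y : R, 0 < y -> is_derive x 1 (fun t => g (t, y)) (A (x, y) + m x * B (x, y))) ->
  (forall x y : R, 0 < y -> is_derive y 1 (fun t => g (x, t)) (e * B (x, y))) ->
  [/\ C1_at (unflatten g) z, dx (unflatten g) z = unflatten A z &
      dy (unflatten g) z = unflatten B z].
Proof.
move=> zP cA cB gx gy.
have pos w : phase w -> 0 < height w by [].
have gC (x y : R) : 0 < y -> [/\ C1_at g (x, y), dx g (x, y) = A (x, y) + m x * B (x, y) &
    dy g (x, y) = e * B (x, y)].
  move=> y0; apply: (@C1_at_intro R g (fun z => A z + m z.1 * B z) (fun z => e * B z)).
  - have N : \forall w \near (x, y), 0 < w.2.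
      exact: near_snd.
    by apply: filterS N => -[x' y'] /= y'0; split; [exact: gx|exact: gy].
  - have c1 := cA x y y0; have c2 := cB x y y0.
    have c3 : {for (x, y), continuous (fun w => m w.1)}.
      by apply: (@ccomp R _ _ m); [exact: cm|exact: (@cfst R (x, y))].
    by conti.
  - by have c2 := cB x y y0; conti.
apply: (@C1_at_intro R _ (unflatten A) (unflatten B)).
- apply: filterS (phase_near zP) => -[x y] /= wP.
  have y0 := pos _ wP; have [_ Ex Ey] := gC x (height (x, y)) y0.
  split.
    have d2 : isd (fun t : R => e * (y - f t)) x (- (e * m x)).
      by have d1 : isd f x (m x) := df x; deriv; cbv beta; ring.
    have N : \forall w \near (x, e * (y - f x)), C1_at g w.
      have N0 : \forall w \near (x, e * (y - f x)), 0 < w.2.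
        exact: near_snd.
      by apply: filterS N0 => -[x' y'] /= y'0; have [] := gC x' y' y'0.
    apply: (is_derive_eq (chain2 (g := fun t => e * (y - f t)) N d2)).
    rewrite Ex Ey /unflatten /=; move: (A _) (B _) => a b.
    have -> : - (e * m x) * (e * b) = - (e * e) * (m x * b) by ring.
    by rewrite planar_ee; ring.
  have d2 : isd (fun t : R => e * (t - f x)) y e by deriv; cbv beta; ring.
  have d3 := @dcomp R (fun t => e * (t - f x)) (fun t => g (x, t)) y _ _ (gy x _ y0) d2.
  apply: (isd_eq d3); rewrite /unflatten /=; move: (B _) => b.
  by rewrite mulrAC planar_ee mul1r.
- exact: unflatten_cont_at (cA _ _ (pos _ zP)).
- exact: unflatten_cont_at (cB _ _ (pos _ zP)).
Qed.

End Planar.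

(** * Traces and potentials *)
Section Pressure.
Context {R : realType}.
Context (e : R) (e1 : `|e| = 1) (f m : R -> R).
Context (df : forall x : R, is_derive x 1 f (m x)) (cm : continuous m).
Implicit Types (z w : R * R) (p g A B : R * R -> R) (x y : R).

(** The derivative of a trace: [x]-derivatives along the curves at height [y > 0]
    are given by the chain rule, and persist in the limit [y -> 0]. *)
Lemma trace_derive (P D : R * R -> R) (x : R) : continuous P -> continuous D ->
  (forall t y : R, 0 < y -> is_derive t 1 (fun s => P (s, y)) (D (t, y))) ->
  is_derive x 1 (fun s => P (s, 0)) (D (x, 0)).
Proof.
move=> cP cD dP; apply: is_derive_eps => eps eps0.
have /cvgrPdist_le/(_ _ eps0)/near_pairP[d d0 H] : {for (x, 0), continuous D} := @cD (x, 0).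
near=> y; have yd : `|y - x| <= d.
  near: y; have C : {for x, continuous (fun y : R => y - x)} by conti.
  have /cvgr_norm_le := C; rewrite subrr normr0; exact.
have Q (t : R) : 0 < t -> t <= d ->
    `|P (y, t) - P (x, t) - D (x, 0) * (y - x)| <= eps * `|y - x|.
  move=> t0 td; have [c cx ->] := @mvt R (fun s => P (s, t)) (fun s => D (s, t)) x y
    (fun s _ => dP s t t0).
  rewrite -mulrBl normrM ler_wpM2r// distrC; apply: H; first exact: le_trans cx yd.
  by rewrite subr0 gtr0_norm.
have C : {for 0, continuous (fun t => `|P (y, t) - P (x, t) - D (x, 0) * (y - x)|)}.
  have c1 := @cont_slice2 R P y 0 (@cP (y, 0)); have c2 := @cont_slice2 R P x 0 (@cP (x, 0)).
  apply: (@ccomp R R _ Num.norm); first exact: norm_continuous.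
  by conti.
have C' : `|P (y, t) - P (x, t) - D (x, 0) * (y - x)| @[t --> 0^'+] -->
    `|P (y, 0) - P (x, 0) - D (x, 0) * (y - x)| by apply: cvg_at_right_filter; exact: C.
apply: (@cvgr_to_le _ _ _ _ _ _ _ C'); near=> t; apply: Q.
  by near: t; exact: nbhs_right_gt.
by near: t; exact: nbhs_right_le.
Unshelve. all: by end_near. Qed.

(** The potential whose derivatives are [g1 + m g2] in x and [e g2] in y.  The path
    runs at height 1, inside the phase, where the field is differentiable. *)
Definition potential (g1 g2 : R * R -> R) z :=
  prim (fun s => g1 (s, 1) + m s * g2 (s, 1)) z.1 +
  e * (prim (fun t => g2 (z.1, t)) z.2 - prim (fun t => g2 (z.1, t)) 1).

Lemma prim_diff (h : R -> R) (a b : R) : continuous h -> a <= b ->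
  prim h b - prim h a = integ `[a, b] h.
Proof.
move=> ch ab; pose c := Num.min a 0.
have c0 : c <= 0 by rewrite ge_min lexx orbT.
have ca : c <= a by rewrite ge_min lexx.
rewrite (prim_shift ch c0 ca) (prim_shift ch c0 (le_trans ca ab)).
have -> : integ `[c, b] h = integ `[c, a] h + integ `[a, b] h.
  by apply: integ_chasles => [|x _]; [rewrite ca|exact: ch].
by ring.
Qed.

Lemma potential_dy (g1 g2 : R * R -> R) x y : continuous g2 ->
  is_derive y 1 (fun t => potential g1 g2 (x, t)) (e * g2 (x, y)).
Proof.
move=> c2; have c : continuous (fun t => g2 (x, t)).
  by move=> t; exact: (@cont_slice2 R g2 x t (@c2 (x, t))).
have d := is_derive_prim y c; rewrite /potential /=.
apply: (isd_eq (dD (dC y _) (dM (dC y e) (dD d (dC y _))))).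
by rewrite mulr0 addr0 addr0 add0r.
Qed.

(** By Green's theorem the horizontal part of the path can be moved from height 1 to
    height y, where the fundamental theorem of calculus applies. *)
Lemma potential_dx (g1 g2 a b : R * R -> R) x y : flat_field e m g1 g2 a b -> 0 < y ->
  is_derive x 1 (fun t => potential g1 g2 (t, y)) (g1 (x, y) + m x * g2 (x, y)).
Proof.
case=> c1 c2 ca cb y1 y2 x1 x2 y0.
have ee := planar_ee e1.
have cA (s t : R) : {for (s, t), continuous (fun z => g1 z + m z.1 * g2 z)}.
  have q1 := @c1 (s, t); have q2 := @c2 (s, t).
  have q3 : {for (s, t), continuous (fun w : R * R => m w.1)}.
    by apply: (@ccomp R _ _ m); [exact: cm|exact: (@cfst R (s, t))].
  by conti.
have cAs (t : R) : continuous (fun s => g1 (s, t) + m s * g2 (s, t)).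
  by move=> s; exact: (@cont_slice1 R (fun z => g1 z + m z.1 * g2 z) s t (cA s t)).
have cB (s : R) : continuous (fun t => g2 (s, t)).
  by move=> t; exact: (@cont_slice2 R g2 s t (@c2 (s, t))).
pose E z := e * (b z - m z.1 * a z).
have rect (u v c d : R) : u <= v -> 0 < c -> c <= d ->
    integ `[u, v] (fun s => g1 (s, d) + m s * g2 (s, d)) -
    integ `[u, v] (fun s => g1 (s, c) + m s * g2 (s, c)) =
    integ `[c, d] (fun t => e * g2 (v, t) - e * g2 (u, t)).
  move=> uv c0 cd.
  have := @closed_form_rectangle R (fun z => g1 z + m z.1 * g2 z) (fun z => e * g2 z) E
    u v c d c uv cd c0; apply.
  - by move=> s t _ _; exact: cA.
  - by move=> s t _ _; have q2 := @c2 (s, t); conti.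
  - move=> s t _ /andP[ct _]; have t0 := lt_trans c0 ct; split.
    + have q1 := ca s t t0; have q2 := cb s t t0.
      have q3 : {for (s, t), continuous (fun w : R * R => m w.1)}.
        by apply: (@ccomp R _ _ m); [exact: cm|exact: (@cfst R (s, t))].
      by rewrite /E; conti.
    + have d1 := y1 s t t0; have d2 := y2 s t t0.
      apply: (isd_eq (dD d1 (dM (dC t (m s)) d2))); rewrite /E /=.
      by rewrite mulr0 addr0; ring.
    + have d2 := x2 s t t0.
      by apply: (isd_eq (dM (dC s e) d2)); rewrite /E /= mulr0 addr0.
have key (u v : R) : u <= v -> potential g1 g2 (v, y) - potential g1 g2 (u, y) =
    prim (fun s => g1 (s, y) + m s * g2 (s, y)) v - prim (fun s => g1 (s, y) + m s * g2 (s, y)) u.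
  move=> uv; rewrite /potential /= (prim_diff (cAs y) uv).
  set p := prim _ v; set q := prim _ u.
  have -> : p = q + integ `[u, v] (fun s => g1 (s, 1) + m s * g2 (s, 1)).
    by rewrite -(prim_diff (cAs 1) uv) addrC subrK.
  have ce (s c d : R) : integ `[c, d] (fun t => e * g2 (s, t)) = e * integ `[c, d] (fun t => g2 (s, t)).
    by rewrite RintegralZl//; apply: continuous_itg => t _; exact: cB.
  have ie (s c d : R) : itg `[c, d] (fun t => e * g2 (s, t)).
    by apply: itgZ => //; apply: continuous_itg => t _; exact: cB.
  have [y_1|y_1] := leP 1 y.
    have := rect u v 1 y uv ltr01 y_1; rewrite RintegralB// !ce -!(prim_diff (cB _) y_1).
    by lra.
  have := rect u v y 1 uv y0 (ltW y_1); rewrite RintegralB// !ce -!(prim_diff (cB _) (ltW y_1)).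
  by lra.
have F : (fun t => potential g1 g2 (t, y)) = (fun t => prim (fun s => g1 (s, y) + m s * g2 (s, y)) t
    + (potential g1 g2 (0, y) - prim (fun s => g1 (s, y) + m s * g2 (s, y)) 0)).
  apply/funext => t; have [t0|t0] := leP 0 t; first by have := key 0 t t0; lra.
  by have := key t 0 (ltW t0); lra.
rewrite F; have d := is_derive_prim x (cAs y).
by apply: (isd_eq (dD d (dC x _))); rewrite addr0.
Qed.

(** Continuity up to the boundary: the potential is Lipschitz continuous in y
    locally uniformly in x, and continuous in x for y > 0. *)
Lemma potential_cont (g1 g2 a b : R * R -> R) x y : flat_field e m g1 g2 a b -> 0 <= y ->
  {for (x, y), continuous (potential g1 g2)}.
Proof.
move=> G y0; have c2 := ff_cont2 G.
have [d d0 H] : exists2 d, 0 < d & forall x' y', `|x' - x| <= d -> `|y' - y| <= d ->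
    `|g2 (x', y')| <= `|g2 (x, y)| + 1.
  have cn : {for (x, y), continuous (fun z => `|g2 z|)}.
    by apply: (@ccomp R _ _ Num.norm); [exact: norm_continuous|exact: (@c2 (x, y))].
  have N : \forall z \near (x, y), `|g2 z| <= `|g2 (x, y)| + 1.
    by apply: (cvgr_le _ cn); rewrite ltrDl.
  by have [d d0 H] := near_pairP N; exists d.
set M := `|g2 (x, y)| + 1 in H; have M0 : 0 < M by rewrite ltr_wpDl.
have lip x' s t : `|x' - x| <= d -> `|s - y| <= d / 3 -> `|t - y| <= d / 3 ->
    `|potential g1 g2 (x', s) - potential g1 g2 (x', t)| <= M * `|s - t|.
  move=> xd sd td; have [c ct ->] := @mvt R (fun t => potential g1 g2 (x', t))
    (fun t => e * g2 (x', t)) t s (fun t _ => potential_dy g1 x' t c2).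
  rewrite !normrM e1 mul1r ler_wpM2r//; apply: H => //.
  move: sd td ct; rewrite !ler_norml => /andP[? ?] /andP[? ?].
  have [st|st] := leP 0 (s - t); [rewrite (ger0_norm st)|rewrite (ltr0_norm st)];
    by move=> /andP[? ?]; apply/andP; split; lra.
apply/cvgrPdist_le => eps eps0.
pose h := Num.min (d / 3) (eps / (4 * M)).
have h0 : 0 < h by rewrite lt_min !divr_gt0// mulr_gt0.
have hd : h <= d / 3 by rewrite ge_min lexx.
have hM : M * h <= eps / 4.
  have : h <= eps / (4 * M) by rewrite ge_min lexx orbT.
  rewrite ler_pdivlMr ?mulr_gt0//; lra.
clearbody h; have yh : 0 < y + h by lra.
have dx0 := potential_dx x G yh.
have e4 : 0 < eps / 4 by rewrite divr_gt0.
have /cvgrPdist_le/(_ _ e4)/nbhs_ballP[r /= r0 Hr] := is_derive_cont dx0.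
apply: (@pair_nearP R _ x y (Num.min (Num.min r d) h)).
  by rewrite !lt_min r0 d0 h0.
move=> x' y'; rewrite !lt_min => /andP[/andP[xr xd] _] /andP[_ yh'].
have dd : `|x - x| <= d by rewrite subrr normr0 ltW.
have A1 : `|potential g1 g2 (x, y) - potential g1 g2 (x, y + h)| <= eps / 4.
  apply: le_trans (lip x y (y + h) dd _ _) _.
  - by rewrite subrr normr0 divr_ge0 ?ltW.
  - by rewrite addrAC subrr add0r gtr0_norm.
  - by rewrite opprD addrA subrr sub0r normrN gtr0_norm.
have A2 : `|potential g1 g2 (x, y + h) - potential g1 g2 (x', y + h)| <= eps / 4.
  by apply: Hr; rewrite /ball /= distrC.
have A3 : `|potential g1 g2 (x', y + h) - potential g1 g2 (x', y')| <= eps / 2.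
  apply: le_trans (lip x' (y + h) y' (ltW xd) _ _) _.
  - by rewrite addrAC subrr add0r gtr0_norm.
  - by rewrite (le_trans (ltW yh')).
  - have : `|y + h - y'| <= 2 * h.
      by move: yh'; rewrite ltr_norml ler_norml => /andP[? ?]; apply/andP; split; lra.
    move=> K; have := ler_wpM2l (ltW M0) K; lra.
move: A1 A2 A3; move: (potential _ _ _) (potential _ _ _) (potential _ _ _) (potential _ _ _) => q1 q2 q3 q4.
by rewrite !ler_norml => /andP[? ?] /andP[? ?] /andP[? ?]; apply/andP; split; lra.
Qed.


Lemma C1_at_near p g z : (\forall w \near z, p w = g w) -> (\forall w \near z, C1_at g w) ->
  [/\ C1_at p z, dx p z = dx g z & dy p z = dy g z].
Proof.
move=> pg gC; have [_ _ cx cy] := nbhs_singleton gC.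
apply: (@C1_at_intro R p (dx g) (dy g) z) => //.
have pg2 : \forall w \near z, \forall u \near w, p u = g u by apply/near_join.
apply: filterS2 gC pg2 => -[x y] gxy E; split; rewrite [_.1]/= [_.2]/=.
  apply: near_eq_is_derive (C1_dx gxy).
  have [d d0 H] := near_pairP E; apply/nbhs_ballP; exists d => //= t xt.
  by apply/esym; apply: H; rewrite ?subrr ?normr0 ?(ltW d0)// distrC ltW.
apply: near_eq_is_derive (C1_dy gxy).
have [d d0 H] := near_pairP E; apply/nbhs_ballP; exists d => //= t yt.
by apply/esym; apply: H; rewrite ?subrr ?normr0 ?(ltW d0)// distrC ltW.
Qed.

Lemma C1_at_affine p (c r : R) z : (\forall w \near z, C1_at p w) ->
  [/\ C1_at (fun w => c * p w + r) z, dx (fun w => c * p w + r) z = c * dx p z &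
      dy (fun w => c * p w + r) z = c * dy p z].
Proof.
move=> N; have [_ _ cx cy] := nbhs_singleton N.
apply: (@C1_at_intro R _ (fun w => c * dx p w) (fun w => c * dy p w)); last 2 first.
- by conti.
- by conti.
apply: filterS N => -[x y] pC; have d1 := C1_dx pC; have d2 := C1_dy pC.
split; rewrite [_.1]/= [_.2]/=.
  by apply: (isd_eq (dD (dM (dC x c) d1) (dC x r))); rewrite mulr0 !addr0.
by apply: (isd_eq (dD (dM (dC y c) d2) (dC y r))); rewrite mulr0 !addr0.
Qed.

Section Construction.
Context (g1 g2 a b : R * R -> R) (G : flat_field e m g1 g2 a b) (c rg C : R).

Definition velocity z := (unflatten e f g1 z, unflatten e f g2 z).
Definition pressure z := - (c * unflatten e f (potential g1 g2) z) - rg * z.2 + C.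

Lemma velocity_boundary x : velocity (x, f x) = (g1 (x, 0), g2 (x, 0)).
Proof. by rewrite /velocity /unflatten /height /= subrr mulr0. Qed.

Lemma velocity1_C1 z : phase e f z ->
  [/\ C1_at (unflatten e f g1) z, dx (unflatten e f g1) z = unflatten e f a z &
      dy (unflatten e f g1) z = unflatten e f b z].
Proof.
case: G => c1 c2 ca cb y1 y2 x1 x2 zP.
exact: (unflatten_C1 e1 df cm zP ca cb x1 y1).
Qed.

Lemma velocity2_C1 z : phase e f z ->
  [/\ C1_at (unflatten e f g2) z, dx (unflatten e f g2) z = unflatten e f b z &
      dy (unflatten e f g2) z = - unflatten e f a z].
Proof.
case: G => c1 c2 ca cb y1 y2 x1 x2 zP.
apply: (unflatten_C1 (A := b) (B := fun z => - a z) e1 df cm zP cb).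
- by move=> x y y0; apply: cN; exact: ca.
- by move=> x y y0; rewrite mulrN; exact: x2.
- by move=> x y y0; rewrite mulrN; exact: y2.
Qed.

Lemma potential_C1 z : phase e f z ->
  [/\ C1_at (unflatten e f (potential g1 g2)) z,
      dx (unflatten e f (potential g1 g2)) z = unflatten e f g1 z &
      dy (unflatten e f (potential g1 g2)) z = unflatten e f g2 z].
Proof.
move=> zP; apply: (unflatten_C1 e1 df cm zP).
- by move=> x y _; exact: (@ff_cont1 _ _ _ _ _ _ _ G (x, y)).
- by move=> x y _; exact: (@ff_cont2 _ _ _ _ _ _ _ G (x, y)).
- by move=> x y; exact: potential_dx G.
- by move=> x y _; apply: potential_dy; exact: ff_cont2 G.
Qed.

Lemma velocity_cont : continuous velocity.
Proof.
move=> z.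
have d1 : {for z, continuous (unflatten e f g1)}.
  by apply: (unflatten_cont_at df); exact: (@ff_cont1 _ _ _ _ _ _ _ G).
have d2 : {for z, continuous (unflatten e f g2)}.
  by apply: (unflatten_cont_at df); exact: (@ff_cont2 _ _ _ _ _ _ _ G).
exact: (@cvg_pair _ _ _ (nbhs z) (nbhs _) (nbhs _) _ _ _ _ _ d1 d2).
Qed.

Lemma pressure_C1 z : phase e f z ->
  [/\ C1_at pressure z, dx pressure z = - (c * unflatten e f g1 z) &
      dy pressure z = - (c * unflatten e f g2 z) - rg].
Proof.
move=> zP.
apply: (@C1_at_intro R pressure (fun z => - (c * unflatten e f g1 z))
  (fun z => - (c * unflatten e f g2 z) - rg) z).
- apply: filterS (phase_near df zP) => -[x y] wP.
  have [PC Ex Ey] := potential_C1 wP; have p1 := C1_dx PC; have p2 := C1_dy PC.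
  rewrite Ex in p1; rewrite Ey in p2; rewrite /pressure; split; rewrite [_.1]/= [_.2]/=.
    apply: (isd_eq (dD (dD (dN (dM (dC x c) p1)) (dC x (- (rg * y)))) (dC x C))).
    by rewrite mulr0 !addr0.
  apply: (isd_eq (dD (dD (dN (dM (dC y c) p2)) (dN (dM (dC y rg) (dI y)))) (dC y C))).
  by rewrite !mulr0 !addr0 mulr1.
- have [_ _] := velocity1_C1 zP => _.
  have d1 : {for z, continuous (unflatten e f g1)}.
    by apply: (unflatten_cont_at df); exact: (@ff_cont1 _ _ _ _ _ _ _ G).
  by conti.
- have d2 : {for z, continuous (unflatten e f g2)}.
    by apply: (unflatten_cont_at df); exact: (@ff_cont2 _ _ _ _ _ _ _ G).
  by conti.
Qed.

Lemma pressure_cont z : closure (phase e f) z -> {for z, continuous pressure}.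
Proof.
rewrite (closure_phase e1 df) /= => zP.
have d : {for z, continuous (unflatten e f (potential g1 g2))}.
  by apply: (unflatten_cont_at df); exact: (potential_cont G).
by have d2 := @csnd R z; rewrite /pressure; conti.
Qed.

Lemma construction_regular : phase_regularity (phase e f) velocity pressure.
Proof.
have C1p : C1_in (phase e f) pressure by move=> z /pressure_C1[].
have C1v1 : C1_in (phase e f) (fun z => (velocity z).1).
  by move=> z /velocity1_C1[].
have C1v2 : C1_in (phase e f) (fun z => (velocity z).2).
  by move=> z /velocity2_C1[].
split; [|split; [exact: C1v1|exact: C1v2]|split; [exact: C1p| |]|split; [exact: C1p| |]].
- exact/continuous_subspaceT/velocity_cont.
- by apply: continuous_in_subspaceT => z /set_mem; exact: pressure_cont.
- exists (fun z => (- (c * unflatten e f g1 z), - (c * unflatten e f g2 z) - rg)).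
  split; last by move=> z /pressure_C1[_ E1 E2]; rewrite /grad E1 E2.
  apply: continuous_subspaceT => z.
  have d1 : {for z, continuous (unflatten e f g1)}.
    by apply: (unflatten_cont_at df); exact: (@ff_cont1 _ _ _ _ _ _ _ G).
  have d2 : {for z, continuous (unflatten e f g2)}.
    by apply: (unflatten_cont_at df); exact: (@ff_cont2 _ _ _ _ _ _ _ G).
  have d3 : {for z, continuous (fun z => - (c * unflatten e f g1 z))} by conti.
  have d4 : {for z, continuous (fun z => - (c * unflatten e f g2 z) - rg)} by conti.
  exact: (@cvg_pair _ _ _ (nbhs z) (nbhs _) (nbhs _) _ _ _ _ _ d3 d4).
- move=> z zP; have N := phase_near df zP.
  have E : \forall w \near z, dx pressure w = - (c * unflatten e f g1 w).
    by apply: filterS N => w /pressure_C1[_ E _].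
  have [A _ _] := @C1_at_near (dx pressure) (fun w => - c * unflatten e f g1 w + 0) z
    (filterS (fun w Ew => etrans Ew (esym (etrans (addr0 _) (mulNr _ _)))) E)
    (filterS (fun w wP => let: And3 A _ _ := @C1_at_affine (unflatten e f g1) (- c) 0 w
      (filterS (fun u uP => let: And3 B _ _ := velocity1_C1 uP in B) (phase_near df wP)) in A) N).
  exact: A.
- move=> z zP; have N := phase_near df zP.
  have E : \forall w \near z, dy pressure w = - (c * unflatten e f g2 w) - rg.
    by apply: filterS N => w /pressure_C1[_ _ E].
  have [A _ _] := @C1_at_near (dy pressure) (fun w => - c * unflatten e f g2 w + - rg) z
    (filterS (fun w Ew => etrans Ew (congr1 (fun t => t - rg) (esym (mulNr _ _)))) E)
    (filterS (fun w wP => let: And3 A _ _ := @C1_at_affine (unflatten e f g2) (- c) (- rg) w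
      (filterS (fun u uP => let: And3 B _ _ := velocity2_C1 uP in B) (phase_near df wP)) in A) N).
  exact: A.
Qed.

Lemma construction_equations : c != 0 ->
  (forall z, phase e f z -> divergence velocity z = 0) /\
  (forall z, phase e f z -> velocity z = - c^-1 *: (grad pressure z + (0, rg))).
Proof.
move=> c0; split=> z zP.
  have [_ E1 _] := velocity1_C1 zP; have [_ _ E2] := velocity2_C1 zP.
  rewrite /divergence; have -> : dx (fun w => (velocity w).1) z = unflatten e f a z := E1.
  have -> : dy (fun w => (velocity w).2) z = - unflatten e f a z := E2.
  exact: subrr.
have [_ E1 E2] := pressure_C1 zP; rewrite /grad E1 E2 /velocity.
move: (unflatten e f g1 z) (unflatten e f g2 z) => u1 u2.
congr pair; rewrite /= ?addr0 ?subrK; change (- c^-1 * - (c * _)) with (- c^-1 * - (c * _)).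
  by rewrite scaleRE; field.
by rewrite scaleRE; field.
Qed.

Lemma construction_trace x : is_derive x 1 (fun s => pressure (s, f s))
  (- (c * (g1 (x, 0) + m x * g2 (x, 0))) - rg * m x).
Proof.
have cP : continuous (fun z : R * R => potential g1 g2 (z.1, Num.max z.2 0)).
  move=> z; have d1 := @cfst R z; have d2 := @max_cont R z.
  apply: (@ccompf2 R _ (potential g1 g2) (fun z => z.1) (fun z : R * R => Num.max z.2 0) z _ d1 d2).
  by apply: (potential_cont G); rewrite le_max lexx orbT.
have cD : continuous (fun z : R * R => g1 z + m z.1 * g2 z).
  move=> z; have q1 := @ff_cont1 _ _ _ _ _ _ _ G z; have q2 := @ff_cont2 _ _ _ _ _ _ _ G z.
  have q3 : {for z, continuous (fun w : R * R => m w.1)}.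
    by apply: (@ccomp R _ _ m); [exact: cm|exact: (@cfst R z)].
  by conti.
have := @trace_derive _ _ x cP cD; rewrite /= maxxx => T.
have d1 : isd (fun s => potential g1 g2 (s, 0)) x (g1 (x, 0) + m x * g2 (x, 0)).
  apply: T => t y y0; rewrite max_l ?(ltW y0)//; exact: potential_dx G y0.
have -> : (fun s => pressure (s, f s)) =
    (fun s => - (c * potential g1 g2 (s, 0)) - rg * f s + C).
  by apply/funext => s; rewrite /pressure /unflatten /height /= subrr mulr0.
apply: (isd_eq (dD (dD (dN (dM (dC x c) d1)) (dN (dM (dC x rg) (df x)))) (dC x C))).
by rewrite !mulr0 !addr0.
Qed.

End Construction.

Section Physical.
Context (v : R * R -> R * R) (p : R * R -> R) (k visc rg : R).
Context (k0 : 0 < k) (visc0 : 0 < visc).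
Context (cv : {within closure (phase e f), continuous v}).
Context (p1 : C1_closure (phase e f) p) (p2 : C2_in (phase e f) p).
Context (darcy : forall z, phase e f z -> v z = - (k / visc) *: (grad p z + (0, rg))).

Lemma darcy1 z : phase e f z -> (v z).1 = - (k / visc) * dx p z.
Proof. by move=> zP; rewrite (darcy zP) /grad; move: (dx p z) (dy p z) => s t; rewrite /= addr0. Qed.

Lemma darcy2 z : phase e f z -> (v z).2 = - (k / visc) * (dy p z + rg).
Proof. by move=> zP; rewrite (darcy zP) /grad; move: (dx p z) (dy p z) => s t. Qed.

(** Darcy's law makes the velocity a gradient, hence curl free. *)
Lemma darcy_curl z : phase e f z ->
  dx (fun z => (v z).2) z = dy (fun z => (v z).1) z.
Proof.
move=> zP; have N := phase_near df zP; have [pC pxC pyC] := p2.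
set l := - (k / visc).
have E1 : \forall w \near z, (v w).1 = l * dx p w by apply: filterS N => w; exact: darcy1.
have E2 : \forall w \near z, (v w).2 = l * (dy p w + rg) by apply: filterS N => w; exact: darcy2.
have Nx : \forall w \near z, C1_at (dx p) w by apply: filterS N => w; exact: pxC.
have Ny : \forall w \near z, C1_at (dy p) w by apply: filterS N => w; exact: pyC.
have near2 (P : R * R -> Prop) : (\forall w \near z, P w) ->
    \forall w \near z, \forall u \near w, P u by move=> H; apply/near_join.
have [_ _ H1] := @C1_at_near (fun z => (v z).1) (fun w => l * dx p w + 0) z
  (filterS (fun w Ew => etrans Ew (esym (addr0 _))) E1)
  (filterS (fun w Nw => let: And3 A _ _ := @C1_at_affine (dx p) l 0 w Nw in A) (near2 _ Nx)).
have [_ H2 _] := @C1_at_near (fun z => (v z).2) (fun w => l * dy p w + l * rg) z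
  (filterS (fun w Ew => etrans Ew (mulrDr _ _ _)) E2)
  (filterS (fun w Nw => let: And3 A _ _ := @C1_at_affine (dy p) l (l * rg) w Nw in A) (near2 _ Ny)).
have [_ _ K1] := @C1_at_affine (dx p) l 0 z Nx.
have [_ K2 _] := @C1_at_affine (dy p) l (l * rg) z Ny.
have S : dx (dy p) z = dy (dx p) z.
  by apply: schwarz; apply: filterS N => w wP; split; [exact: pC|exact: pxC|exact: pyC].
exact: etrans H2 (etrans K2 (etrans (congr1 (fun t => l * t) S) (esym (etrans H1 K1)))).
Qed.

(** The tangential derivative of the pressure is, by Darcy's law, the tangential
    velocity up to gravity: this is how the pressure jump prescribes a jump of the
    tangential velocity. *)
Lemma darcy_trace x : is_derive x 1 (fun s => p (s, f s))
  (- (visc / k * ((v (x, f x)).1 + m x * (v (x, f x)).2)) - rg * m x).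
Proof.
have [pC cp _] := p1.
have cP := flatten_cont e1 df cp; have cV := flatten_cont e1 df cv.
have cD : continuous (fun z : R * R =>
    - (visc / k * ((flatten e f v z).1 + m z.1 * (flatten e f v z).2)) - rg * m z.1).
  move=> z; have q1 : {for z, continuous (fun z => (flatten e f v z).1)}.
    by apply: (continuous_comp (cV z)); exact: cvg_fst.
  have q2 : {for z, continuous (fun z => (flatten e f v z).2)}.
    by apply: (continuous_comp (cV z)); exact: cvg_snd.
  have q3 : {for z, continuous (fun w : R * R => m w.1)}.
    by apply: (@ccomp R _ _ m); [exact: cm|exact: (@cfst R z)].
  by conti.
have := @trace_derive _ _ x cP cD.
have E (s : R) (T : Type) (h : R * R -> T) : flatten e f h (s, 0) = h (s, f s).
  by rewrite flatten_inside// mulr0 addr0.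
have -> : (fun s => flatten e f p (s, 0)) = (fun s => p (s, f s)).
  by apply/funext => s; exact: E.
rewrite !E; apply => t y y0; have zP := phase_coord e1 f t y0.
have D := flatten_dx e1 df t pC y0.
apply: (isd_eq D); rewrite !flatten_inside ?(ltW y0)// (darcy1 zP) (darcy2 zP) [_.1]/=.
move: (dx p _) (dy p _) => s u; field.
by rewrite !gt_eqF.
Qed.

End Physical.

End Pressure.

(** * Singular integrals along the graph *)
Section PrincipalValues.
Context {R : realType}.
Context (L : R) (f m : R -> R).
Context (df : forall x : R, is_derive x 1 f (m x)) (cm : continuous m).
Context (mL : forall x, `|m x| <= L).
Implicit Types w : R -> R.

Definition delta (x y : R) := f x - f (x - y).

Lemma flat_vanish_rotate (e : R) (G1 G2 : R * R -> R) :
  flat_vanish e f G1 G2 -> flat_vanish e f G2 (fun z => - G1 z).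
Proof.
move=> V eps /V[N H]; exists N => x y y0 far; have [h1 h2] := H x y y0 far.
by rewrite normrN.
Qed.

(** Subtracting the Plemelj formulas of the two phases leaves the jump of the
    tangential velocity as density. *)
Lemma two_phase_PV w G1 G2 a b (x : R) : two_phase f m w G1 G2 a b ->
  has_PV (fun y => y * w (x - y) / denominator f x y)
    (- pi * (G2 true (x, 0) + G2 false (x, 0))) /\
  has_PV (fun y => delta x y * w (x - y) / denominator f x y)
    (pi * (G1 true (x, 0) + G1 false (x, 0))).
Proof.
case=> F V T N; split.
- have H1 := plemelj_phase x (@normr_side R true) df cm mL (F true) (V true).
  have H2 := plemelj_phase x (@normr_side R false) df cm mL (F false) (V false).
  have H := has_PVD (has_PVZ (-1) H1) H2.
  apply: (has_PV_eq H) => [y|]; last first.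
    by rewrite /side; move: (pi : R) => p; ring.
  have t1 := T (x - y); have n1 := N (x - y).
  rewrite -t1; move: n1.
  move: (G1 true _) (G2 true _) (G1 false _) (G2 false _) (denominator _ _ _)^-1 => u1 u2 v1 v2 d.
  move=> n1; have -> : v2 - m (x - y) * v1 = u2 - m (x - y) * u1 by rewrite n1.
  by ring.
- have H1 := plemelj_phase x (@normr_side R true) df cm mL (flat_rotate f (F true)) (flat_vanish_rotate (V true)).
  have H2 := plemelj_phase x (@normr_side R false) df cm mL (flat_rotate f (F false)) (flat_vanish_rotate (V false)).
  have H := has_PVD (has_PVZ (-1) H1) H2.
  apply: (has_PV_eq H) => [y|]; last first.
    by rewrite /side; move: (pi : R) => p; ring.
  have t1 := T (x - y); have n1 := N (x - y).
  rewrite -t1 /delta; move: n1.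
  move: (G1 true _) (G2 true _) (G1 false _) (G2 false _) (denominator _ _ _)^-1 => u1 u2 v1 v2 d.
  move=> n1; have -> : v2 + m (x - y) * - v1 = u2 - m (x - y) * u1 by rewrite mulrN n1.
  by ring.
Qed.

Context (B : R) (fB : forall x, `|f x| <= B).

Lemma reflect_cont (x y : R) : {for y, continuous (fun y : R => x - y)}.
Proof. exact: (cD (@cC R R x y) (cN (@cI R y))). Qed.

Lemma den_cont (x y : R) : {for y, continuous (denominator f x)}.
Proof.
have cf : continuous f by move=> t; exact: is_derive_cont (df t).
have c1 : {for y, continuous (fun y => f (x - y))}.
  by apply: (@ccomp R R _ f); [exact: cf|exact: reflect_cont].
by rewrite /denominator; conti.
Qed.

Lemma den_gt0 (x y : R) : y != 0 -> 0 < denominator f x y.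
Proof. by move=> y0; rewrite /denominator ltr_wpDr ?sqr_ge0// exprn_even_gt0. Qed.

Lemma d_den (x y : R) : isd (denominator f x) y (2 * y + 2 * delta x y * m (x - y)).
Proof.
have d1 : isd (fun y => f (x - y)) y (- m (x - y)).
  have dl : isd (fun y : R => x - y) y (-1) by deriv; cbv beta; ring.
  rewrite -mulrN1; exact: (@dcomp R (fun y => x - y) f y _ _ (df _) dl).
by rewrite /denominator /delta; deriv; cbv beta; ring.
Qed.

(** The kernel of this principal value is the derivative of half the logarithm of
    the denominator, whose values at [y] and [-y] agree asymptotically both as
    [y] tends to [0] and as [y] tends to infinity. *)
Lemma log_kernel_PV (x : R) :
  has_PV (fun y => (y + delta x y * m (x - y)) / denominator f x y) 0.
Proof.
have cf : continuous f by move=> t; exact: is_derive_cont (df t).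
have B0 : 0 <= B := le_trans (normr_ge0 _) (fB 0).
pose k y := (y + delta x y * m (x - y)) / denominator f x y.
have ck (y : R) : y != 0 -> {for y, continuous k}.
  move=> /(den_gt0 x)/gt_eqF/negbT n0; have c0 := @den_cont x y.
  have c1 : {for y, continuous (fun y => f (x - y))}.
    by apply: (@ccomp R R _ f); [exact: cf|exact: reflect_cont].
  have c2 : {for y, continuous (fun y => m (x - y))}.
    by apply: (@ccomp R R _ m); [exact: cm|exact: reflect_cont].
  by rewrite /k /delta; conti.
pose H (y : R) := 2^-1 * ln (denominator f x y).
have dH (y : R) : y != 0 -> is_derive y 1 H (k y).
  move=> y0; have D0 := den_gt0 x y0; have := d_ln D0 (@d_den x y) => dl.
  apply: (isd_eq (dM (dC y 2^-1) dl)); have n0 : denominator f x y != 0 by rewrite gt_eqF.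
  by rewrite /k mulr0 addr0; move: n0; move: (denominator f x y) => q n0; field.
(* on intervals away from 0 the kernel has the primitive H *)
have path (a b : R) : a <= b -> (forall y, a <= y <= b -> y != 0) ->
    integ `[a, b] k = H b - H a.
  move=> ab nz; apply: FTC2 => //.
  - by move=> y yab; apply: ck; exact: nz.
  - by move=> y yab; exact: is_derive_cont (dH y (nz y yab)).
  - by move=> y /andP[ay yb]; apply: dH; apply: nz; rewrite !ltW.
apply: has_PV_intro; first exact: ck.
have rat (u : R) : u != 0 -> denominator f x u = u ^+ 2 * (1 + (delta x u / u) ^+ 2).
  by move=> u0; rewrite /denominator -/(delta x u); field.
pose q (u : R) := 1 + (delta x u / u) ^+ 2.
have q0 u : 0 < q u by rewrite /q ltr_wpDr ?sqr_ge0.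
have HE (u : R) : 0 < u -> H u - H (- u) = 2^-1 * (ln (q u) - ln (q (- u))).
  move=> u0; have un : u != 0 by rewrite gt_eqF.
  rewrite /H (rat u un) (rat (- u)) ?oppr_eq0// sqrrN -mulrBr; congr (_ * _).
  rewrite !lnM ?posrE ?exprn_gt0 ?q0//; rewrite /q; ring.
(* at zero both quotients tend to 1 + f'(x)^2, at infinity to 1 *)
have lim0 (s : R) : `|s| = 1 -> q (s * u) @[u --> 0^'+] --> 1 + m x ^+ 2.
  move=> s1; have sn : s != 0 by rewrite -normr_gt0 s1.
  apply: cvgD; first exact: cvg_cst.
  have Q : delta x (s * u) / (s * u) @[u --> 0^'+] --> m x.
    apply/cvgrPdist_le => eps eps0.
    have N := is_derive_epsP (df x) eps0.
    have C : x - s * u @[u --> 0^'+] --> x.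
      have c1 : {for 0, continuous (fun u : R => x - s * u)}.
        exact: (cD (@cC R R x 0) (cN (cM (@cC R R s 0) (@cI R 0)))).
      have := cvg_at_right_filter c1; by rewrite mulr0 subr0.
    have N2 : \forall u \near 0^'+, `|f (x - s * u) - f x - m x * (x - s * u - x)| <=
        eps * `|x - s * u - x| := C _ N.
    near=> u; have u0 : 0 < u by near: u; exact: nbhs_right_gt.
    have su : s * u != 0 by rewrite mulf_neq0// gt_eqF.
    have : `|f (x - s * u) - f x - m x * (x - s * u - x)| <= eps * `|x - s * u - x|.
      by near: u; exact: N2.
    have -> : x - s * u - x = - (s * u) by ring.
    rewrite normrN /delta.
    have E (p t r v : R) : v != 0 -> p - (t - r) / v = (r - t - p * - v) / v.
      by move=> vn; field.
    move=> Hu; rewrite (E _ _ _ _ su) normrM normfV ler_pdivrMr ?normr_gt0//.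
  have QQ : (delta x (s * u) / (s * u)) * (delta x (s * u) / (s * u)) @[u --> 0^'+] --> m x * m x.
    by apply: cvgM; exact: Q.
  exact: QQ.
have limoo (s : R) : `|s| = 1 -> q (s * u^-1) @[u --> 0^'+] --> (1 : R).
  move=> s1; rewrite -[X in _ --> X]addr0; apply: cvgD; first exact: cvg_cst.
  have Q : delta x (s * u^-1) / (s * u^-1) @[u --> 0^'+] --> (0 : R).
    apply/cvgr0Pnorm_le => eps eps0; near=> u.
    have u0 : 0 < u by near: u; exact: nbhs_right_gt.
    have ue : u <= eps / (2 * B + 1).
      by near: u; apply: nbhs_right_le; rewrite divr_gt0//; lra.
    rewrite invfM invrK normrM normrM normfV s1 invr1 mul1r (gtr0_norm u0).
    have D : `|delta x (s * u^-1)| <= 2 * B + 1.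
      rewrite /delta (le_trans (ler_normB _ _))//.
      by have := fB x; have := fB (x - s * u^-1); lra.
    apply: (@le_trans _ _ ((2 * B + 1) * u)); first by rewrite ler_wpM2r// ltW.
    by rewrite mulrC -ler_pdivlMr//; lra.
  have QQ : (delta x (s * u^-1) / (s * u^-1)) * (delta x (s * u^-1) / (s * u^-1))
      @[u --> 0^'+] --> (0 : R) * 0 by apply: cvgM; exact: Q.
  by rewrite mulr0 in QQ; exact: QQ.
have lnq (c : R) (F : R -> R) : 0 < c -> q (F u) @[u --> 0^'+] --> c ->
    ln (q (F u)) @[u --> 0^'+] --> ln c.
  by move=> c0 Q; exact: (cvg_comp _ _ Q (continuous_ln c0)).
have m1 : 0 < 1 + m x ^+ 2 by rewrite ltr_wpDr ?sqr_ge0.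
have n1 : `|1 : R| = 1 by rewrite normr1.
have nN1 : `|-1 : R| = 1 by rewrite normrN normr1.
have A1 := lnq _ _ m1 (lim0 1 n1); have A2 := lnq _ _ m1 (lim0 (-1) nN1).
have A3 := lnq _ _ ltr01 (limoo 1 n1); have A4 := lnq _ _ ltr01 (limoo (-1) nN1).
have Z : 2^-1 * ((ln (q (1 * u^-1)) - ln (q (-1 * u^-1))) - (ln (q (1 * u)) - ln (q (-1 * u))))
    @[u --> 0^'+] --> (0 : R).
  rewrite -[X in _ --> X](mulr0 2^-1); apply: cvgMr.
  rewrite -[X in _ --> X](subrr 0); apply: cvgB.
    by rewrite -[X in _ --> X](subrr (ln 1)); apply: cvgB; [exact: A3|exact: A4].
  by rewrite -[X in _ --> X](subrr (ln (1 + m x ^+ 2))); apply: cvgB; [exact: A1|exact: A2].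
apply: cvg_trans Z; apply: near_eq_cvg; near=> u.
have u0 : 0 < u by near: u; exact: nbhs_right_gt.
have u1 : u <= 1 by near: u; exact: nbhs_right_le.
have ui : 0 < u^-1 by rewrite invr_gt0.
have uu : u <= u^-1 by rewrite (le_trans u1)// invf_ge1.
rewrite !path; last 4 first.
- exact: uu.
- by move=> y /andP[uy _]; rewrite gt_eqF// (lt_le_trans u0).
- by rewrite lerN2.
- by move=> y /andP[_ yu]; rewrite lt_eqF// (le_lt_trans yu)// oppr_lt0.
have E1 := HE _ u0; have E2 := HE _ ui; rewrite !mul1r !mulN1r.
by move: E1 E2; move: (H _) (H _) (H _) (H _) (ln _) (ln _) (ln _) (ln _) => h1 h2 h3 h4 l1 l2 l3 l4; lra.
Unshelve. all: by end_near. Qed.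

(** With d = f(x) - f(x - y), the numerator is
    y (f'(x) - f'(x - y)) = f'(x) (y + d f'(x - y)) - f'(x - y) (y + f'(x) d),
    and the first term has principal value 0 by [log_kernel_PV]. *)
Lemma gravity_PV (x A C : R) :
  has_PV (fun y => y * m (x - y) / denominator f x y) A ->
  has_PV (fun y => delta x y * m (x - y) / denominator f x y) C ->
  has_PV (fun y => y * (m x - m (x - y)) / denominator f x y) (- (A + m x * C)).
Proof.
move=> hA hC; have h0 := has_PVZ (m x) (log_kernel_PV x).
have H := has_PVD h0 (has_PVZ (-1) (has_PVD hA (has_PVZ (m x) hC))).
apply: (has_PV_eq H) => [y|]; last by ring.
by move: (denominator f x y)^-1 => d; rewrite /delta; ring.
Qed.

End PrincipalValues.

(** * Smooth cut-offs *)
Section Smooth.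
Context {R : realType}.
Local Notation mu := (@lebesgue_measure R).
Implicit Types g h : R -> R.

(** Derivatives are quantified rather than computed, which makes stability under
    products and affine substitutions an induction on the order. *)
Fixpoint times_derivable (n : nat) g : Prop :=
  if n is k.+1 then exists2 g', (forall x : R, is_derive x 1 g (g' x)) & times_derivable k g'
  else True.

Lemma times_derivable_weak n g : times_derivable n.+1 g -> times_derivable n g.
Proof.
elim: n g => //= n IH g [g' dg [g'' dg' H]]; exists g' => //; apply: IH; by exists g''.
Qed.

Lemma times_derivableC n (c : R) : times_derivable n (fun=> c).
Proof.
elim: n c => //= n IH c; exists (fun=> 0); last exact: IH.
by move=> x; exact: dC.
Qed.

Lemma times_derivableD n g h : times_derivable n g -> times_derivable n h ->
  times_derivable n (fun x => g x + h x).
Proof.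
elim: n g h => //= n IH g h [g' dg G] [h' dh H]; exists (fun x => g' x + h' x); last exact: IH.
by move=> x; exact: (dD (dg x) (dh x)).
Qed.

Lemma times_derivableM n g h : times_derivable n g -> times_derivable n h ->
  times_derivable n (fun x => g x * h x).
Proof.
elim: n g h => //= n IH g h gn hn; have gw := times_derivable_weak gn.
have hw := times_derivable_weak hn; case: gn hn => g' dg G [h' dh H].
exists (fun x => g x * h' x + h x * g' x).
  by move=> x; exact: (dM (dg x) (dh x)).
by apply: times_derivableD; apply: IH.
Qed.

Lemma times_derivable_affine n g (c d : R) : times_derivable n g ->
  times_derivable n (fun x => g (c * x + d)).
Proof.
elim: n g => //= n IH g [g' dg G]; exists (fun x => g' (c * x + d) * c).
  move=> x; have dl : isd (fun x => c * x + d) x c by deriv; cbv beta; ring.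
  exact: (@dcomp R (fun x => c * x + d) g x _ _ (dg _) dl).
by apply: times_derivableM; [exact: IH|exact: times_derivableC].
Qed.

Lemma times_derivable_derive1n n g (x : R) : times_derivable n.+1 g ->
  derivable (derive1n n g) x 1.
Proof.
elim: n g => [|n IH] g [g' dg G]; first by have [] := dg x.
have E : derive1 g = g' by apply/funext => y; rewrite derive1E; have [_ ->] := dg y.
by rewrite /derive1n iterSr E; exact: IH.
Qed.

(** The span of these functions is closed under differentiation. *)
Definition flat_exp (n : nat) (x : R) : R :=
  if 0 < x then x^-1 ^+ n * expR (- x^-1) else 0.

(** Here exp u = exp (u / k)^k and exp (u / k) >= u / k, with k = n + 1. *)
Lemma pow_le_expR n (u : R) : 0 <= u -> u ^+ n.+1 <= n.+1%:R ^+ n.+1 * expR u.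
Proof.
move=> u0; have n0 : (0 : R) < n.+1%:R by [].
have -> : u = n.+1%:R * (u / n.+1%:R) by rewrite mulrC divfK// gt_eqF.
rewrite expRM_natl -exprMn ler_pXn2r ?nnegrE ?mulr_ge0 ?divr_ge0 ?expR_ge0//.
rewrite ler_pM2l//; apply: le_trans (expR_ge1Dx _); by rewrite lerDr.
Qed.

Lemma is_derive_flat_exp n (x : R) :
  is_derive x 1 (flat_exp n) (flat_exp n.+2 x + - n%:R * flat_exp n.+1 x).
Proof.
have [x0|x0|x0] := ltgtP 0 x; last first.
- rewrite -x0 /flat_exp ltxx mulr0 addr0; apply: is_derive_eps => eps eps0.
  have C0 : 0 < n.+2%:R ^+ n.+2 :> R by rewrite exprn_gt0.
  near=> y; rewrite ltxx !subr0 mul0r subr0.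
  have yd : `|y| <= eps / n.+2%:R ^+ n.+2.
    near: y; apply: cvgr0_norm_le; last by rewrite divr_gt0.
    exact: cvg_id.
  case: ifPn => y0; last by rewrite normr0 mulr_ge0// ltW.
  have u0 : 0 < y^-1 by rewrite invr_gt0.
  have H := pow_le_expR n.+1 (ltW u0).
  rewrite ger0_norm ?mulr_ge0 ?exprn_ge0 ?expR_ge0 ?(ltW u0)//.
  rewrite gtr0_norm// in yd *; rewrite ler_pdivlMr// in yd.
  rewrite expRN ler_pdivrMr ?expR_gt0//.
  have E : y^-1 ^+ n = y^-1 ^+ n.+2 * y * y.
    by rewrite !exprS; move: (y^-1 ^+ n) => q; field; rewrite gt_eqF.
  have y2 : 0 <= y * y by rewrite mulr_ge0// ltW.
  rewrite E -mulrA; apply: (le_trans (ler_wpM2r y2 H)).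
  have -> : n.+2%:R ^+ n.+2 * expR y^-1 * (y * y) = (y * n.+2%:R ^+ n.+2) * (y * expR y^-1) by ring.
  by rewrite -[X in _ <= X]mulrA ler_wpM2r// mulr_ge0 ?expR_ge0// ltW.
- have E : \forall y \near x, 0 = flat_exp n y.
    near=> y; rewrite /flat_exp ifF//; apply/negbTE; rewrite -leNgt.
    by near: y; apply: (cvgr_le x) => //; exact: cvg_id.
  have -> : flat_exp n.+2 x + - n%:R * flat_exp n.+1 x = 0.
    by rewrite /flat_exp !ifF ?mulr0 ?addr0//; apply/negbTE; rewrite -leNgt ltW.
  apply: near_eq_is_derive E _; exact: is_derive_cst.
- have xn : x != 0 by rewrite gt_eqF.
  have d1 : isd (fun y : R => y^-1) x (- (1 / x ^+ 2)) by exact: (dV xn (dI x)).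
  have d2 : isd (fun y : R => expR (- y^-1)) x (expR (- x^-1) * - - (1 / x ^+ 2)).
    exact: (@dcomp R (fun y => - y^-1) expR x _ _ (is_derive_expR _) (dN d1)).
  have d3 k : isd (fun y : R => y^-1 ^+ k) x (- (k%:R * x^-1 ^+ k.+1)).
    elim: k => [|k IH]; first by rewrite mul0r oppr0; exact: dC.
    have -> : (fun y : R => y^-1 ^+ k.+1) = (fun y => y^-1 * y^-1 ^+ k).
      by apply/funext => y; rewrite exprS.
    apply: (isd_eq (dM d1 IH)); rewrite !exprS -[k.+1%:R]natr1; move: (x^-1 ^+ k) => q.
    by field.
  have E : \forall y \near x, y^-1 ^+ n * expR (- y^-1) = flat_exp n y.
    near=> y; rewrite /flat_exp ifT//.
    by near: y; apply: (cvgr_gt x) => //; exact: cvg_id.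
  apply: near_eq_is_derive E _.
  apply: (isd_eq (dM (d3 n) d2)); rewrite /flat_exp x0 !exprS.
  by move: (x^-1 ^+ n) (expR _) => q r; field.
Unshelve. all: by end_near. Qed.

Lemma flat_exp_smooth k n : times_derivable k (flat_exp n).
Proof.
elim: k n => //= k IH n; exists (fun x => flat_exp n.+2 x + - n%:R * flat_exp n.+1 x).
  by move=> x; exact: is_derive_flat_exp.
by apply: times_derivableD => //; apply: times_derivableM => //; exact: times_derivableC.
Qed.

Definition bump (x : R) := flat_exp 0 x * flat_exp 0 (1 - x).

Lemma flat_exp0_bound (x : R) : 0 <= flat_exp 0 x <= 1.
Proof.
rewrite /flat_exp; case: ifPn => x0; last by rewrite lexx ler01.
by rewrite mul1r expR_ge0/= -expR0 ler_expR oppr_le0 invr_ge0 ltW.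
Qed.

Lemma bump_bound (x : R) : 0 <= bump x <= 1.
Proof.
have /andP[a b] := flat_exp0_bound x; have /andP[c d] := flat_exp0_bound (1 - x).
by rewrite /bump mulr_ge0//= mulr_ile1.
Qed.

Lemma bump_out (x : R) : x <= 0 \/ 1 <= x -> bump x = 0.
Proof.
rewrite /bump /flat_exp; case=> H.
  by rewrite ifF ?mul0r//; apply/negbTE; rewrite -leNgt.
by rewrite mulrC ifF ?mul0r//; apply/negbTE; rewrite -leNgt subr_le0.
Qed.

Lemma bump_smooth k : times_derivable k bump.
Proof.
have -> : bump = (fun x => flat_exp 0 x * flat_exp 0 ((-1) * x + 1)).
  by apply/funext => x; rewrite mulN1r addrC.
apply: times_derivableM; first exact: flat_exp_smooth.
by apply: times_derivable_affine; exact: flat_exp_smooth.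
Qed.

Lemma bump_cont : continuous bump.
Proof. by move=> x; have [b' db _] := bump_smooth 1; exact: is_derive_cont (db x). Qed.

Definition bump_mass := integ `[0 : R, 1] bump.

Lemma bump_prim_out (x : R) : (x <= 0 -> prim bump x = 0) /\ (1 <= x -> prim bump x = bump_mass).
Proof.
have Z (a b : R) : b <= 0 \/ 1 <= a -> integ `[a, b] bump = 0.
  move=> H; have -> : (0 : R) = integ `[a, b] (fun=> 0) by rewrite /Rintegral integral0.
  apply: eq_Rintegral => y; rewrite inE /= in_itv /= => /andP[ay yb]; apply: bump_out.
  by case: H => H; [left; exact: le_trans H|right; exact: le_trans ay].
rewrite /prim; split=> x0.
  case: ifPn => x1; last by rewrite Z ?oppr0//; left.
  by rewrite Z//; left.
rewrite (le_trans ler01 x0) /bump_mass.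
have -> : integ `[0, x] bump = integ `[0, 1] bump + integ `[1, x] bump.
  by apply: integ_chasles => [|y _]; [rewrite ler01 x0|exact: bump_cont].
by rewrite (Z 1 x) ?addr0//; right.
Qed.

Lemma bump_prim_bound (x : R) : 0 <= prim bump x <= bump_mass.
Proof.
have P (a b : R) : 0 <= integ `[a, b] bump.
  by apply: Rintegral_ge0 => y _; have /andP[] := bump_bound y.
have [h1 h2] := bump_prim_out x.
have [x0|x0] := leP x 0; first by rewrite h1// lexx P.
have [x1|x1] := leP 1 x; first by rewrite h2// lexx P.
rewrite /prim (ltW x0) P /= /bump_mass.
have -> : integ `[0, 1] bump = integ `[0, x] bump + integ `[x, 1] bump.
  by apply: integ_chasles => [|y _]; [rewrite !ltW|exact: bump_cont].
by rewrite lerDl.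
Qed.

(** Otherwise the primitive of the bump would be constant, and the bump would vanish
    at 1/2. *)
Lemma bump_mass_gt0 : 0 < bump_mass.
Proof.
have /andP[p q] := bump_prim_bound 0.
rewrite lt_neqAle (le_trans p q) andbT eq_sym; apply/eqP => m0.
have E : prim bump = fun=> 0.
  by apply/funext => x; have /andP[] := bump_prim_bound x; rewrite m0 => a b; apply/le_anti/andP.
have [_] := is_derive_prim 2^-1 bump_cont; rewrite E derive_cst.
have h : 1 - 2^-1 = 2^-1 :> R by field.
have p0 : 0 < flat_exp 0 (2^-1 : R) by rewrite /flat_exp invr_gt0 ltr0n mul1r expR_gt0.
by rewrite /bump h => E0; have := mulr_gt0 p0 p0; rewrite -E0 ltxx.
Qed.

(** A smooth step, from 0 on the negative axis to 1 beyond 1. *)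
Definition step (x : R) := prim bump x / bump_mass.

Lemma step_bound (x : R) : 0 <= step x <= 1.
Proof.
have /andP[p q] := bump_prim_bound x; have m0 := bump_mass_gt0.
by rewrite /step divr_ge0 ?(ltW m0)//= ler_pdivrMr// mul1r.
Qed.

Lemma step_out (x : R) : (x <= 0 -> step x = 0) /\ (1 <= x -> step x = 1).
Proof.
have [h1 h2] := bump_prim_out x; have m0 := bump_mass_gt0.
by rewrite /step; split=> x0; [rewrite h1// mul0r|rewrite h2// divff// gt_eqF].
Qed.

Lemma is_derive_step (x : R) : is_derive x 1 step (bump x / bump_mass).
Proof.
have d1 : isd (prim bump) x (bump x) := is_derive_prim x bump_cont.
by apply: (isd_eq (dM d1 (dC x bump_mass^-1))); rewrite mulr0 add0r mulrC.
Qed.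

Lemma step_smooth k : times_derivable k step.
Proof.
case: k => //= k; exists (fun x => bump x / bump_mass).
  exact: is_derive_step.
by apply: times_derivableM; [exact: bump_smooth|exact: times_derivableC].
Qed.

(** Smooth cut-offs approximating the indicator function of ]a, b]. *)
Definition cutoff (a b l x : R) := step (l * (x - a)) - step (l * (x - b)).

Lemma test_cutoff (a b l : R) : 1 <= l -> a <= b -> test_function (cutoff a b l).
Proof.
move=> l1 ab; have l0 : 0 < l by exact: lt_le_trans l1.
split=> [n x|].
  apply: times_derivable_derive1n; rewrite /cutoff.
  have -> : (fun x => step (l * (x - a)) - step (l * (x - b))) =
      (fun x => step (l * x + - (l * a)) + (-1) * step (l * x + - (l * b))).
    by apply/funext => y; rewrite !mulrBr mulN1r.
  apply: times_derivableD; first by apply: times_derivable_affine; exact: step_smooth.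
  apply: times_derivableM; first exact: times_derivableC.
  by apply: times_derivable_affine; exact: step_smooth.
exists (`|a| + `|b| + 1) => x; have a1 := normr_ge0 a; have b1 := normr_ge0 b.
have a2 := ler_norm (- a); rewrite normrN in a2; have b2 := ler_norm b.
have [x0|x0] := leP 0 x; [rewrite (ger0_norm x0)|rewrite (ltr0_norm x0)] => xM.
  have s1 : 1 <= l * (x - a).
    by rewrite (le_trans l1)// ler_peMr ?(ltW l0)//; lra.
  have s2 : 1 <= l * (x - b).
    by rewrite (le_trans l1)// ler_peMr ?(ltW l0)//; lra.
  by rewrite /cutoff (step_out _).2// (step_out _).2// subrr.
have s1 : l * (x - a) <= 0 by rewrite pmulr_rle0//; lra.
have s2 : l * (x - b) <= 0 by rewrite pmulr_rle0//; lra.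
by rewrite /cutoff (step_out _).1// (step_out _).1// subrr.
Qed.

Lemma derive1_cutoff (a b l x : R) : derive1 (cutoff a b l) x =
  l * (bump (l * (x - a)) / bump_mass) - l * (bump (l * (x - b)) / bump_mass).
Proof.
have H (c : R) : isd (fun x => step (l * (x - c))) x (l * (bump (l * (x - c)) / bump_mass)).
  have dl : isd (fun x => l * (x - c)) x l by deriv; cbv beta; ring.
  rewrite mulrC; exact: (@dcomp R (fun x => l * (x - c)) step x _ _ (is_derive_step _) dl).
by rewrite derive1E; have [_ ->] := dD (H a) (dN (H b)).
Qed.

End Smooth.

(** * Weak derivatives on the line *)
Section WeakDerivatives.
Context {R : realType}.
Local Notation mu := (@lebesgue_measure R).
Implicit Types g w k : R -> R.

Lemma L2_itg g : L2 g -> measurable_fun setT g /\ itg setT (fun s => g s ^+ 2).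
Proof.
rewrite /L2 => g2; split; last exact: Lfun2_integrable_sqr g2.
by move: g2; rewrite inE => /andP[]; rewrite inE.
Qed.

Lemma ae_weak (P Q : R -> Prop) : {ae mu, forall x, P x} ->
  (forall x, P x -> Q x) -> {ae mu, forall x, Q x}.
Proof.
by move=> [A [mA A0 PA]] PQ; exists A; split=> // x nQ; apply: PA => Px; exact/nQ/PQ.
Qed.

Lemma ae_dense (P : R -> Prop) (x r : R) : {ae mu, forall y, P y} -> 0 < r ->
  exists2 y, `|x - y| < r & P y.
Proof.
move=> [A [mA A0 PA]] r0; apply: contrapT => nP.
have BA : ball x r `<=` A.
  by move=> y xy; apply: PA => Py; apply: nP; exists y.
have mB : measurable (ball x r : set R) by exact: measurable_ball.
have H : (mu (ball x r) <= mu A)%E by apply: le_measure; rewrite ?inE.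
have A0' : mu A = 0%E := A0; move: H.
by rewrite A0' (lebesgue_measure_ball _ (ltW r0)) lee_fin leNgt pmulrn_lgt0 ?r0.
Qed.

Lemma ae_eq_cont g k : continuous g -> continuous k ->
  {ae mu, forall x, g x = k x} -> forall x, g x = k x.
Proof.
move=> cg ck gk x; apply/eqP; rewrite -subr_eq0 -normr_le0.
apply/ler_addgt0Pl => eps eps0; rewrite addr0.
have cd : {for x, continuous (fun y => g y - k y)}.
  by have c1 := @cg x; have c2 := @ck x; conti.
have /cvgrPdist_le/(_ _ eps0)/nbhs_ballP[d /= d0 H] := cd.
have [y xy E] := ae_dense x gk d0.
by have := H y xy; rewrite /= E subrr subr0.
Qed.

Lemma itg_local g a b : measurable_fun setT g -> itg setT (fun s => g s ^+ 2) ->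
  itg `[a, b] g.
Proof.
move=> mg ig; apply: (@itg_le R `[a, b]%classic g (fun s => 1 + g s ^+ 2)) => //.
- exact: measurable_funTS.
- move=> x _; have := sqr_ge0 (`|g x| - 1); rewrite sqrrB1 real_normK ?num_real//.
  by have := normr_ge0 (g x); lra.
- apply: itgD => //; first by apply: continuous_itg => x _; exact: (@cst_continuous R R 1 x).
  exact: (@itg_sub R `[a, b]%classic setT).
Qed.

Lemma integ_chasles_itg a b c g : a <= b <= c -> itg `[a, c] g ->
  integ `[a, c] g = integ `[a, b] g + integ `[b, c] g.
Proof.
move=> /andP[ab bc] ig; apply/eqP; rewrite addrC -subr_eq; apply/eqP.
rewrite Rintegral_itvB ?bnd_simp//.
apply: Rintegral_itv_obnd_cbnd.
apply: (@itg_sub _ _ `[a, c]) => //.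
by apply: subset_itv; rewrite bnd_simp.
Qed.

Lemma integ_cst a b (c : R) : a <= b -> integ `[a, b] (fun=> c) = c * (b - a).
Proof.
move=> ab; rewrite Rintegral_cst//.
transitivity (c * fine (b - a)%:E) => //; congr (c * fine _).
apply/(etrans (lebesgue_measure_itv `[a, b]%R)); rewrite /= lte_fin.
by case: ltgtP ab => //= -> _; rewrite subrr.
Qed.

(** Young's inequality, used in place of the Cauchy-Schwarz inequality. *)
Lemma young_increment w a b (l : R) : measurable_fun setT w ->
  itg setT (fun s => w s ^+ 2) -> 0 < l -> a <= b ->
  integ `[a, b] (fun s => `|w s|) <=
    (l * (b - a) + l^-1 * integ setT (fun s => w s ^+ 2)) / 2.
Proof.
move=> mw iw l0 ab.
have iloc := itg_local a b mw iw.
have l2 : 0 < l^-1 / 2 by rewrite divr_gt0// invr_gt0.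
have i2 : itg `[a, b] (fun s => w s ^+ 2) by exact: (@itg_sub R `[a, b]%classic setT).
have ic : itg `[a, b] (fun=> l / 2).
  by apply: continuous_itg => x _; exact: (@cst_continuous R R _ x).
have i3 : itg `[a, b] (fun s => l^-1 / 2 * w s ^+ 2) by apply: itgZ.
apply: (@le_trans _ _ (integ `[a, b] (fun s => l / 2 + l^-1 / 2 * w s ^+ 2))).
  apply: le_Rintegral => //; [exact: itg_norm|exact: itgD|].
  move=> s _; rewrite -[w s ^+ 2]real_normK ?num_real//; move: `|w s| => q.
  have := sqr_ge0 (l - q); rewrite -(ler_pM2l l2) mulr0 sqrrB => H; rewrite -subr_ge0.
  have -> : l / 2 + l^-1 / 2 * q ^+ 2 - q = l^-1 / 2 * (l ^+ 2 - l * q *+ 2 + q ^+ 2).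
    by field; rewrite gt_eqF.
  exact: H.
rewrite RintegralD// integ_cst// RintegralZl//.
have S : integ `[a, b] (fun s => w s ^+ 2) <= integ setT (fun s => w s ^+ 2).
  rewrite /Rintegral fine_le//.
  - exact: integrable_fin_num i2.
  - exact: integrable_fin_num iw.
  - apply: ge0_subset_integral => //; first exact: (measurable_int _ iw).
    by move=> x _; rewrite lee_fin sqr_ge0.
move: (ler_wpM2l (ltW l2) S).
move: (integ `[a, b] (fun s => w s ^+ 2)) (integ setT (fun s => w s ^+ 2)) => p q.
by clear; lra.
Qed.

Lemma itg_supp k a b : (forall x, x < a \/ b < x -> k x = 0) -> itg `[a, b] k ->
  itg setT k /\ integ setT k = integ `[a, b] k.
Proof.
move=> k0 i.
have E x : (k \_ `[a, b]) x = k x.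
  rewrite patchE; case: ifPn => //.
  rewrite notin_setE /= in_itv /= => /negP; rewrite negb_and -!ltNge => /orP H.
  by rewrite k0.
split; last by rewrite [RHS]Rintegral_mkcond; apply: eq_Rintegral => x _; rewrite E.
have H := (@integrable_mkcond _ _ R mu _ _ (measurable_itv `[a, b]%R)).1 i.
have := H; congr (mu.-integrable _ _).
by apply/funext => x; rewrite restrict_EFin /= E.
Qed.

Lemma bump_itg : itg setT (@bump R) /\ integ setT (@bump R) = bump_mass.
Proof.
apply: itg_supp; last by apply: continuous_itg => x _; exact: bump_cont.
by move=> x H; rewrite bump_out//; case: H => /ltW; [left|right].
Qed.

Definition mollifier (a : R) (n : nat) (x : R) : R :=
  n.+1%:R * (bump (n.+1%:R * (x - a)) / bump_mass).

Lemma mollifier_cont a n : continuous (mollifier a n).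
Proof.
move=> x; have c1 : {for x, continuous (fun x => n.+1%:R * (x - a))} by conti.
have c2 : {for x, continuous (fun x => bump (n.+1%:R * (x - a)))}.
  by apply: (@ccomp R R _ (@bump R)); [exact: bump_cont|exact: c1].
by rewrite /mollifier; conti.
Qed.

Lemma mollifier_out a n (x : R) : x <= a \/ a + n.+1%:R^-1 <= x -> mollifier a n x = 0.
Proof.
have n0 : (0 : R) < n.+1%:R by [].
move=> H; rewrite /mollifier bump_out ?mul0r ?mulr0//; case: H => H; [left|right].
  by rewrite pmulr_rle0// subr_le0.
by rewrite -ler_pdivrMl// mulr1 lerBrDl.
Qed.

Lemma mollifier_bound a n (x : R) : `|mollifier a n x| <= n.+1%:R / bump_mass.
Proof.
have n0 : (0 : R) < n.+1%:R by []; have m0 := @bump_mass_gt0 R.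
have /andP[b0 b1] := bump_bound (n.+1%:R * (x - a)).
have b2 : 0 <= bump (n.+1%:R * (x - a)) / bump_mass :> R by rewrite divr_ge0 ?(ltW m0).
rewrite /mollifier ger0_norm; last by rewrite mulr_ge0 ?(ltW n0).
by rewrite ler_pM2l// ler_piMl// invr_ge0 ltW.
Qed.

Lemma mollifier_itg a n : itg setT (mollifier a n) /\ integ setT (mollifier a n) = 1.
Proof.
have n0 : (0 : R) < n.+1%:R by []; have m0 := @bump_mass_gt0 R.
have i : itg setT (mollifier a n).
  apply: (@itg_supp _ a (a + n.+1%:R^-1) _ _).1.
    by move=> x H; apply: mollifier_out; case: H => /ltW; [left|right].
  by apply: continuous_itg => x _; exact: mollifier_cont.
split=> //; have h0 : (0 : R) < n.+1%:R^-1 by rewrite invr_gt0.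
have [_ ->] := integ_scale a h0 (@mollifier_cont a n) i.
have [ib mb] := bump_itg.
have -> : (fun t => mollifier a n (a + n.+1%:R^-1 * t)) = (fun t => (n.+1%:R / bump_mass) * bump t).
  apply/funext => t; rewrite /mollifier.
  have -> : n.+1%:R * (a + n.+1%:R^-1 * t - a) = t by rewrite addrAC subrr add0r mulrA divff ?mul1r// gt_eqF.
  by rewrite mulrA mulrAC.
rewrite RintegralZl// mb; have := @gt_eqF _ _ _ _ n0; have := gt_eqF m0.
move: (bump_mass : R) (n.+1%:R : R) => p q pn qn; field.
by rewrite qn pn.
Qed.

Lemma mollifier_meas g a n : measurable_fun setT g ->
  measurable_fun setT (fun x => g x * mollifier a n x).
Proof. by move=> mg; apply: measurable_funM => //; apply: cont_meas; exact: mollifier_cont. Qed.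

Lemma itg_mollify g a n : measurable_fun setT g -> itg setT (fun s => g s ^+ 2) ->
  itg setT (fun x => g x * mollifier a n x).
Proof.
move=> mg ig; apply: (@itg_supp _ a (a + n.+1%:R^-1) _ _).1.
  by move=> x H; rewrite mollifier_out ?mulr0//; case: H => /ltW; [left|right].
have il := itg_norm (measurable_itv _) (itg_local a (a + n.+1%:R^-1) mg ig).
apply: (@itg_le R `[a, a + n.+1%:R^-1]%classic _ (fun x => n.+1%:R / bump_mass * `|g x|)) => //.
- by apply: measurable_funTS; exact: mollifier_meas.
- by move=> x _; rewrite normrM mulrC ler_wpM2r// mollifier_bound.
- exact: itgZ.
Qed.

(** The mollifier has mass 1, lives on an interval of length h = 1 / (n + 1) and is
    at most a multiple of 1 / h, so the error is a multiple of the mean oscillation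
    of [g] near a. *)
Lemma lebesgue_pt_mollify g (a : R) : measurable_fun setT g ->
  itg setT (fun s => g s ^+ 2) -> lebesgue_pt g a ->
  integ setT (fun x => g x * mollifier a n x) @[n --> \oo] --> g a.
Proof.
move=> mg ig La; have m0 := @bump_mass_gt0 R.
pose h n : R := n.+1%:R^-1; have h0 n : 0 < h n by rewrite invr_gt0.
have hcvg : h n @[n --> \oo] --> 0^'+.
  move=> A HA; have H : h n @[n --> \oo] --> 0 by exact: cvg_harmonic.
  have : \forall n \near \oo, 0 < h n -> A (h n) := H _ HA.
  by apply: filterS => n; apply.
have D := cvg_comp _ _ hcvg La.
pose B n : set R := ball a (h n).
have mB n : measurable (B n) by exact: measurable_ball.
pose I n := integ (B n) (fun x => `|g x - g a|).
have BI n : B n `<=` `[a - h n, a + h n].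
  move=> x; rewrite /B ball_itv /= !in_itv /= => /andP[p q].
  by rewrite !ltW.
have iB n : itg (B n) (fun x => `|g x - g a|).
  apply: (@itg_sub R _ `[a - h n, a + h n]%classic) => //.
  apply: itg_norm => //; apply: itgB => //; first exact: itg_local.
  by apply: continuous_itg => x _; exact: (@cst_continuous R R _ x).
have dE n : davg g a (h n) = ((h n *+ 2)^-1 * I n)%:E.
  rewrite /davg /iavg (lebesgue_measure_ball _ (ltW (h0 n))) EFinM inver.
  rewrite (gt_eqF _) ?pmulrn_lgt0//; congr (_ * _)%E.
  rewrite /I /Rintegral fineK; last first.
    by apply: integrable_fin_num; [exact: mB|exact: iB].
  by apply: eq_integral => x _.
have C : (h n *+ 2)^-1 * I n @[n --> \oo] --> 0.
  have : ((h n *+ 2)^-1 * I n)%:E @[n --> \oo] --> (0 : R)%:E.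
    by apply: cvg_trans D; apply: near_eq_cvg; near=> n; rewrite /= dE.
  by move=> /fine_cvgP[].
have bd n : `|g a - integ setT (fun x => g x * mollifier a n x)| <=
    2 / bump_mass * ((h n *+ 2)^-1 * I n).
  have [ik k1] := mollifier_itg a n; have igk := itg_mollify a n mg ig.
  have ic : itg setT (fun x => g a * mollifier a n x) by exact: itgZ.
  have E0 : g a = integ setT (fun x => g a * mollifier a n x) by rewrite RintegralZl// k1 mulr1.
  rewrite {1}E0 -RintegralB//.
  have -> : integ setT (fun x => g a * mollifier a n x - g x * mollifier a n x) =
      integ (B n) (fun x => g a * mollifier a n x - g x * mollifier a n x).
    rewrite [RHS]Rintegral_mkcond; apply: eq_Rintegral => x _; rewrite patchE.
    case: ifPn => //; rewrite notin_setE /B ball_itv /= in_itv /= => /negP.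
    rewrite negb_and -!leNgt => /orP H; rewrite mollifier_out ?mulr0 ?subrr//.
    by case: H => H; [left|right] => //; have := h0 n; move: H; rewrite -/(h n); set r := h n; lra.
  have iD : itg (B n) (fun x => g a * mollifier a n x - g x * mollifier a n x).
    by apply: (@itg_sub R _ setT) => //; apply: itgB.
  have EQ : 2 / bump_mass * ((h n *+ 2)^-1 * I n) = n.+1%:R / bump_mass * I n.
    have -> : (h n *+ 2)^-1 = 2^-1 * n.+1%:R.
      have G (p q : R) : p = q^-1 -> (p *+ 2)^-1 = 2^-1 * q.
        by move=> ->; rewrite -(mulr_natl q^-1) invfM invrK.
      exact: G.
    by field; rewrite gt_eqF.
  rewrite EQ; apply: (@le_trans _ _ (integ (B n) (fun x => `|g a * mollifier a n x - g x * mollifier a n x|))).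
    by apply: le_normr_Rintegral; [exact: mB|exact: iD].
  have EI : n.+1%:R / bump_mass * I n = integ (B n) (fun x => n.+1%:R / bump_mass * `|g x - g a|).
    by rewrite /I RintegralZl; [|exact: mB|exact: iB].
  rewrite EI; apply: le_Rintegral; [exact: mB|by apply: itg_norm; [exact: mB|exact: iD]|
    by apply: itgZ; [exact: mB|exact: iB]|].
  move=> x _; rewrite -mulrBl normrM mulrC distrC.
    by rewrite ler_wpM2r// mollifier_bound.
apply/cvgrPdist_le => eps eps0.
have e1 : 0 < eps * bump_mass / 2 by rewrite divr_gt0// mulr_gt0.
have /cvgr0_norm_le/(_ _ e1) H := C; apply: filterS H => n /ler_normlW Hn.
apply: le_trans (bd n) _; rewrite mulrAC ler_pdivrMr// mulrC.
by rewrite -ler_pdivlMr.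
Unshelve. all: by end_near. Qed.


Definition weakly_derives g w := forall phi : R -> R, test_function phi ->
  integ setT (fun x => g x * derive1 phi x) = - integ setT (fun x => w x * phi x).

(** Testing with smooth approximations of the indicator function of ]a, b]: their
    derivatives concentrate at a and b. *)
Lemma weak_increment g w a b : a < b ->
  measurable_fun setT g -> itg setT (fun s => g s ^+ 2) ->
  measurable_fun setT w -> itg setT (fun s => w s ^+ 2) ->
  weakly_derives g w -> lebesgue_pt g a -> lebesgue_pt g b ->
  g b - g a = integ `[a, b] w.
Proof.
move=> ab mg ig mw iw gw La Lb.
have Ca := lebesgue_pt_mollify mg ig La; have Cb := lebesgue_pt_mollify mg ig Lb.
have n1 n : (1 : R) <= n.+1%:R by rewrite ler1n.
have n0 n : (0 : R) < n.+1%:R by [].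
pose phi n := cutoff a b n.+1%:R.
have E n : integ setT (fun x => w x * phi n x) =
    integ setT (fun x => g x * mollifier b n x) - integ setT (fun x => g x * mollifier a n x).
  have T : test_function (phi n) by apply: test_cutoff => //; exact: ltW.
  apply: oppr_inj; rewrite -(gw _ T) opprB -RintegralB//; try exact: itg_mollify.
  by apply: eq_Rintegral => x _; rewrite /phi derive1_cutoff mulrBr.
pose W x := `|w x| * \1_(`[a, b + 1]) x.
have iW : itg setT W.
  have [] // := @itg_supp W a (b + 1).
    move=> x H; rewrite /W indicE memNset ?mulr0//= in_itv /= => /andP[p q].
    by case: H => H; [move: p|move: q]; rewrite leNgt H.
  have i1 := itg_norm (measurable_itv _) (itg_local a (b + 1) mw iw).
  apply: (@itg_le R `[a, b + 1]%classic W (fun x => `|w x|)) => //.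
    apply: measurable_funTS; apply: measurable_funM; first exact: measurableT_comp.
    exact: measurable_indic.
  move=> x _; rewrite /W normrM normr_id ler_piMr// indicE.
  by case: (_ \in _); rewrite ?normr0 ?normr1.
have phi_le n x : `|phi n x| <= \1_(`[a, b + 1]) x.
  have /andP[p q] := step_bound (n.+1%:R * (x - a)).
  have /andP[r s] := step_bound (n.+1%:R * (x - b)).
  have P1 : `|phi n x| <= 1 by rewrite /phi /cutoff ler_norml; apply/andP; split; lra.
  rewrite indicE; case: (boolP (x \in _)) => [_|xn]; first exact: P1.
  have [xa|xa] := leP x a.
    rewrite /phi /cutoff (step_out _).1 ?pmulr_rle0 ?subr_le0// (step_out _).1 ?subrr ?normr0//.
    by rewrite pmulr_rle0// subr_le0 (le_trans xa)// ltW.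
  have [xb|xb] := leP x (b + 1).
    by move: xn; rewrite notin_setE /= in_itv /= (ltW xa) xb.
  have big (c : R) : c <= b -> 1 <= n.+1%:R * (x - c).
    by move=> cb; rewrite (le_trans (n1 n))// ler_peMr ?(ltW (n0 n))//; lra.
  by rewrite /phi /cutoff ((step_out _).2 (big a (ltW ab))) ((step_out _).2 (big b (lexx _))) subrr normr0.
have phi_cvg x : phi n x @[n --> \oo] --> (\1_(`]a, b]) x : R).
  have S (c : R) : c < x -> \forall n \near \oo, step (n.+1%:R * (x - c)) = 1.
    move=> cx; near=> n; apply: (step_out _).2.
    rewrite -ler_pdivrMr ?subr_gt0// mul1r.
    have : (x - c)^-1 <= n%:R by near: n; exact: nbhs_infty_ger.
    by move=> H; rewrite (le_trans H)// ler_nat.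
  have Z (c : R) n : x <= c -> step (n.+1%:R * (x - c)) = 0.
    by move=> xc; rewrite (step_out _).1// pmulr_rle0// subr_le0.
  have K (v : R) : (\forall n \near \oo, phi n x = v) -> phi n x @[n --> \oo] --> v.
    by move=> H; apply: cvg_near_cst; exact: H.
  apply: K; rewrite indicE; have [xa|xa] := leP x a.
    rewrite memNset /=; last by rewrite in_itv /= => /andP[]; rewrite ltNge xa.
    by near=> n; rewrite /phi /cutoff !Z ?subrr// (le_trans xa)// ltW.
  have [xb|xb] := leP x b.
    rewrite mem_set /=; last by rewrite in_itv /= xa xb.
    near=> n; rewrite /phi /cutoff (Z b)// subr0; near: n; exact: S.
  rewrite memNset /=; last by rewrite in_itv /= => /andP[_]; rewrite leNgt xb.
  near=> n; rewrite /phi /cutoff.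
  have -> : step (n.+1%:R * (x - a)) = 1 by near: n; exact: S.
  have -> : step (n.+1%:R * (x - b)) = 1 by near: n; exact: S.
  by rewrite subrr.
have mphi n : measurable_fun setT (fun x => w x * phi n x).
  apply: measurable_funM => //; apply: cont_meas => x.
  have cs (c : R) : {for x, continuous (fun x => step (n.+1%:R * (x - c)))}.
    have dl : isd (fun x => n.+1%:R * (x - c)) x n.+1%:R by deriv; cbv beta; ring.
    exact: is_derive_cont (@dcomp R (fun x => n.+1%:R * (x - c)) step x _ _ (is_derive_step _) dl).
  by have c1 := cs a; have c2 := cs b; rewrite /phi /cutoff; conti.
have [_ C] := @dct R setT (fun n x => w x * phi n x) (fun x => w x * \1_(`]a, b]) x) W
  measurableT mphi (fun x _ => cvgMr (phi_cvg x)) iW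
  (fun n x _ => ltac:(by rewrite normrM ler_wpM2l)).
have D : integ setT (fun x => g x * mollifier b n x) - integ setT (fun x => g x * mollifier a n x)
    @[n --> \oo] --> g b - g a by apply: cvgB; [exact: Cb|exact: Ca].
rewrite -(cvg_lim _ D)//; apply/cvg_lim => //.
have -> : integ `[a, b] w = integ setT (fun x => w x * \1_(`]a, b]) x).
  rewrite -Rintegral_itv_obnd_cbnd; last first.
    apply: (@itg_sub R _ `[a, b]%classic) => //; last exact: itg_local.
    by apply: subset_itv; rewrite bnd_simp.
  rewrite Rintegral_mkcond; apply: eq_Rintegral => x _; rewrite patchE indicE.
  by case: (_ \in _); rewrite ?mulr1 ?mulr0.
by apply: cvg_trans C; apply: near_eq_cvg; near=> n; rewrite E.
Unshelve. all: by end_near. Qed.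

(** Absolute continuity with derivative [w], in integrated form. *)
Definition increments g w := forall a b, a <= b -> g b - g a = integ `[a, b] w.

(** Almost every point is a Lebesgue point of [g]; integrating [w] from one of them
    reproduces [g] at all the others. *)
Lemma weak_representative g w :
  measurable_fun setT g -> itg setT (fun s => g s ^+ 2) ->
  measurable_fun setT w -> itg setT (fun s => w s ^+ 2) ->
  weakly_derives g w ->
  exists2 k, {ae mu, forall x, g x = k x} & increments k w.
Proof.
move=> mg ig mw iw gw.
have Lg : {ae mu, forall x, lebesgue_pt g x}.
  apply: lebesgue_differentiation; split => //; first exact: openT.
  move=> K _ cK; have [M [_ HM]] := compact_bounded cK.
  have KM : K `<=` `[- (M + 1), M + 1].
    by move=> x Kx; rewrite /= in_itv /= -ler_norml; apply: HM => //; rewrite ltrDl.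
  have /integrableP[_] := itg_local (- (M + 1)) (M + 1) mg ig.
  apply: le_lt_trans; apply: ge0_subset_integral => //.
  - exact: closed_measurable (compact_closed (@Rhausdorff R) cK).
  - by apply/measurable_EFinP; apply: measurableT_comp => //; exact: measurable_funTS.
have [a _ La] := ae_dense 0 Lg ltr01.
pose k x := if a <= x then g a + integ `[a, x] w else g a - integ `[x, a] w.
exists k.
  apply: (ae_weak Lg) => x Lx; rewrite /k; case: (ltgtP a x) => ax.
  - by rewrite -(weak_increment ax mg ig mw iw gw La Lx) addrC subrK.
  - by rewrite -(weak_increment ax mg ig mw iw gw Lx La) opprB addrC subrK.
  - by rewrite ax integ_itv_same addr0.
move=> x y xy; rewrite /k; case: (leP a x) => ax; case: (leP a y) => ay.
- rewrite (@integ_chasles_itg a x y) ?ax//; last exact: itg_local.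
  by move: (integ _ _) (integ _ _) => p q; ring.
- by have := le_trans ax xy; rewrite leNgt ay.
- rewrite (@integ_chasles_itg x a y) ?(ltW ax)//; last exact: itg_local.
  by move: (integ _ _) (integ _ _) => p q; ring.
- rewrite (@integ_chasles_itg x y a) ?xy ?ltW//; last exact: itg_local.
  by move: (integ _ _) (integ _ _) => p q; ring.
Qed.

Lemma increment_bound k w (l x y : R) : increments k w -> measurable_fun setT w ->
  itg setT (fun s => w s ^+ 2) -> 0 < l ->
  `|k y - k x| <= (l * `|y - x| + l^-1 * integ setT (fun s => w s ^+ 2)) / 2.
Proof.
move=> kw mw iw l0; wlog xy : x y / x <= y.
  move=> H; have [/H//|/ltW/H] := leP x y.
  by rewrite distrC (distrC x).
rewrite (kw _ _ xy) [`|y - x|]ger0_norm ?subr_ge0//.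
apply: le_trans (young_increment mw iw l0 xy).
by apply: le_normr_Rintegral => //; exact: itg_local.
Qed.

Lemma increment_cont k w : increments k w -> measurable_fun setT w ->
  itg setT (fun s => w s ^+ 2) -> continuous k.
Proof.
move=> kw mw iw x; apply/cvgrPdist_le => eps eps0.
set J := integ setT (fun s => w s ^+ 2).
have J0 : 0 <= J by apply: Rintegral_ge0 => s _; exact: sqr_ge0.
(* with this weight each of the two terms of the bound is at most eps *)
pose l := (J + 1) / eps; have l0 : 0 < l by rewrite divr_gt0//; lra.
near=> y; rewrite distrC; apply: le_trans (increment_bound x y kw mw iw l0) _.
have H : `|y - x| <= eps / l.
  near: y; have C : {for x, continuous (fun y : R => y - x)} by conti.
  have /cvgr_norm_le := C; rewrite subrr normr0; apply; exact: divr_gt0.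
rewrite -/J; have A : l * `|y - x| <= eps by rewrite mulrC -ler_pdivlMr.
have B : l^-1 * J <= eps.
  rewrite /l invf_div mulrAC ler_pdivrMr; last by lra.
  by rewrite ler_pM2l//; lra.
by lra.
Unshelve. all: by end_near. Qed.

(** On a unit interval [k] oscillates boundedly, and its mean is controlled by its
    square integral. *)
Lemma increment_bounded k w : increments k w -> continuous k ->
  itg setT (fun s => k s ^+ 2) -> measurable_fun setT w ->
  itg setT (fun s => w s ^+ 2) -> exists B, forall x, `|k x| <= B.
Proof.
move=> kw ck ik mw iw; have mk : measurable_fun setT k by exact: cont_meas.
set J := integ setT (fun s => w s ^+ 2); set J2 := integ setT (fun s => k s ^+ 2).
exists ((1 + J2) / 2 + (1 + J) / 2) => x; have x1 : x <= x + 1 by rewrite lerDl.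
have Y := young_increment mk ik ltr01 x1.
have i1 : itg `[x, x + 1] (fun s => `|k s|) by apply: itg_norm => //; exact: itg_local.
have ic (c : R) : itg `[x, x + 1] (fun=> c).
  by apply: continuous_itg => s _; exact: (@cst_continuous R R c s).
have : integ `[x, x + 1] (fun=> `|k x|) <= integ `[x, x + 1] (fun s => `|k s| + (1 + J) / 2).
  apply: le_Rintegral => //; first exact: itgD.
  move=> s; rewrite /= in_itv /= => /andP[xs sx].
  have H := increment_bound x s kw mw iw ltr01; rewrite -/J in H.
  have : `|k x| <= `|k s| + `|k s - k x|.
    by have := ler_normB (k s) (k s - k x); rewrite subKr.
  have : `|s - x| <= 1 by rewrite ger0_norm; lra.
  by move: H; rewrite mul1r invr1 mul1r; lra.
rewrite RintegralD// !integ_cst//.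
by move: Y; rewrite -/J2 invr1 !mul1r; lra.
Qed.

Lemma increment_derive k w u : increments k w -> measurable_fun setT w ->
  {ae mu, forall x, w x = u x} -> continuous u -> forall x : R, is_derive x 1 k (u x).
Proof.
move=> kw mw wu cu x.
have inc a b : a <= b -> k b - k a = integ `[a, b] u.
  move=> ab; rewrite (kw _ _ ab) /Rintegral; congr fine; apply: ae_eq_integral => //.
  - by apply/measurable_EFinP; exact: measurable_funTS.
  - by apply/measurable_EFinP; apply: measurable_funTS; exact: cont_meas.
  - by apply: (ae_weak wu) => s /= -> _.
have E : k = (fun y => prim u y + k 0).
  apply/funext => y; rewrite /prim; case: (leP 0 y) => y0.
    by rewrite -inc// subrK.
  by rewrite -inc ?ltW// opprB subrK.
rewrite E; have d := is_derive_prim x cu.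
by apply: (isd_eq (dD d (dC x _))); rewrite addr0.
Qed.

Lemma ae_itg_sq g k : itg setT (fun s => g s ^+ 2) -> continuous k ->
  {ae mu, forall x, g x = k x} -> itg setT (fun s => k s ^+ 2).
Proof.
move=> ig ck gk; have mk2 : measurable_fun setT (fun s => k s ^+ 2).
  by apply: cont_meas => s; have c := ck s; conti.
apply/integrableP; split; first exact/measurable_EFinP.
have /integrableP[mg] := ig; apply: le_lt_trans.
rewrite le_eqVlt; apply/orP; left; apply/eqP; apply: ae_eq_integral => //.
- by apply: measurableT_comp => //; exact/measurable_EFinP.
- exact: measurableT_comp.
- by apply: (ae_weak gk) => s /= -> _.
Qed.

(** Each weak derivative of order at most 4 agrees almost everywhere with a
    continuous function whose increments are integrals of the next one; [F] itself,
    being continuous, agrees with its representative everywhere. *)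
Theorem sobolev5_profile F : Sobolev 5 F -> continuous F ->
  exists F1 F2 F3 F4, [/\ [/\ forall x : R, is_derive x 1 F (F1 x),
      forall x : R, is_derive x 1 F1 (F2 x), forall x : R, is_derive x 1 F2 (F3 x) &
      forall x : R, is_derive x 1 F3 (F4 x)], continuous F4,
    [/\ itg setT (fun s => F s ^+ 2), itg setT (fun s => F1 s ^+ 2),
        itg setT (fun s => F2 s ^+ 2), itg setT (fun s => F3 s ^+ 2) &
        itg setT (fun s => F4 s ^+ 2)] &
    exists B, forall x, [/\ `|F x| <= B, `|F1 x| <= B, `|F2 x| <= B, `|F3 x| <= B &
      `|F4 x| <= B]].
Proof.
move=> [LF HF] cF.
have [w1 L1 W1] := HF 1%N isT; have [w2 L2' W2] := HF 2%N isT; have [w3 L3 W3] := HF 3%N isT.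
have [w4 L4 W4] := HF 4%N isT; have [w5 L5 W5] := HF 5%N isT.
have wd0 : weakly_derives F w1.
  by move=> phi T; have := W1 phi T; rewrite derive1n1 expr1 mulN1r.
have wd j u v : weak_derivative j F u -> weak_derivative j.+1 F v -> weakly_derives u v.
  move=> U V phi T; have T' : test_function (derive1 phi).
    case: T => T1 [M TM]; split=> [n x|]; first by have := T1 n.+1 x; rewrite /derive1n iterSr.
    exists M => x Mx; rewrite derive1E.
    have N : \forall y \near x, (0 : R) = phi y.
      have C : {for x, continuous (fun y : R => `|y|)} := @norm_continuous R R x.
      have N0 : \forall y \near x, M < `|y| by apply: (cvgr_gt `|x| C).
      by apply: filterS N0 => y /TM.
    have D : is_derive x 1 (fun=> 0 : R) 0 by exact: is_derive_cst.
    by have [_ ->] := near_eq_is_derive N D.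
  have := U _ T'; have := V _ T; rewrite /derive1n iterSr exprS => -> E.
  have sg : (-1 : R) ^+ j != 0 by rewrite expf_neq0// oppr_eq0 oner_eq0.
  by apply: (mulfI sg); rewrite -E mulN1r mulNr mulrN.
have [m0 i0] := L2_itg LF; have [m1 i1] := L2_itg L1; have [m2 i2] := L2_itg L2'.
have [m3 i3] := L2_itg L3; have [m4 i4] := L2_itg L4; have [m5 i5] := L2_itg L5.
have [F4 e4 k4] := weak_representative m4 i4 m5 i5 (wd _ _ _ W4 W5).
have [F3 e3 k3] := weak_representative m3 i3 m4 i4 (wd _ _ _ W3 W4).
have [F2 e2 k2] := weak_representative m2 i2 m3 i3 (wd _ _ _ W2 W3).
have [F1 e1 k1] := weak_representative m1 i1 m2 i2 (wd _ _ _ W1 W2).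
have [F0 e0 k0] := weak_representative m0 i0 m1 i1 wd0.
have c4 := increment_cont k4 m5 i5; have c3 := increment_cont k3 m4 i4.
have c2 := increment_cont k2 m3 i3; have c1 := increment_cont k1 m2 i2.
have c0 := increment_cont k0 m1 i1.
have FE : F0 = F by apply/funext => x; apply: ae_eq_cont => //; apply: (ae_weak e0) => s ->.
rewrite {}FE in e0 k0 c0.
have q1 := ae_itg_sq i1 c1 e1; have q2 := ae_itg_sq i2 c2 e2.
have q3 := ae_itg_sq i3 c3 e3; have q4 := ae_itg_sq i4 c4 e4.
exists F1, F2, F3, F4; split=> //.
- split; [exact: increment_derive k0 m1 e1 c1|exact: increment_derive k1 m2 e2 c2|
    exact: increment_derive k2 m3 e3 c3|exact: increment_derive k3 m4 e4 c4].
- have [B0 H0] := increment_bounded k0 c0 i0 m1 i1; have [B1 H1] := increment_bounded k1 c1 q1 m2 i2.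
  have [B2 H2] := increment_bounded k2 c2 q2 m3 i3; have [B3 H3] := increment_bounded k3 c3 q3 m4 i4.
  have [B4 H4] := increment_bounded k4 c4 q4 m5 i5.
  have B0' : 0 <= B0 := le_trans (normr_ge0 _) (H0 0).
  have B1' : 0 <= B1 := le_trans (normr_ge0 _) (H1 0).
  have B2' : 0 <= B2 := le_trans (normr_ge0 _) (H2 0).
  have B3' : 0 <= B3 := le_trans (normr_ge0 _) (H3 0).
  have B4' : 0 <= B4 := le_trans (normr_ge0 _) (H4 0).
  exists (B0 + B1 + B2 + B3 + B4) => x.
  by split; [apply: le_trans (H0 x) _|apply: le_trans (H1 x) _|apply: le_trans (H2 x) _|
    apply: le_trans (H3 x) _|apply: le_trans (H4 x) _]; lra.
Qed.

End WeakDerivatives.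

(** * The interface at a fixed time *)
Section FixedTime.
Context {R : realType}.
Local Notation mu := (@lebesgue_measure R).
Context (F m m1 m2 m3 : R -> R) (B : R).
Context (dF : forall x : R, is_derive x 1 F (m x)).
Context (dm : forall x : R, is_derive x 1 m (m1 x)).
Context (dm1 : forall x : R, is_derive x 1 m1 (m2 x)).
Context (dm2 : forall x : R, is_derive x 1 m2 (m3 x)).
Context (cm3 : continuous m3).
Context (F2 : itg setT (fun s => F s ^+ 2)) (mL2 : itg setT (fun s => m s ^+ 2)).
Context (m1L2 : itg setT (fun s => m1 s ^+ 2)) (m2L2 : itg setT (fun s => m2 s ^+ 2)).
Context (m3L2 : itg setT (fun s => m3 s ^+ 2)).
Context (FB : forall x, `|F x| <= B) (mB : forall x, `|m x| <= B).
Context (m1B : forall x, `|m1 x| <= B) (m2B : forall x, `|m2 x| <= B).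

Lemma profile_cm : continuous m. Proof. by move=> x; exact: is_derive_cont (dm x). Qed.
Lemma profile_cm1 : continuous m1. Proof. by move=> x; exact: is_derive_cont (dm1 x). Qed.
Lemma profile_cm2 : continuous m2. Proof. by move=> x; exact: is_derive_cont (dm2 x). Qed.

Lemma derive1_profile : derive1 F = m.
Proof. by apply/funext => x; rewrite derive1E; have [_ ->] := dF x. Qed.

(** The inverse of the length element sqrt (1 + F'^2). *)
Definition inv_length (x : R) := (Num.sqrt (1 + m x ^+ 2))^-1.
Local Notation r := inv_length.

Lemma length_gt0 x : 0 < Num.sqrt (1 + m x ^+ 2).
Proof. by rewrite sqrtr_gt0 ltr_wpDr ?sqr_ge0. Qed.

Lemma inv_length_bound x : 0 < r x <= 1.
Proof.
rewrite /inv_length invr_gt0 length_gt0 /= invf_le1 ?length_gt0//.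
by rewrite -[X in X <= _]sqrtr1 ler_wsqrtr// lerDl sqr_ge0.
Qed.

Lemma curvatureE x : curvature F x = m1 x * r x ^+ 3.
Proof.
have E : derive1n 2 F x = m1 x.
  rewrite /derive1n /= derive1_profile derive1E; by have [_ ->] := dm x.
have p : 0 <= 1 + m x ^+ 2 by rewrite addr_ge0 ?sqr_ge0.
rewrite /curvature E derive1_profile /inv_length; congr (_ * _).
have -> : (3 / 2 : R) = 2^-1 * 3%:R by rewrite mulrC.
by rewrite powRrM powR12_sqrt// powR_mulrn ?sqrtr_ge0// exprVn.
Qed.

Lemma d_inv_length x : isd r x (- (m x * m1 x * r x ^+ 3)).
Proof.
have u0 : 0 < 1 + m x ^+ 2 by rewrite ltr_wpDr ?sqr_ge0.
have s0 := length_gt0 x; have sn : Num.sqrt (1 + m x ^+ 2) != 0 by rewrite gt_eqF.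
have du : isd (fun x => 1 + m x ^+ 2) x (2 * m x * m1 x).
  by have d1 : isd m x (m1 x) := dm x; deriv; cbv beta; ring.
have ds := @dcomp R (fun x => 1 + m x ^+ 2) Num.sqrt x _ _ (is_derive1_sqrt u0) du.
have H := @dV R (fun x => Num.sqrt (1 + m x ^+ 2)) x _ sn ds; rewrite /isd /inv_length exprVn; apply: (isd_eq H).
by move: (Num.sqrt _) sn => q sn; field.
Qed.

Definition dcurvature (x : R) := m2 x * r x ^+ 3 - 3 * (m x * m1 x * m1 x * r x ^+ 5).
Definition ddcurvature (x : R) := m3 x * r x ^+ 3
  - (9 * m x * m1 x * r x ^+ 5) * m2 x
  + (15 * m x ^+ 2 * m1 x ^+ 2 * r x ^+ 7 - 3 * m1 x ^+ 2 * r x ^+ 5) * m1 x.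

Lemma d_pow_inv_length x n : isd (fun x => r x ^+ n) x (- (n%:R * (m x * m1 x * r x ^+ n.+2))).
Proof.
have d := d_inv_length x; elim: n => [|n IH].
  by rewrite mul0r oppr0; exact: dC.
have -> : (fun x => r x ^+ n.+1) = (fun x => r x * r x ^+ n) by apply/funext => y; rewrite exprS.
by rewrite /isd; apply: (isd_eq (dM d IH)); rewrite !exprS -natr1; move: (r x ^+ n) (r x) => q t; ring.
Qed.

Lemma d_curvature (x : R) : is_derive x 1 (curvature F) (dcurvature x).
Proof.
have -> : curvature F = (fun x => m1 x * r x ^+ 3) by apply/funext => y; exact: curvatureE.
apply: (isd_eq (dM (dm1 x) (d_pow_inv_length x 3))); rewrite /dcurvature.
by move: (r x) => q; ring.
Qed.

Lemma d_dcurvature (x : R) : is_derive x 1 dcurvature (ddcurvature x).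
Proof.
have d3 := d_pow_inv_length x 3; have d5 := d_pow_inv_length x 5.
have e0 : isd m x (m1 x) := dm x; have e1 : isd m1 x (m2 x) := dm1 x.
have e2 : isd m2 x (m3 x) := dm2 x.
apply: (isd_eq (dD (dM e2 d3) (dN (dM (dC x 3) (dM (dM (dM e0 e1) e1) d5))))).
by rewrite /ddcurvature; move: (r x) => q; ring.
Qed.

Lemma derive1_curvature : derive1 (curvature F) = dcurvature.
Proof. by apply/funext => x; rewrite derive1E; have [_ ->] := d_curvature x. Qed.

Lemma pow_inv_length_le n x : `|r x ^+ n| <= 1.
Proof.
have /andP[r0 r1] := inv_length_bound x.
by rewrite ger0_norm ?exprn_ge0 ?(ltW r0)// exprn_ile1 ?(ltW r0).
Qed.

Lemma profile_B0 : 0 <= B. Proof. exact: le_trans (FB 0). Qed.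

Lemma dcurvature_le x : `|dcurvature x| <= 1 * `|m2 x| + 3 * B ^+ 2 * `|m1 x|.
Proof.
have B0 := profile_B0; rewrite /dcurvature (le_trans (ler_normB _ _))// lerD//.
  by rewrite mul1r normrM ler_piMr// pow_inv_length_le.
have -> : 3 * (m x * m1 x * m1 x * r x ^+ 5) = 3 * ((m x * m1 x * r x ^+ 5) * m1 x) by ring.
have -> : 3 * B ^+ 2 * `|m1 x| = 3 * (B ^+ 2 * `|m1 x|) by rewrite mulrA.
rewrite normrM [`|3|]ger0_norm// ler_pM2l// normrM ler_wpM2r//.
rewrite normrM -[B ^+ 2]mulr1 ler_pM ?pow_inv_length_le//.
by rewrite normrM expr2 ler_pM.
Qed.

Lemma ddcurvature_le x : `|ddcurvature x| <=
  1 * `|m3 x| + (9 * B ^+ 2 + 15 * B ^+ 4 + 3 * B ^+ 2) * `|(`|m1 x| + `|m2 x|)|.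
Proof.
have B0 := profile_B0; have P n : 0 <= B ^+ n by rewrite exprn_ge0.
rewrite (ger0_norm (addr_ge0 (normr_ge0 (m1 x)) (normr_ge0 (m2 x)))).
have A1 : `|m3 x * r x ^+ 3| <= `|m3 x| by rewrite normrM ler_piMr// pow_inv_length_le.
have Q : `|m x * m1 x| <= B ^+ 2 by rewrite normrM expr2 ler_pM.
have A2 : `|9 * m x * m1 x * r x ^+ 5| <= 9 * B ^+ 2.
  have -> : 9 * m x * m1 x * r x ^+ 5 = 9 * ((m x * m1 x) * r x ^+ 5) by ring.
  rewrite normrM ger0_norm// ler_pM2l// normrM -[B ^+ 2]mulr1.
  by rewrite ler_pM ?pow_inv_length_le.
have A3 : `|15 * m x ^+ 2 * m1 x ^+ 2 * r x ^+ 7| <= 15 * B ^+ 4.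
  have -> : 15 * m x ^+ 2 * m1 x ^+ 2 * r x ^+ 7 =
      15 * (((m x * m1 x) * (m x * m1 x)) * r x ^+ 7) by ring.
  rewrite normrM ger0_norm// ler_pM2l// normrM -[B ^+ 4]mulr1.
  rewrite ler_pM ?pow_inv_length_le// normrM.
  have -> : B ^+ 4 = B ^+ 2 * B ^+ 2 by ring.
  by rewrite ler_pM.
have A4 : `|3 * m1 x ^+ 2 * r x ^+ 5| <= 3 * B ^+ 2.
  rewrite -mulrA normrM ger0_norm// ler_pM2l// normrM -[B ^+ 2]mulr1.
  by rewrite ler_pM ?pow_inv_length_le// !expr2 normrM ler_pM.
rewrite /ddcurvature mul1r.
set c2 := 9 * m x * m1 x * r x ^+ 5 in A2 *.
set c3 := 15 * m x ^+ 2 * m1 x ^+ 2 * r x ^+ 7 in A3 *.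
set c4 := 3 * m1 x ^+ 2 * r x ^+ 5 in A4 *.
apply: le_trans (ler_normD _ _) _; apply: le_trans (lerD (ler_normB _ _) (lexx _)) _.
have H2 : `|c2 * m2 x| <= 9 * B ^+ 2 * `|m2 x| by rewrite normrM ler_wpM2r.
have H3 : `|(c3 - c4) * m1 x| <= (15 * B ^+ 4 + 3 * B ^+ 2) * `|m1 x|.
  by rewrite normrM ler_wpM2r// (le_trans (ler_normB _ _))// lerD.
have U1 : 0 <= 9 * B ^+ 2 * `|m1 x| by rewrite !mulr_ge0.
have U2 : 0 <= (15 * B ^+ 4 + 3 * B ^+ 2) * `|m2 x|.
  by rewrite mulr_ge0// addr_ge0// mulr_ge0.
apply: le_trans (lerD (lerD A1 H2) H3) _; rewrite -subr_ge0.
rewrite (_ : _ - _ = 9 * B ^+ 2 * `|m1 x| + (15 * B ^+ 4 + 3 * B ^+ 2) * `|m2 x|).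
  exact: addr_ge0.
by ring.
Qed.

Lemma cont_pow_inv_length n : continuous (fun x => r x ^+ n).
Proof. by move=> x; exact: is_derive_cont (d_pow_inv_length x n). Qed.

Lemma ddcurvature_cont : continuous ddcurvature.
Proof.
move=> x; have c0 := @profile_cm x; have c1 := @profile_cm1 x; have c2 := @profile_cm2 x.
have c3 := @cm3 x; have r3 := @cont_pow_inv_length 3 x; have r5 := @cont_pow_inv_length 5 x.
by have r7 := @cont_pow_inv_length 7 x; rewrite /ddcurvature; conti.
Qed.

Lemma dcurvature_cont : continuous dcurvature.
Proof. by move=> x; exact: is_derive_cont (d_dcurvature x). Qed.

Lemma dcurvature_L2 : itg setT (fun s => dcurvature s ^+ 2).
Proof. exact: (itg_sq_comb dcurvature_cont dcurvature_le m2L2 m1L2). Qed.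

Lemma ddcurvature_L2 : itg setT (fun s => ddcurvature s ^+ 2).
Proof.
have cv : continuous (fun s => `|m1 s| + `|m2 s|).
  move=> s; have c1 : {for s, continuous (fun s => `|m1 s|)}.
    by apply: (@ccomp R R _ Num.norm); [exact: norm_continuous|exact: profile_cm1].
  have c2 : {for s, continuous (fun s => `|m2 s|)}.
    by apply: (@ccomp R R _ Num.norm); [exact: norm_continuous|exact: profile_cm2].
  by conti.
have v2 : itg setT (fun s => (`|m1 s| + `|m2 s|) ^+ 2).
  apply: (itg_sq_comb (A := 1) (B := 1) cv _ m1L2 m2L2) => s.
  by rewrite !mul1r ger0_norm ?addr_ge0.
exact: (itg_sq_comb ddcurvature_cont ddcurvature_le m3L2 v2).
Qed.

Lemma dcurvature_bounded x : `|dcurvature x| <= B + 3 * B ^+ 2 * B.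
Proof.
apply: le_trans (dcurvature_le x) _; rewrite mul1r lerD//.
by rewrite ler_wpM2l// mulr_ge0// exprn_ge0// profile_B0.
Qed.

(** Otherwise F^2 would have a fixed amount of mass, by Lipschitz continuity, on
    intervals of fixed length that move to infinity. *)
Lemma profile_vanishes (eps : R) : 0 < eps -> exists M, forall x, M < `|x| -> `|F x| <= eps.
Proof.
move=> eps0; apply: contrapT => nex.
have /choice[u Hu] : forall n : nat, exists x, n%:R < `|x| /\ eps < `|F x|.
  move=> n; apply: contrapT => nz; apply: nex; exists n%:R => x nx.
  by rewrite leNgt; apply/negP => ex; apply: nz; exists x.
have B0 := profile_B0; have cF : continuous F by move=> x; exact: is_derive_cont (dF x).
(* over a distance h the function loses at most half of the value eps *)
pose h := eps / (2 * (B + 1)); have h0 : 0 < h by rewrite divr_gt0// mulr_gt0//; lra.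
pose I n : set R := `[u n, u n + h].
pose q n s := F s ^+ 2 * \1_(I n) s.
have cF2 : continuous (fun s => F s ^+ 2) by move=> s; have c := cF s; conti.
have mq n : measurable_fun setT (q n).
  apply: measurable_funM; first exact: cont_meas.
  by apply: measurable_indic; exact: measurable_itv.
have qle n s : setT s -> `|q n s| <= F s ^+ 2.
  move=> _; rewrite /q normrM [`|F s ^+ 2|]ger0_norm ?sqr_ge0// ler_piMr ?sqr_ge0// indicE.
  by case: (_ \in _); rewrite ?normr0 ?normr1.
have qcvg s : setT s -> q n s @[n --> \oo] --> (0 : R).
  move=> _; apply: cvg_near_cst; near=> n.
  rewrite /q indicE memNset ?mulr0// /I /= in_itv /= => /andP[us su].
  have nn : `|s| + h < n%:R by near: n; exact: nbhs_infty_gtr.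
  have [un _] := Hu n; have s1 := ler_norm s; have := ler_norm (- s); rewrite normrN => s2.
  by move: un; have [u0|u0] := leP 0 (u n); [rewrite ger0_norm//|rewrite ltr0_norm//]; lra.
have [_ C] := @dct R setT q (fun=> 0) (fun s => F s ^+ 2) measurableT mq qcvg F2 qle.
have low n : h * (eps / 2) ^+ 2 <= integ setT (q n).
  have -> : integ setT (q n) = integ (I n) (fun s => F s ^+ 2).
    rewrite [RHS]Rintegral_mkcond; apply: eq_Rintegral => s _; rewrite patchE /q indicE.
    by case: (_ \in _); rewrite ?mulr1 ?mulr0.
  have uh : u n <= u n + h by rewrite lerDl ltW.
  have -> : h * (eps / 2) ^+ 2 = integ (I n) (fun=> (eps / 2) ^+ 2).
    by rewrite /I (integ_cst _ uh); ring.
  apply: le_Rintegral => //.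
  - exact: measurable_itv.
  - by apply: continuous_itg => s _; exact: (@cst_continuous R R _ s).
  - by apply: continuous_itg => s _; exact: cF2.
  - move=> s; rewrite /I /= in_itv /= => /andP[us su].
    have [_ eu] := Hu n; have lp := lipschitz dF mB (u n) s.
    have sh : B * `|u n - s| <= eps / 2.
      have : `|u n - s| <= h by rewrite ler0_norm; lra.
      move=> H; apply: (@le_trans _ _ ((B + 1) * h)).
        by rewrite ler_pM//; lra.
      by rewrite /h le_eqVlt; apply/orP; left; apply/eqP; field; lra.
    have : `|F (u n)| <= `|F s| + `|F (u n) - F s|.
      by have := ler_normD (F s) (F (u n) - F s); rewrite addrC subrK.
    move=> H; rewrite -[F s ^+ 2]real_normK ?num_real// ler_pXn2r ?nnegrE ?divr_ge0//.
      by lra.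
    exact: ltW.
have z0 : integ setT (fun=> 0 : R) = 0 by rewrite /Rintegral integral0.
rewrite z0 in C; have l0 : 0 < h * (eps / 2) ^+ 2 by rewrite mulr_gt0// exprn_gt0// divr_gt0.
have /cvgr0_norm_lt/(_ _ l0)[n _ /(_ n (leqnn _)) /= Hn] := C.
by have := lt_le_trans Hn (low n); rewrite ltNge ler_norm.
Unshelve. all: by end_near. Qed.

Lemma profile_flat : F x @[x --> +oo] --> (0 : R) /\ F x @[x --> -oo] --> (0 : R).
Proof.
split; apply/cvgr0Pnorm_le => eps /profile_vanishes[M HM]; near=> x; apply: HM.
  by apply: lt_le_trans (ler_norm _); near: x; apply: nbhs_pinfty_gt; rewrite num_real.
rewrite -normrN; apply: lt_le_trans (ler_norm _); rewrite ltrNr.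
by near: x; apply: nbhs_ninfty_lt; rewrite num_real.
Unshelve. all: by end_near. Qed.

Context (k visc sigma g rhop rhom : R) (k0 : 0 < k) (visc0 : 0 < visc).
Local Notation Delta := (g * (rhom - rhop)).

(** The jump of the tangential velocity: the pressure jump differentiated along the
    interface and divided by minus mu / k, after inserting Darcy's law. *)
Definition strength (x : R) := k / visc * (Delta * m x - sigma * dcurvature x).

Lemma strength_two_phase : exists G1 G2 a b, two_phase F m strength G1 G2 a b.
Proof.
have cm := profile_cm; have cm1 := profile_cm1; have cd := dcurvature_cont.
pose w1 x := k / visc * (Delta * m1 x - sigma * ddcurvature x).
have dw (x : R) : is_derive x 1 strength (w1 x).
  have e1 : isd m x (m1 x) := dm x; have e2 : isd dcurvature x (ddcurvature x) := d_dcurvature x.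
  apply: (isd_eq (dM (dC x _) (dD (dM (dC x _) e1) (dN (dM (dC x _) e2))))).
  by rewrite /w1 !mulr0 !addr0.
have cw : continuous strength by move=> x; exact: is_derive_cont (dw x).
have cw1 : continuous w1.
  by move=> x; have c1 := @cm1 x; have c2 := @ddcurvature_cont x; rewrite /w1; conti.
have le (p q : R) : `|k / visc * (Delta * p - sigma * q)| <=
    `|k / visc| * `|Delta| * `|p| + `|k / visc| * `|sigma| * `|q|.
  rewrite normrM -!mulrA -mulrDr ler_wpM2l// (le_trans (ler_normB _ _))//.
  by rewrite !normrM mulrA.
apply: (@cauchy_two_phase R B B (`|k / visc| * `|Delta| * B +
  `|k / visc| * `|sigma| * (B + 3 * B ^+ 2 * B)) F m m1 strength w1) => //.
- move=> x; apply: le_trans (le _ _) _; rewrite lerD// ler_wpM2l// ?mulr_ge0//.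
  exact: dcurvature_bounded.
- by apply: (itg_sq_comb cw _ mL2 dcurvature_L2) => s; exact: le.
- by apply: (itg_sq_comb cw1 _ m1L2 ddcurvature_L2) => s; exact: le.
Qed.

(** The Plemelj formulas give the sums of the boundary values from both sides.  The
    normal velocity is continuous, so it is half its sum, and this is the right-hand
    side once the density is split by linearity; the principal values of the separate
    densities f' and kappa(f)' exist because each has its own Cauchy integral. *)
Lemma evolution_value G1 G2 a b x : two_phase F m strength G1 G2 a b ->
  [/\ PV_exists (capillary_integrand1 F x), PV_exists (capillary_integrand2 F x),
      PV_exists (gravity_integrand F x) &
      evolution_rhs k visc sigma Delta F x = G2 true (x, 0) - m x * G1 true (x, 0)].
Proof.
move=> TP; have cm := profile_cm.
have [H1 [H2 [ha [hb TPk]]]] : exists G1 G2 a b, two_phase F m dcurvature G1 G2 a b.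
  exact: (@cauchy_two_phase R B B (B + 3 * B ^+ 2 * B) F m m1 dcurvature ddcurvature dF dm
    profile_cm1 mB m1B d_dcurvature ddcurvature_cont dcurvature_bounded dcurvature_L2 ddcurvature_L2).
have [I1 [I2 [ia [ib TPm]]]] : exists G1 G2 a b, two_phase F m m G1 G2 a b.
  exact: (@cauchy_two_phase R B B B F m m1 m m1 dF dm profile_cm1 mB m1B dm profile_cm1 mB mL2 m1L2).
have [ak bk] := two_phase_PV dF cm mB x TPk.
have [am bm] := two_phase_PV dF cm mB x TPm.
have [aw bw] := two_phase_PV dF cm mB x TP.
have gr := gravity_PV dF cm FB am bm.
have lin q A1 A2 : has_PV (fun y => q y * m (x - y) / denominator F x y) A1 ->
    has_PV (fun y => q y * dcurvature (x - y) / denominator F x y) A2 ->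
    has_PV (fun y => q y * strength (x - y) / denominator F x y)
      (k / visc * Delta * A1 + - (k / visc * sigma) * A2).
  move=> h1 h2; apply: (has_PV_eq (has_PVD (has_PVZ (k / visc * Delta) h1)
    (has_PVZ (- (k / visc * sigma)) h2))) => // y; rewrite /strength.
  move: (q y) (m (x - y)) (dcurvature (x - y)) (denominator F x y)^-1 (k / visc) Delta.
  by move=> t1 t2 t3 t4 t5 t6; ring.
have Ea := has_PV_unique aw (lin _ _ _ am ak).
have Eb := has_PV_unique bw (lin _ _ _ bm bk).
have c1 : has_PV (capillary_integrand1 F x) (pi * (H1 true (x, 0) + H1 false (x, 0))).
  apply: (has_PV_eq bk) => // y; rewrite /capillary_integrand1 derive1_curvature /delta.
  by rewrite mulrAC.
have c2 : has_PV (capillary_integrand2 F x) (- pi * (H2 true (x, 0) + H2 false (x, 0))).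
  apply: (has_PV_eq ak) => // y; rewrite /capillary_integrand2 derive1_curvature.
  by rewrite mulrAC.
have c3 : has_PV (gravity_integrand F x) (- (- pi * (I2 true (x, 0) + I2 false (x, 0)) +
    m x * (pi * (I1 true (x, 0) + I1 false (x, 0))))).
  by apply: (has_PV_eq gr) => // y; rewrite /gravity_integrand derive1_profile.
split; [exact: c1.1|exact: c2.1|exact: c3.1|].
rewrite /evolution_rhs c1.2 c2.2 c3.2 derive1_profile.
have N := tp_normal TP x; have p0 : (pi : R) != 0 by rewrite gt_eqF// pi_gt0.
move: Ea Eb p0 N; move: (pi : R) (G1 true _) (G2 true _) (G1 false _) (G2 false _) => p u1 u2 v1 v2.
move: (H1 true _ + _) (H2 true _ + _) (I1 true _ + _) (I2 true _ + _) => h1 h2 i1 i2 Ea Eb p0 N.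
have vn : visc != 0 by rewrite gt_eqF.
have -> : sigma * k / (2 * p * visc) * m x * (p * h1) + sigma * k / (2 * p * visc) * (- p * h2)
    + Delta * k / (2 * p * visc) * (- (- p * i2 + m x * (p * i1))) =
  (2 * p)^-1 * (- m x * (k / visc * Delta * (p * i1) + - (k / visc * sigma) * (p * h1))
    - (k / visc * Delta * (- p * i2) + - (k / visc * sigma) * (- p * h2))).
  by field; rewrite p0 vn.
rewrite -Ea -Eb.
have -> : (2 * p)^-1 * (- m x * (p * (u1 + v1)) - - p * (u2 + v2)) =
  2^-1 * ((u2 - m x * u1) + (v2 - m x * v1)) by field.
by rewrite -N; field.
Qed.

Lemma above_phase : above F = phase 1 F.
Proof. by apply/seteqP; split => z; rewrite /above /phase /= /height mul1r subr_gt0. Qed.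

Lemma below_phase : below F = phase (-1) F.
Proof. by apply/seteqP; split => z; rewrite /below /phase /= /height mulN1r opprB subr_gt0. Qed.

Section FromMuskat.
Context (Ft : R -> R) (vp vm : R * R -> R * R) (pp pm : R * R -> R).
Context (regp : phase_regularity (above F) vp pp) (regm : phase_regularity (below F) vm pm).
Context (MP : muskat_problem k visc sigma g rhop rhom F Ft vp vm pp pm).

Lemma muskat_two_phase : exists G1 G2 a b, two_phase F m strength G1 G2 a b /\
  forall x, G1 true (x, 0) = (vp (x, F x)).1 /\ G2 true (x, 0) = (vp (x, F x)).2.
Proof.
have cm := profile_cm; have n1 : `|1 : R| = 1 by rewrite normr1.
have nN1 : `|-1 : R| = 1 by rewrite normrN normr1.
case: MP => [[divp darp vanp]] [divm darm vanm] jmp nrm _ _ _.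
move: regp regm divp darp vanp divm darm vanm; rewrite above_phase below_phase.
move=> [cvp [vp1 vp2] pp1 pp2] [cvm [vm1 vm2] pm1 pm2] divp darp vanp divm darm vanm.
have fp := flat_of_velocity n1 dF cvp vp1 vp2 divp (darcy_curl dF pp2 darp).
have fm := flat_of_velocity nN1 dF cvm vm1 vm2 divm (darcy_curl dF pm2 darm).
have tp := darcy_trace n1 dF cm k0 visc0 cvp pp1 darp.
have tm := darcy_trace nN1 dF cm k0 visc0 cvm pm1 darm.
have B1 (e : R) (v : R * R -> R * R) x : flatten e F v (x, 0) = v (x, F x).
  by rewrite flatten_inside// mulr0 addr0.
exists (fun i z => (if i then flatten 1 F vp z else flatten (-1) F vm z).1),
  (fun i z => (if i then flatten 1 F vp z else flatten (-1) F vm z).2),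
  (fun i z => if i then dx (fun z => (vp z).1) (z.1, F z.1 + 1 * z.2)
              else dx (fun z => (vm z).1) (z.1, F z.1 + -1 * z.2)),
  (fun i z => if i then dy (fun z => (vp z).1) (z.1, F z.1 + 1 * z.2)
              else dy (fun z => (vm z).1) (z.1, F z.1 + -1 * z.2)).
split; last by move=> x; rewrite B1.
split.
- by case; [exact: fp|exact: fm].
- by case; [exact: (vanish_of_velocity n1 dF vanp)|exact: (vanish_of_velocity nN1 dF vanm)].
- move=> x; rewrite !B1.
  have d1 : isd (fun s => pp (s, F s) - pm (s, F s)) x _ := dD (tp x) (dN (tm x)).
  have d2 : isd (fun s => sigma * curvature F s) x _ := dM (dC x sigma) (d_curvature x).
  have E : (fun s => pp (s, F s) - pm (s, F s)) = (fun s => sigma * curvature F s).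
    by apply/funext => s; exact: jmp.
  rewrite E in d1; have [_ D1] := d1; have [_ D2] := d2.
  move: D2; rewrite D1 mulr0 addr0 /strength.
  move: (vp _) (vm _) => [p1 p2] [q1 q2] /= D.
  have kn : k != 0 by rewrite gt_eqF.
  have vn : visc != 0 by rewrite gt_eqF.
  have -> : p1 + m x * p2 - (q1 + m x * q2) = k / visc * ((visc / k) * (p1 + m x * p2) - (visc / k) * (q1 + m x * q2)).
    by field; rewrite kn vn.
  congr (_ * _); move: D; move: (visc / k) => c; lra.
- move=> x; rewrite !B1; have := nrm x; rewrite /dot /unit_normal derive1_profile.
  have s0 : (Num.sqrt (1 + m x ^+ 2))^-1 != 0 by rewrite invr_eq0 gt_eqF// length_gt0.
  move: (vp _) (vm _) s0; move: (Num.sqrt _)^-1 => s [p1 p2] [q1 q2] s0 /=.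
  rewrite !scaleRE => E; apply: (mulfI s0).
  have -> : s * (p2 - m x * p1) = p1 * (s * - m x) + p2 * (s * 1) by ring.
  by rewrite E; ring.
Qed.

Lemma muskat_evolution : evolution_problem k visc sigma Delta F Ft.
Proof.
have [G1 [G2 [a [b [TP bd]]]]] := muskat_two_phase.
split; first by move=> x; have [h1 h2 h3 _] := evolution_value x TP.
apply: (ae_weak (muskat_kinematic_above MP)) => x ->.
have [_ _ _ ->] := evolution_value x TP; have [-> ->] := bd x.
by rewrite /dot /= derive1_profile; move: (vp _) => [p1 p2] /=; ring.
Qed.

End FromMuskat.

Lemma velocity_vanishes e g1 g2 : `|e| = 1 -> flat_vanish e F g1 g2 ->
  vanishes_at_infinity (phase e F) (velocity e F g1 g2).
Proof.
move=> e1 V eps eps0; have e3 : 0 < eps / 3 by rewrite divr_gt0.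
have [N HN] := V _ e3; exists (2 * Num.max N 0) => z.
rewrite (closure_phase e1 dF) /= => zP far.
have far' : N < `|z.1| \/ N < `|F z.1 + e * height e F z|.
  rewrite (height_inv e1).
  have := lt_le_trans far (enorm_le z).
  have N1 : N <= Num.max N 0 by rewrite le_max lexx.
  have [h|h] := ltP N `|z.1|; first by left.
  by move=> H; right; move: N1 H h; set q := Num.max N 0; lra.
have [h1 h2] := HN _ _ zP far'; apply: le_lt_trans (enorm_le _) _.
rewrite /velocity /unflatten /=; move: h1 h2; set a := `|_|; set b := `|_|; lra.
Qed.

(** The velocity is the Cauchy integral, the pressures are its potentials.  Their
    difference along the interface has the derivative of sigma kappa(f), so that one
    additive constant adjusts the jump condition. *)
Lemma evolution_muskat Ft : evolution_problem k visc sigma Delta F Ft ->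
  exists vp vm pp pm,
    [/\ phase_regularity (above F) vp pp, phase_regularity (below F) vm pm &
        muskat_problem k visc sigma g rhop rhom F Ft vp vm pp pm].
Proof.
move=> [_ Fte]; have [G1 [G2 [a [b TP]]]] := strength_two_phase.
have cm := profile_cm; have n1 : `|1 : R| = 1 by rewrite normr1.
have nN1 : `|-1 : R| = 1 by rewrite normrN normr1.
have kn : k != 0 by rewrite gt_eqF.
have vn : visc != 0 by rewrite gt_eqF.
have c0 : visc / k != 0 by rewrite mulf_neq0// invr_eq0.
have Gp : flat_field 1 m (G1 true) (G2 true) (a true) (b true) := tp_field TP true.
have Gm : flat_field (-1) m (G1 false) (G2 false) (a false) (b false) := tp_field TP false.
pose pm := pressure (-1) F m (G1 false) (G2 false) (visc / k) (rhom * g) 0.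
pose pp0 := pressure 1 F m (G1 true) (G2 true) (visc / k) (rhop * g) 0.
pose C := sigma * curvature F 0 - (pp0 (0, F 0) - pm (0, F 0)).
pose pp := pressure 1 F m (G1 true) (G2 true) (visc / k) (rhop * g) C.
pose vp := velocity 1 F (G1 true) (G2 true); pose vm := velocity (-1) F (G1 false) (G2 false).
have Bp x : vp (x, F x) = (G1 true (x, 0), G2 true (x, 0)) by exact: velocity_boundary.
have Bm x : vm (x, F x) = (G1 false (x, 0), G2 false (x, 0)) by exact: velocity_boundary.
have [divp darp] := construction_equations n1 dF cm Gp (rhop * g) C c0.
have [divm darm] := construction_equations nN1 dF cm Gm (rhom * g) 0 c0.
have kin (v : R * R -> R * R) i : (forall x, v (x, F x) = (G1 i (x, 0), G2 i (x, 0))) ->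
    kinematic_condition F Ft v.
  move=> Bv; apply: (ae_weak Fte) => x ->.
  have [_ _ _ ->] := evolution_value x TP.
  rewrite Bv /dot /= derive1_profile; have N := tp_normal TP x.
  by case: i {Bv}; [ring|rewrite N; ring].
exists vp, vm, pp, pm; split.
- by rewrite above_phase; exact: (construction_regular n1 dF cm Gp).
- by rewrite below_phase; exact: (construction_regular nN1 dF cm Gm).
split.
- rewrite above_phase; split; [exact: divp| |exact: (velocity_vanishes n1 (tp_vanish TP true))].
  by move=> z zP; have E := darp z zP; rewrite invf_div in E; exact: E.
- rewrite below_phase; split; [exact: divm| |exact: (velocity_vanishes nN1 (tp_vanish TP false))].
  by move=> z zP; have E := darm z zP; rewrite invf_div in E; exact: E.
- have d (x : R) : is_derive x 1 (fun s => pp (s, F s) - pm (s, F s) - sigma * curvature F s) 0.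
    have tp := construction_trace n1 dF cm Gp (visc / k) (rhop * g) C x.
    have tm := construction_trace nN1 dF cm Gm (visc / k) (rhom * g) 0 x.
    have dc : isd (curvature F) x (dcurvature x) := d_curvature x.
    apply: (isd_eq (dD (dD tp (dN tm)) (dN (dM (dC x sigma) dc)))).
    have T := tp_tangential TP x; move: T; rewrite /strength.
    move: (G1 true _) (G2 true _) (G1 false _) (G2 false _) (dcurvature x) => u1 u2 v1 v2 q T.
    rewrite mulr0 addr0.
    have -> : u1 + m x * u2 = v1 + m x * v2 + k / visc * (Delta * m x - sigma * q) by lra.
    by field; rewrite kn vn.
  move=> x; have [t _] := @mvt R _ (fun=> 0) 0 x (fun s _ => d s).
  have P0 : pp (0, F 0) = pp0 (0, F 0) + C by rewrite /pp /pp0 /pressure addr0.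
  rewrite mul0r P0 /C; move: (pp (x, F x)) (pm (x, F x)) (pp0 (0, F 0)) (pm (0, F 0)).
  move: (curvature F x) (curvature F 0) => c1 c2 p1 p2 p3 p4 E.
  apply/eqP; rewrite -subr_eq0 -E; apply/eqP; ring.
- move=> x; rewrite Bp Bm /dot /unit_normal derive1_profile /= !scaleRE.
  have N := tp_normal TP x; move: N; move: (Num.sqrt _)^-1 => s.
  move: (G1 true _) (G2 true _) (G1 false _) (G2 false _) => u1 u2 v1 v2 N.
  have -> : u1 * (s * - m x) + u2 * (s * 1) = s * (u2 - m x * u1) by ring.
  by rewrite N; ring.
- exact: profile_flat.
- exact: (kin _ true).
- exact: (kin _ false).
Qed.

End FixedTime.
(** * The equivalence *)
Theorem proposition2p1 (R : realType) (sigma : R) (T : \bar R)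
    (k visc g rhop rhom : R) (f ft : R -> R -> R) (f0 : R -> R)
    (sigma_ge0 : 0 <= sigma) (T_gt0 : (0 < T)%E)
    (k_gt0 : 0 < k) (visc_gt0 : 0 < visc) (g_ge0 : 0 <= g)
    (f_C1 : L2_C1_on [set t | 0 < t /\ (t%:E < T)%E] f ft)
    (f_C0 : L2_continuous_on [set t | 0 <= t /\ (t%:E < T)%E] f)
    (f_H5 : forall t, 0 < t -> (t%:E < T)%E ->
      Sobolev 5 (f t) /\ continuous (f t)) :
  ((exists (vp vm : R -> R * R -> R * R) (pp pm : R -> R * R -> R),
      forall t, 0 < t -> (t%:E < T)%E ->
        [/\ phase_regularity (above (f t)) (vp t) (pp t),
            phase_regularity (below (f t)) (vm t) (pm t) &
            muskat_problem k visc sigma g rhop rhom (f t) (ft t)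
              (vp t) (vm t) (pp t) (pm t)]) /\
   {ae leb, forall x, f 0 x = f0 x})
  <->
  ((forall t, 0 < t -> (t%:E < T)%E ->
      evolution_problem k visc sigma (g * (rhom - rhop)) (f t) (ft t)) /\
   {ae leb, forall x, f 0 x = f0 x}).

Proof.
have fixed t : 0 < t -> (t%:E < T)%E ->
    (forall vp vm pp pm, phase_regularity (above (f t)) vp pp ->
      phase_regularity (below (f t)) vm pm ->
      muskat_problem k visc sigma g rhop rhom (f t) (ft t) vp vm pp pm ->
      evolution_problem k visc sigma (g * (rhom - rhop)) (f t) (ft t)) /\
    (evolution_problem k visc sigma (g * (rhom - rhop)) (f t) (ft t) ->
      exists vp vm pp pm, [/\ phase_regularity (above (f t)) vp pp,
        phase_regularity (below (f t)) vm pm &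
        muskat_problem k visc sigma g rhop rhom (f t) (ft t) vp vm pp pm]).
  move=> t0 tT; have [S cf] := f_H5 t t0 tT.
  have [F1 [F2 [F3 [F4 [[d0 d1 d2 d3] c4 [i0 i1 i2 i3 i4] [B HB]]]]]] := sobolev5_profile S cf.
  have b0 x : `|f t x| <= B by have [] := HB x.
  have b1 x : `|F1 x| <= B by have [] := HB x.
  have b2 x : `|F2 x| <= B by have [] := HB x.
  have b3 x : `|F3 x| <= B by have [] := HB x.
  split=> [vp vm pp pm rp rm MP|EP].
    exact: (muskat_evolution d0 d1 d2 d3 c4 i1 i2 i3 i4 b0 b1 b2 b3 k_gt0 visc_gt0 rp rm MP).
  exact: (evolution_muskat d0 d1 d2 d3 c4 i0 i1 i2 i3 i4 b0 b1 b2 b3 k_gt0 visc_gt0 EP).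
split=> -[H init]; split=> //.
  move=> t t0 tT; have [vp [vm [pp [pm HH]]]] := H.
  by have [rp rm MP] := HH t t0 tT; exact: (fixed t t0 tT).1 rp rm MP.
have /choice[q Hq] : forall t : R, exists q : (R * R -> R * R) * (R * R -> R * R) *
    (R * R -> R) * (R * R -> R), 0 < t -> (t%:E < T)%E ->
    [/\ phase_regularity (above (f t)) q.1.1.1 q.1.2,
        phase_regularity (below (f t)) q.1.1.2 q.2 &
        muskat_problem k visc sigma g rhop rhom (f t) (ft t) q.1.1.1 q.1.1.2 q.1.2 q.2].
  move=> t; have [[t0 tT]|nt] := pselect (0 < t /\ (t%:E < T)%E).
    have [vp [vm [pp [pm HH]]]] := (fixed t t0 tT).2 (H t t0 tT).
    by exists (vp, vm, pp, pm).
  by exists (fun=> (0, 0), fun=> (0, 0), fun=> 0, fun=> 0) => t0 tT; case: nt.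
exists (fun t => (q t).1.1.1), (fun t => (q t).1.1.2), (fun t => (q t).1.2), (fun t => (q t).2).
by move=> t t0 tT; exact: Hq.
Qed.
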